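(* Let $(J,F)$ be an invariant balanced Hermitian structure on a $6$-dimensional nilmanifold $M$ whose underlying Lie algebra $\mathfrak g$ is non-abelian. Then there is a basis $\{e^1,\ldots,e^6\}$ of (invariant, global) $1$-forms on $M$ satisfying $$Je^1=-e^2,\quad Je^3=-e^4,\quad Je^5=-e^6,\qquad F=e^{12}+e^{34}+e^{56},$$ and one of the following systems of equations: (A) $de^1=de^2=de^3=de^4=0$, $\ de^5=t(e^{13}-e^{24})$, $\ de^6=t(e^{14}+e^{23})$, where $t\in\mathbb R^*$; (B) $de^1=de^2=de^3=de^4=0$, $$de^5=\tfrac{t}{s}(\rho+b^2)e^{13}-\tfrac{t}{s}(\rho-b^2)e^{24},\qquad de^6=-2t(e^{12}-e^{34})+\tfrac{t}{s}(\rho-b^2)e^{14}+\tfrac{t}{s}(\rho+b^2)e^{23},$$ where $\rho\in\{0,1\}$, $b\in\mathbb R$ and $s,t\in\mathbb R^*$; (C) $de^1=de^2=de^3=de^4=0$, $$de^5=sY\big[2b^2u_1|u|(e^{12}-e^{34})-b^2tu_1|u|Y(e^{13}+e^{24})+2\rho su_1(e^{13}-e^{24})+2su_2\big((\rho-b^2)e^{14}+(\rho+b^2)e^{23}\big)\big],$$ $$de^6=sY\big[2(2s^2-b^2u_2)|u|(e^{12}-e^{34})+b^2tu_2|u|Y(e^{13}+e^{24})-2\rho su_2(e^{13}-e^{24})+2su_1\big((\rho-b^2)e^{14}+(\rho+b^2)e^{23}\big)\big],$$ where $\rho\in\{0,1\}$, $b,s\in\mathbb R$, $t\in\mathbb R^*$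 and $u=u_1+iu_2\in\mathbb C^*$ ($u_1,u_2\in\mathbb R$) are such that $s^2>|u|^2>0$, and $Y=\frac{2\sqrt{s^2-|u|^2}}{|u|t}$; (D) $de^1=de^2=de^5=0$, $\ de^3=\frac{2s}{r}e^{15}$, $\ de^4=\frac{2s}{r}e^{25}$, $\ de^6=\pm\frac{2}{rs}(e^{13}+e^{24})$, where $r,s\in\mathbb R^*$; (E) $de^1=de^2=0$, $$de^3=\tfrac{s}{rtZ}\Big[\pm\tfrac{t^2}{s^2}(e^{13}+e^{24})\pm\tfrac{t^2}{s^2}(st+Z)(e^{25}-e^{16})+e^{14}+\tfrac{1}{st+Z}e^{15}\Big],$$ $$de^4=\tfrac{s}{rtZ}\Big[e^{24}+\tfrac{1}{st+Z}e^{25}\Big],\qquad de^5=\tfrac{-s}{rtZ}\Big[(st+Z)e^{24}+e^{25}\Big],$$ $$de^6=\tfrac{s}{rtZ}\Big[\pm\tfrac{t^2}{s^2}\tfrac{1}{st+Z}(e^{13}+e^{24})\pm\tfrac{t^2}{s^2}(e^{25}-e^{16})+(st+Z)e^{14}+e^{15}\Big],$$ where $r,s,t\in\mathbb R^*$ are such that $s^2t^2>1$, and $Z=\sqrt{s^2t^2-1}$. Furthermore: in case (A) the complex structure $J$ is complex-parallelizable, i.e. $M$ is the Iwasawa manifold; for (B) and (C) the complex structure is nilpotent and $\mathfrak g$ is isomorphic to $\mathfrak h_2$, $\mathfrak h_3$, $\mathfrak h_4$, $\mathfrak h_5$ or $\mathfrak h_6$; abelian complex structures correspond to $\rho=0$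 in (B) and (C), and in such case $\mathfrak g\cong\mathfrak h_3$ or $\mathfrak h_5$ and we can take $b^2=\delta\in\{0,1\}$; finally, in the remaining cases (D) and (E) the Lie algebra $\mathfrak g$ is isomorphic to $\mathfrak h_{19}^-$ and the complex structure is non-nilpotent, where the $\pm$-sign in the equations corresponds to $J=J_0^{\pm}$, respectively.
   Context: A nilmanifold is a compact quotient $M=\Gamma\backslash G$ of a simply-connected nilpotent Lie group $G$ by a lattice $\Gamma$ of maximal rank; its underlying Lie algebra is the Lie algebra $\mathfrak g$ of $G$. Invariant objects on $M$ are those induced by left-invariant objects on $G$, i.e. by objects on $\mathfrak g$; $d$ is the Chevalley-Eilenberg differential on $\mathfrak g^*$, and $e^{ij}=e^i\wedge e^j$. A complex structure on $\mathfrak g$ is an endomorphism $J$ with $J^2=-\mathrm{Id}$ and $[JX,JY]=J[JX,Y]+J[X,JY]+[X,Y]$. It acts on $1$-forms by $(J\alpha)(X)=-\alpha(JX)$, and $(1,0)$-forms are the elements $\alpha\in\mathfrak g^*_{\mathbb C}$ with $J\alpha=i\alpha$ for this action. A Hermitian structure is a pair $(J,g)$ with $g(\cdot,\cdot)=g(J\cdot,J\cdot)$, equivalently $(J,F)$ with $F(X,Y)=g(X,JY)$; in dimension 6 it is balanced if $F\wedge F$ is closed. Put $\mathfrak g_0^J=0$ and $\mathfrak g_l^J=\{X\in\mathfrak g\mid [X,\mathfrak g]\subseteq\mathfrak g_{l-1}^J,\ [JX,\mathfrak g]\subseteq\mathfrak g_{l-1}^J\}$. $J$ is nilpotent if $\mathfrak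 g_l^J=\mathfrak g$ for some $l$, otherwise non-nilpotent; abelian if $[JX,JY]=[X,Y]$ for all $X,Y$; complex-parallelizable if $[JX,Y]=J[X,Y]$ for all $X,Y$. The Lie algebras are described by $(de^1,\ldots,de^6)$ in a suitable basis of the dual, with $ij$ standing for $e^{ij}$: $\mathfrak h_2=(0,0,0,0,12,34)$, $\mathfrak h_3=(0,0,0,0,0,12+34)$, $\mathfrak h_4=(0,0,0,0,12,14+23)$, $\mathfrak h_5=(0,0,0,0,13+42,14+23)$, $\mathfrak h_6=(0,0,0,0,12,13)$, $\mathfrak h_{19}^-=(0,0,0,12,23,14-35)$. $J_0^{\pm}$ denote the complex structures on $\mathfrak h_{19}^-$ given by a $(1,0)$-basis with $d\omega^1=0$, $d\omega^2=\omega^{13}+\omega^{1\bar3}$, $d\omega^3=\pm i(\omega^{1\bar2}-\omega^{2\bar1})$, where $\omega^{jk}=\omega^j\wedge\omega^k$, $\omega^{j\bar k}=\omega^j\wedge\overline{\omega^k}$; up to isomorphism these are the only two complex structures on $\mathfrak h_{19}^-$. The Iwasawa manifold corresponds to $\mathfrak h_5$ with the complex structure given by a $(1,0)$-basis with $d\omega^1=d\omega^2=0$, $d\omega^3=\omega^{12}$. *)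

(* Defs.v *)
From HB Require Import structures.
From mathcomp Require Import all_boot all_order all_algebra all_fingroup.
From mathcomp Require Import ring.
From mathcomp Require Import sesquilinear complex.
From mathcomp Require Import all_classical all_reals all_analysis.
Import Order.TTheory GRing.Theory Num.Theory.
Import numFieldNormedType.Exports.

Set Warnings "-notation-overridden,-notation-incompatible-prefix,-ambiguous-paths".
Set Implicit Arguments.
Unset Strict Implicit.
Unset Printing Implicit Defensive.

Local Open Scope classical_set_scope.
Local Open Scope ring_scope.

Record is_lie_bracket (R : realType) (V : vectType R) (br : V -> V -> V) :
  Prop := IsLieBracket {
    br_linearl : forall y, linear (br^~ y);
    br_linearr : forall x, linear (br x);
    br_alt : forall x, br x x = 0;
    br_jacobi : forall x y z,
      br x (br y z) + br y (br z x) + br z (br x y) = 0 }.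

Record lieAlgebra (R : realType) := LieAlgebra {
  lie_space :> vectType R;
  lie_br : lie_space -> lie_space -> lie_space;
  lie_brP : is_lie_bracket lie_br }.

Notation "⁅ x , y ⁆" := (lie_br x y) (at level 0) : ring_scope.

Section LieAlgebras.
Variable R : realType.
Implicit Types g h : lieAlgebra R.

Definition lie_abelian g := forall x y : g, ⁅x, y⁆ = 0.

Definition lie_nilpotent g :=
  exists k : nat, forall (s : k.-tuple g) (y : g),
    foldr (fun x z => ⁅x, z⁆) y s = 0.

Definition lie_iso g h :=
  exists2 f : 'Hom(g, h), bijective f &
    forall x y, f ⁅x, y⁆ = ⁅f x, f y⁆.

End LieAlgebras.

(* Every simply-connected nilpotent Lie group is isomorphic to exp(n) for some
   Lie algebra n of strictly upper triangular matrices; conversely each such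
   exp(n) is a closed simply-connected nilpotent subgroup of GL_n(R) with Lie
   algebra n. A nilmanifold Gamma\G is therefore given by its Lie algebra g, a
   faithful representation of g by such matrices, and Gamma in G = exp(g). *)
Section Nilmanifolds.
Variable R : realType.

(* The exponential series, which stops before the n-th power
   since A is n x n and strictly triangular. *)
Definition nilexp n (A : 'M[R]_n) : 'M[R]_n :=
  \sum_(k < n) (k`!%:R)^-1 *: A ^+ k.

Definition lie_group (g : lieAlgebra R) n (rho : 'Hom(g, 'M[R]_n)) :
  set 'M[R]_n := [set nilexp (rho x) | x in setT].

Record lattice_in n (G Gamma : set 'M[R]_n) : Prop := LatticeIn {
  lattice_sub : Gamma `<=` G;
  lattice_one : Gamma 1%:M;
  lattice_mul : forall A B, Gamma A -> Gamma B -> Gamma (A *m B);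
  lattice_inv : forall A, Gamma A -> Gamma (invmx A);
  lattice_discrete : exists2 U, nbhs (1%:M : 'M[R]_n) U &
    Gamma `&` U = [set 1%:M];
  lattice_cocompact : exists K : set 'M[R]_n, [/\ compact K, K `<=` G &
    forall A, G A -> exists C B, [/\ Gamma C, K B & A = C *m B]] }.

Record nilmanifold := Nilmanifold {
  nm_alg :> lieAlgebra R;
  nm_nilpotent : lie_nilpotent nm_alg;
  nm_size : nat;
  nm_rep : 'Hom(nm_alg, 'M[R]_nm_size);
  nm_rep_inj : injective nm_rep;
  nm_rep_br : forall x y, nm_rep ⁅x, y⁆ =
    nm_rep x *m nm_rep y - nm_rep y *m nm_rep x;
  nm_rep_upper : forall x (i j : 'I_nm_size), (j <= i)%N -> nm_rep x i j = 0;
  nm_lattice : set 'M[R]_nm_size;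
  nm_latticeP : lattice_in (lie_group nm_rep) nm_lattice }.

End Nilmanifolds.

(* K-valued n-forms on V = g (K = R or C), as functions of n vectors. The type
   does not impose that they are multilinear and alternating: all forms below
   are, being obtained from 1-forms by wedge products and ext_d, or being the
   fundamental 2-form of a Hermitian structure. *)
Definition kform (K : fieldType) (V : Type) (n : nat) := ('I_n -> V) -> K^o.

Section Forms.
Variables (K : fieldType) (R : realType) (g : lieAlgebra R).

Definition form1 (a : g -> K) : kform K g 1 := fun X => a (X ord0).

Definition wedge_form p q (a : kform K g p) (b : kform K g q) :
  kform K g (p + q) :=
  fun X => (p`!%:R * q`!%:R)^-1 * \sum_(s : 'S_(p + q)) (-1) ^+ s *
    (a (fun i => X (s (lshift q i))) * b (fun j => X (s (rshift p j)))).

Definition cons_arg n (x : g) (X : 'I_n -> g) : 'I_n.+1 -> g :=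
  fun i => if unlift ord0 i is Some j then X j else x.

(* (d a)(X_0, ..., X_n) is the sum over i < j of
   (-1)^(i+j) a([X_i, X_j], X_0, ..., ^X_i, ..., ^X_j, ..., X_n);
   for i < j, lift j i has value i, and lift j \o lift i avoids both. *)
Definition ext_d n (a : kform K g n.+1) : kform K g n.+2 :=
  fun X => \sum_(j < n.+2) \sum_(i < n.+1 | (i < j)%N) (-1) ^+ (i + j) *
    a (cons_arg ⁅X (lift j i), X j⁆ (fun m => X (lift j (lift i m)))).

End Forms.

Section ComplexStructures.
Variables (R : realType) (g : lieAlgebra R) (J : 'End(g)).

Definition complex_structure :=
  (forall X, J (J X) = - X) /\
  (forall X Y, ⁅J X, J Y⁆ = J ⁅J X, Y⁆ + J ⁅X, J Y⁆ + ⁅X, Y⁆).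

Definition abelian_cs := forall X Y, ⁅J X, J Y⁆ = ⁅X, Y⁆.

Definition parallelizable_cs := forall X Y, ⁅J X, Y⁆ = J ⁅X, Y⁆.

Fixpoint ascending_J (l : nat) : set g :=
  if l is l'.+1 then
    [set X | forall Y, ascending_J l' ⁅X, Y⁆ /\ ascending_J l' ⁅J X, Y⁆]
  else [set 0].

Definition nilpotent_cs := exists l, ascending_J l = setT.

Definition dual_space := 'Hom(g, R^o).

Definition J_dual (a : dual_space) : dual_space := - (a \o J)%VF.

(* Complex 1-forms are the R-linear maps g -> C. *)
Definition is_10_form (w : g -> R[i]) :=
  (forall (a : R) X Y, w (a *: X + Y) = a%:C%C * w X + w Y) /\
  (forall X, - w (J X) = 'i%C * w X).

Definition is_10_basis (w1 w2 w3 : g -> R[i]) :=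
  [/\ is_10_form w1, is_10_form w2, is_10_form w3 &
    forall w, is_10_form w -> exists! c : R[i] * R[i] * R[i],
      forall X, w X = c.1.1 * w1 X + c.1.2 * w2 X + c.2 * w3 X].

Definition conj_form (w : g -> R[i]) : g -> R[i] := fun X => (w X)^*%C.

Local Notation "a ∧ b" := (wedge_form (form1 a) (form1 b)) (at level 40).
Local Notation d a := (ext_d (form1 a)).

Definition iwasawa_cs := exists w1 w2 w3, [/\ is_10_basis w1 w2 w3,
  d w1 = 0, d w2 = 0 & d w3 = w1 ∧ w2].

(* J_0^+ for [neg = false] and J_0^- for [neg = true]. *)
Definition J0_cs (neg : bool) := exists w1 w2 w3, [/\ is_10_basis w1 w2 w3,
  d w1 = 0, d w2 = w1 ∧ w3 + w1 ∧ conj_form w3 &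
  d w3 = ((-1) ^+ neg * 'i%C : R[i]) *:
           (w1 ∧ conj_form w2 - w2 ∧ conj_form w1)].

(* {dot g for idfun} is the library's type of symmetric positive definite
   bilinear forms on g. *)
Definition hermitian_metric (m : {dot g for idfun}) :=
  forall X Y, m (J X) (J Y) = m X Y.

Definition fundamental (m : {dot g for idfun}) : kform R g 2 :=
  fun X => m (X 0) (J (X 1)).

Definition balanced (m : {dot g for idfun}) :=
  ext_d (n := 3) (wedge_form (fundamental m) (fundamental m)) = 0.

End ComplexStructures.

Section Models.
Variable R : realType.
Local Notation V := 'rV[R]_6.

(* e^i(x), with i = 1, ..., 6 (not 0, ..., 5), and e^{ij}(x, y) *)
Definition crd (x : V) (i : nat) : R := x 0 (inord i.-1).
Definition crd2 (x y : V) (i j : nat) : R :=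
  crd x i * crd y j - crd x j * crd y i.
Local Notation w := crd2.

Definition row6 (s : seq R) : V := \row_k s`_k.

Lemma crd_ext x y : (forall i, (i < 6)%N -> crd x i.+1 = crd y i.+1) -> x = y.
Proof.
move=> xy; apply/rowP => i; have := xy i (ltn_ord i).
by rewrite /crd /= inord_val.
Qed.

Lemma crd_linear i : scalar (crd ^~ i).
Proof. by move=> a x y; rewrite /crd !mxE. Qed.

Lemma crdD x y i : crd (x + y) i = crd x i + crd y i.
Proof. by rewrite /crd !mxE. Qed.

Lemma crd0 i : crd 0 i = 0.
Proof. by rewrite /crd !mxE. Qed.

Lemma crd_row6 s i : (i < 6)%N -> crd (row6 s) i.+1 = s`_i.
Proof. by move=> i6; rewrite /crd mxE /= inordK. Qed.

(* The entry de^k(x, y) gives the k-th coordinate - de^k(x, y) of [x, y]. *)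
Definition br_h2 (x y : V) :=
  row6 [:: 0; 0; 0; 0; - w x y 1 2; - w x y 3 4].
Definition br_h3 (x y : V) :=
  row6 [:: 0; 0; 0; 0; 0; - (w x y 1 2 + w x y 3 4)].
Definition br_h4 (x y : V) :=
  row6 [:: 0; 0; 0; 0; - w x y 1 2; - (w x y 1 4 + w x y 2 3)].
Definition br_h5 (x y : V) :=
  row6 [:: 0; 0; 0; 0; - (w x y 1 3 + w x y 4 2); - (w x y 1 4 + w x y 2 3)].
Definition br_h6 (x y : V) :=
  row6 [:: 0; 0; 0; 0; - w x y 1 2; - w x y 1 3].
Definition br_h19m (x y : V) :=
  row6 [:: 0; 0; 0; - w x y 1 2; - w x y 2 3; - (w x y 1 4 - w x y 3 5)].

Ltac prove_lie_bracket :=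
  split; repeat (move=> ?); apply: crd_ext;
  case=> [|[|[|[|[|[|//]]]]]] _ /=;
  rewrite ?(crd_linear, crdD, crd0) !crd_row6 //= /crd2;
  rewrite ?crd_linear ?crd_row6 //= /crd2; ring.

Fact h2P : is_lie_bracket br_h2. Proof. prove_lie_bracket. Qed.
Fact h3P : is_lie_bracket br_h3. Proof. prove_lie_bracket. Qed.
Fact h4P : is_lie_bracket br_h4. Proof. prove_lie_bracket. Qed.
Fact h5P : is_lie_bracket br_h5. Proof. prove_lie_bracket. Qed.
Fact h6P : is_lie_bracket br_h6. Proof. prove_lie_bracket. Qed.
Fact h19mP : is_lie_bracket br_h19m. Proof. prove_lie_bracket. Qed.

Definition h2 := LieAlgebra h2P.
Definition h3 := LieAlgebra h3P.
Definition h4 := LieAlgebra h4P.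
Definition h5 := LieAlgebra h5P.
Definition h6 := LieAlgebra h6P.
Definition h19m := LieAlgebra h19mP.

End Models.

Section StructureEquations.
Variables (R : realType) (g : lieAlgebra R).

(* e = (e^1, ..., e^6); [coform e i] is e^i, [e2 i j] is e^{ij}. *)
Variable e : 6.-tuple (dual_space g).

Definition coform (i : nat) : dual_space g := e`_i.-1.

Local Notation de i := (ext_d (form1 (coform i))).
Local Notation e2 i j := (wedge_form (form1 (coform i)) (form1 (coform j))).

Definition adapted_basis (J : 'End(g)) (m : {dot g for idfun}) :=
  [/\ basis_of fullv e,
      J_dual J (coform 1) = - coform 2,
      J_dual J (coform 3) = - coform 4,
      J_dual J (coform 5) = - coform 6 &
      fundamental J m = e2 1 2 + e2 3 4 + e2 5 6].

Definition closed1234 := [/\ de 1 = 0, de 2 = 0, de 3 = 0 & de 4 = 0].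

Definition case_A (t : R) :=
  [/\ t != 0, closed1234,
      de 5 = t *: (e2 1 3 - e2 2 4) &
      de 6 = t *: (e2 1 4 + e2 2 3)].

Definition case_B (rho b s t : R) :=
  [/\ rho = 0 \/ rho = 1, s != 0 /\ t != 0, closed1234,
      de 5 = (t / s * (rho + b ^+ 2)) *: e2 1 3
             - (t / s * (rho - b ^+ 2)) *: e2 2 4 &
      de 6 = - (2 * t) *: (e2 1 2 - e2 3 4)
             + (t / s * (rho - b ^+ 2)) *: e2 1 4
             + (t / s * (rho + b ^+ 2)) *: e2 2 3].

(* u = u1 + i u2, modu = |u| *)
Definition case_C (rho b s t u1 u2 : R) :=
  let modu := Num.sqrt (u1 ^+ 2 + u2 ^+ 2) in
  let Y := 2 * Num.sqrt (s ^+ 2 - modu ^+ 2) / (modu * t) in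
  [/\ [/\ rho = 0 \/ rho = 1, t != 0 & 0 < modu ^+ 2 < s ^+ 2], closed1234,
      de 5 = (s * Y) *:
        ((2 * b ^+ 2 * u1 * modu) *: (e2 1 2 - e2 3 4)
         - (b ^+ 2 * t * u1 * modu * Y) *: (e2 1 3 + e2 2 4)
         + (2 * rho * s * u1) *: (e2 1 3 - e2 2 4)
         + (2 * s * u2) *: ((rho - b ^+ 2) *: e2 1 4
                            + (rho + b ^+ 2) *: e2 2 3)) &
      de 6 = (s * Y) *:
        ((2 * (2 * s ^+ 2 - b ^+ 2 * u2) * modu) *: (e2 1 2 - e2 3 4)
         + (b ^+ 2 * t * u2 * modu * Y) *: (e2 1 3 + e2 2 4)
         - (2 * rho * s * u2) *: (e2 1 3 - e2 2 4)
         + (2 * s * u1) *: ((rho - b ^+ 2) *: e2 1 4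
                            + (rho + b ^+ 2) *: e2 2 3))].

(* In the cases D and E the sign +- is (-1) ^+ neg. *)
Definition case_D (neg : bool) (r s : R) :=
  [/\ r != 0 /\ s != 0,
      [/\ de 1 = 0, de 2 = 0 & de 5 = 0],
      de 3 = (2 * s / r) *: e2 1 5,
      de 4 = (2 * s / r) *: e2 2 5 &
      de 6 = ((-1) ^+ neg * (2 / (r * s))) *: (e2 1 3 + e2 2 4)].

Definition case_E (neg : bool) (r s t : R) :=
  let Z := Num.sqrt (s ^+ 2 * t ^+ 2 - 1) in
  let k := (-1) ^+ neg * (t ^+ 2 / s ^+ 2) in
  [/\ [/\ r != 0, s != 0, t != 0 & 1 < s ^+ 2 * t ^+ 2],
      de 1 = 0 /\ de 2 = 0,
      de 3 = (s / (r * t * Z)) *: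
        (k *: (e2 1 3 + e2 2 4)
         + (k * (s * t + Z)) *: (e2 2 5 - e2 1 6)
         + e2 1 4 + (s * t + Z)^-1 *: e2 1 5),
      de 4 = (s / (r * t * Z)) *: (e2 2 4 + (s * t + Z)^-1 *: e2 2 5) &
      de 5 = (- s / (r * t * Z)) *: ((s * t + Z) *: e2 2 4 + e2 2 5) /\
      de 6 = (s / (r * t * Z)) *:
        ((k * (s * t + Z)^-1) *: (e2 1 3 + e2 2 4)
         + k *: (e2 2 5 - e2 1 6)
         + (s * t + Z) *: e2 1 4 + e2 1 5)].

End StructureEquations.

(* Main.v *)
From HB Require Import structures.
Require Import Defs.
From mathcomp Require Import all_boot all_order all_algebra all_fingroup.
From mathcomp Require Import ring lra.
From mathcomp Require Import sesquilinear complex.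
From mathcomp Require Import all_classical all_reals all_analysis.
Import Order.TTheory GRing.Theory Num.Theory.
Set Implicit Arguments.
Unset Strict Implicit.
Unset Printing Implicit Defensive.
Local Open Scope ring_scope.

(** A nilpotent Lie algebra has traceless adjoint maps. Hence d (F ∧ F) = 0 at
    five vectors of a unitary frame u_1, J u_1, u_2, J u_2, u_3, J u_3 becomes
    the linear equation [u_1, J u_1] + [u_2, J u_2] + [u_3, J u_3] = 0
    ([balanced_bracket_sum]). The classification starts from this equation and
    splits according to whether the center contains a J-invariant plane.

    Suppose that it contains one, spanned by c and J c. The quotient by it is a
    four-dimensional nilpotent Lie algebra in which the same trace vanishes, and
    the nilpotency of the adjoint maps forces it to be abelian
    ([abelian_mod_central_plane]). So d vanishes on the first two (1,0)-forms
    of a unitary coframe, and the integrability of J and the bracket equation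
    give dw3 = rho w^12 + (a primitive (1,1)-form in w1, w2). The latter is a
    trace-free complex 2 x 2 matrix, on which unitary changes of w1, w2 act by
    conjugation. Schur triangularization followed by changes of phase makes the
    matrix upper triangular and all coefficients real and nonnegative
    ([two_step_normal_form]). Equations (B) are this normal form when the
    diagonal is not zero and (A) when the matrix is zero; when only the diagonal
    is zero, one more rotation gives (C) ([two_step_cases]). The pair de^5, de^6
    then spans a pencil of 2-forms on a four-dimensional space; the wedge square
    is a quadratic form on the pencil. The isomorphism type of the Lie algebra
    is read off from the dimension of the pencil and the rank and signature of
    this form ([normal_form_models]).

    Suppose now that no such plane exists, and let w be a central unit vector.
    By integrability ad (J w) commutes with J; it is nilpotent, so it is
    strictly triangular in a suitable unitary frame u, x, w, and phases make its
    coefficients real: [J w, u] = t = mu x + nu w with mu > 0 and nu >= 0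
    ([exists_triangular_frame]). The Jacobi identity with J w, the bracket
    equation, integrability and Engel's theorem leave only one more parameter:
    all remaining brackets are determined by [u, t] = [J u, J t] = c w with c <> 0
    ([triangular_frame_brackets]). The frame satisfies (D) when nu = 0, and a
    rotation of the plane of x and w brings it to (E) when nu > 0. In both cases
    a linear change of (1,0)-forms gives the equations of J0^+ or J0^-,
    according to the sign of c; this sign is an invariant since it is the one of
    the double brackets [Y, [J W, Y]] relative to the central vector W
    ([J0_cs_sign]). *)

(** * Alternating sums and the exterior calculus in degrees one and two *)

Section AlternatingSums.
Variables (K : fieldType) (T : Type).

Definition alt2 (G : T -> T -> K) x y := G x y - G y x.
Definition alt3 (G : T -> T -> T -> K) x y z :=
  alt2 (G x) y z - alt2 (G y) x z + alt2 (G z) x y.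
Definition alt4 (G : T -> T -> T -> T -> K) x y z t :=
  alt3 (G x) y z t - alt3 (G y) x z t + alt3 (G z) x y t - alt3 (G t) x y z.

(** Laplace expansion: a permutation of n+1 indices is the image of the first
    one together with a permutation of the remaining ones. *)
Lemma sum_perm_lift n (G : 'S_n.+1 -> K) :
  \sum_(s : 'S_n.+1) (-1) ^+ s * G s =
  \sum_(i < n.+1) (-1) ^+ i *
    \sum_(s : 'S_n) (-1) ^+ s * G (lift_perm ord0 i s).
Proof.
pose f (p : 'I_n.+1 * 'S_n) := lift_perm ord0 p.1 p.2.
have f_inj : injective f.
  move=> [i s] [j t] /= /permP st.
  have ij : i = j by have := st ord0; rewrite !lift_perm_id.
  rewrite -{}ij in st *; congr (_, _); apply/permP => k.
  by have := st (lift ord0 k); rewrite !lift_perm_lift => /lift_inj.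
have f_bij : bijective f.
  apply: inj_card_bij => //.
  by rewrite card_prod !card_Sn card_ord factS.
rewrite (reindex f) /=; last by apply: onW_bij.
rewrite [RHS](eq_bigr (fun i : 'I_n.+1 => \sum_(s : 'S_n)
   (-1) ^+ i * ((-1) ^+ s * G (lift_perm ord0 i s)))); last first.
  by move=> i _; rewrite big_distrr.
rewrite pair_big /=; apply: eq_bigr => -[i s] _ /=.
by rewrite /f odd_lift_perm /= signr_addb signr_odd -mulrA.
Qed.

Lemma sum_perm_alt1 (G : T -> K) (x : 'I_1 -> T) :
  \sum_(s : 'S_1) (-1) ^+ s * G (x (s ord0)) = G (x ord0).
Proof.
rewrite (bigD1 1%g) //= big1 => [|s /negP[]]; last first.
  by apply/eqP/permP => i; rewrite !ord1.
by rewrite odd_perm1 perm1 addr0 mul1r.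
Qed.

Lemma sum_perm_alt2 (G : T -> T -> K) (x : 'I_2 -> T) :
  \sum_(s : 'S_2) (-1) ^+ s * G (x (s ord0)) (x (s (lift ord0 ord0))) =
  alt2 G (x ord0) (x (lift ord0 ord0)).
Proof.
rewrite (sum_perm_lift
  (fun s => G (x (s ord0)) (x (s (lift ord0 ord0))))) /=.
under eq_bigr => i _.
  under eq_bigr => s _ do rewrite lift_perm_id lift_perm_lift.
  rewrite (sum_perm_alt1 (fun y => G (x i) y) (fun k => x (lift i k))).
  over.
rewrite !big_ord_recl big_ord0 /alt2 /=.
have -> : lift (lift ord0 ord0) ord0 = ord0 :> 'I_2 by apply: val_inj.
by rewrite /bump /=; ring.
Qed.

Lemma sum_perm_alt3 (G : T -> T -> T -> K) (x : 'I_3 -> T) :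
  \sum_(s : 'S_3) (-1) ^+ s * G (x (s ord0)) (x (s (lift ord0 ord0)))
    (x (s (lift ord0 (lift ord0 ord0)))) =
  alt3 G (x ord0) (x (lift ord0 ord0)) (x (lift ord0 (lift ord0 ord0))).
Proof.
rewrite (sum_perm_lift (fun s => G (x (s ord0)) (x (s (lift ord0 ord0)))
    (x (s (lift ord0 (lift ord0 ord0)))))) /=.
under eq_bigr => i _.
  under eq_bigr => s _ do rewrite lift_perm_id !lift_perm_lift.
  rewrite (sum_perm_alt2 (fun y => G (x i) y) (fun k => x (lift i k))).
  over.
rewrite !big_ord_recl big_ord0 /alt3 /=.
set i0 : 'I_3 := ord0; set i1 : 'I_3 := lift ord0 ord0;
set i2 : 'I_3 := lift ord0 (lift ord0 ord0).
have -> : lift i1 ord0 = i0 by apply: val_inj.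
have -> : lift i2 ord0 = i0 by apply: val_inj.
have -> : lift i1 (lift ord0 ord0) = i2 by apply: val_inj.
have -> : lift i2 (lift ord0 ord0) = i1 by apply: val_inj.
by rewrite /bump /=; ring.
Qed.

Lemma sum_perm_alt4 (G : T -> T -> T -> T -> K) (x : 'I_4 -> T) :
  \sum_(s : 'S_4) (-1) ^+ s * G (x (s ord0)) (x (s (lift ord0 ord0)))
    (x (s (lift ord0 (lift ord0 ord0))))
    (x (s (lift ord0 (lift ord0 (lift ord0 ord0))))) =
  alt4 G (x ord0) (x (lift ord0 ord0)) (x (lift ord0 (lift ord0 ord0)))
    (x (lift ord0 (lift ord0 (lift ord0 ord0)))).
Proof.
rewrite (sum_perm_lift (fun s => G (x (s ord0)) (x (s (lift ord0 ord0)))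
    (x (s (lift ord0 (lift ord0 ord0))))
    (x (s (lift ord0 (lift ord0 (lift ord0 ord0))))))) /=.
under eq_bigr => i _.
  under eq_bigr => s _ do rewrite lift_perm_id !lift_perm_lift.
  rewrite (sum_perm_alt3 (fun y => G (x i) y) (fun k => x (lift i k))).
  over.
rewrite !big_ord_recl big_ord0 /alt4 /=.
set i0 : 'I_4 := ord0; set i1 : 'I_4 := lift ord0 ord0;
set i2 : 'I_4 := lift ord0 (lift ord0 ord0).
set i3 : 'I_4 := lift ord0 (lift ord0 (lift ord0 ord0)).
have -> : lift i1 ord0 = i0 by apply: val_inj.
have -> : lift i2 ord0 = i0 by apply: val_inj.
have -> : lift i3 ord0 = i0 by apply: val_inj.
have -> : lift i1 (lift ord0 ord0) = i2 by apply: val_inj.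
have -> : lift i2 (lift ord0 ord0) = i1 by apply: val_inj.
have -> : lift i3 (lift ord0 ord0) = i1 by apply: val_inj.
have -> : lift i1 (lift ord0 (lift ord0 ord0)) = i3 by apply: val_inj.
have -> : lift i2 (lift ord0 (lift ord0 ord0)) = i3 by apply: val_inj.
have -> : lift i3 (lift ord0 (lift ord0 ord0)) = i2 by apply: val_inj.
by rewrite /bump /=; ring.
Qed.
End AlternatingSums.

Section LowDegreeForms.
Variables (K : fieldType) (R : realType) (g : lieAlgebra R).
Implicit Types (a b : g -> K) (X : 'I_2 -> g).

Lemma ord2_1E : lift ord0 ord0 = 1 :> 'I_2.
Proof. exact: val_inj. Qed.

Lemma ext_d1E a X : ext_d (form1 a) X = - a ⁅X 0, X 1⁆.
Proof.
rewrite /ext_d !big_ord_recl big_ord0 big_mkcond big_ord1 /=.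
rewrite big_mkcond big_ord1 /= add0r addr0 /form1 /cons_arg unlift_none.
have -> : lift (lift ord0 ord0) ord0 = 0 :> 'I_2 by apply: val_inj.
by rewrite ord2_1E /bump /= mulN1r.
Qed.

Lemma wedge11E a b X :
  wedge_form (form1 a) (form1 b) X = a (X 0) * b (X 1) - a (X 1) * b (X 0).
Proof.
rewrite /wedge_form /form1 mul1r invr1 mul1r -ord2_1E.
rewrite -[RHS](sum_perm_alt2 (fun x y => a x * b y) X).
apply: eq_bigr => s _; do 2!congr (_ * _).
  by congr (a (X (s _))); apply: val_inj.
by congr (b (X (s _))); apply: val_inj.
Qed.

Lemma kformD (a b : kform K g 2) (X : 'I_2 -> g) : (a + b) X = a X + b X.
Proof. by []. Qed.
Lemma kformN (a : kform K g 2) (X : 'I_2 -> g) : (- a) X = - a X.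
Proof. by []. Qed.
Lemma kformZ (c : K) (a : kform K g 2) (X : 'I_2 -> g) : (c *: a) X = c * a X.
Proof. by []. Qed.
Lemma kform0 (X : 'I_2 -> g) : (0 : kform K g 2) X = 0.
Proof. by []. Qed.
Definition kformE := (kformD, kformN, kformZ, kform0, wedge11E).
End LowDegreeForms.

Section FourForms.
Variables (K : fieldType) (R : realType) (g : lieAlgebra R).

(** The 24 permutations fall into three classes of eight with equal terms, one
    for each splitting of the four arguments into two pairs; the factor
    1 / (2! 2!) leaves 2. *)
Lemma wedge22E (phi : g -> g -> K) (X : 'I_4 -> g) :
  (4%:R : K) != 0 -> (forall x y, phi y x = - phi x y) ->
  let F : kform K g 2 := fun Y => phi (Y 0) (Y 1) in
  wedge_form F F X =
  2%:R * (phi (X 0) (X 1) * phi (X 2%:R) (X 3%:R)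
          - phi (X 0) (X 2%:R) * phi (X 1) (X 3%:R)
          + phi (X 0) (X 3%:R) * phi (X 1) (X 2%:R)).
Proof.
move=> n4 phiC /=; rewrite /wedge_form /=.
have := sum_perm_alt4 (fun x y z t => phi x y * phi z t) X.
have e1 : lift ord0 ord0 = 1 :> 'I_4 by apply: val_inj.
have e2 : lift ord0 (lift ord0 ord0) = 2%:R :> 'I_4 by apply: val_inj.
have e3 : lift ord0 (lift ord0 (lift ord0 ord0)) = 3%:R :> 'I_4.
  by apply: val_inj.
have e0 : ord0 = 0 :> 'I_4 by apply: val_inj.
rewrite e1 e2 e3 e0.
move=> sumE.
rewrite -[X in _ * X]/(\sum_(s : 'S_4) (-1) ^+ s *
  (phi (X (s (lshift 2 (0 : 'I_2)))) (X (s (lshift 2 (1 : 'I_2)))) *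
   phi (X (s (rshift 2 (0 : 'I_2)))) (X (s (rshift 2 (1 : 'I_2)))))).
have -> : lshift 2 (0 : 'I_2) = 0 :> 'I_4 by apply: val_inj.
have -> : lshift 2 (1 : 'I_2) = 1 :> 'I_4 by apply: val_inj.
have -> : rshift 2 (0 : 'I_2) = 2%:R :> 'I_4 by apply: val_inj.
have -> : rshift 2 (1 : 'I_2) = 3%:R :> 'I_4 by apply: val_inj.
rewrite sumE /alt4 /alt3 /alt2.
rewrite (phiC (X 0) (X 1)) (phiC (X 0) (X 2%:R)) (phiC (X 0) (X 3%:R)).
rewrite (phiC (X 1) (X 2%:R)) (phiC (X 1) (X 3%:R)) (phiC (X 2%:R) (X 3%:R)).
have n2 : (2%:R : K) != 0.
  by apply: contraNneq n4 => e; rewrite (natrM _ 2 2) e mul0r.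
have -> : (2`!%:R * 2`!%:R : K) = 4%:R by rewrite -natrM.
by field.
Qed.

Lemma cons_arg0 n (x : g) (X : 'I_n -> g) : cons_arg x X ord0 = x.
Proof. by rewrite /cons_arg unlift_none. Qed.

Lemma cons_argS n (x : g) (X : 'I_n -> g) i : cons_arg x X (lift ord0 i) = X i.
Proof. by rewrite /cons_arg liftK. Qed.

Lemma ext_d4E (phi : g -> g -> g -> g -> K) (x0 x1 x2 x3 x4 : g) :
  let a : kform K g 4 := fun Y => phi (Y 0) (Y 1) (Y 2%:R) (Y 3%:R) in
  ext_d a (fun i : 'I_5 => nth 0 [:: x0; x1; x2; x3; x4] i) =
  - phi ⁅x0, x1⁆ x2 x3 x4 + phi ⁅x0, x2⁆ x1 x3 x4 - phi ⁅x0, x3⁆ x1 x2 x4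
  + phi ⁅x0, x4⁆ x1 x2 x3 - phi ⁅x1, x2⁆ x0 x3 x4 + phi ⁅x1, x3⁆ x0 x2 x4
  - phi ⁅x1, x4⁆ x0 x2 x3 - phi ⁅x2, x3⁆ x0 x1 x4 + phi ⁅x2, x4⁆ x0 x1 x3
  - phi ⁅x3, x4⁆ x0 x1 x2.
Proof.
rewrite /ext_d /=.
under eq_bigr => j _ do rewrite big_mkcond !big_ord_recl big_ord0 /=.
rewrite !big_ord_recl big_ord0 /=.
have e1 : 1 = lift ord0 ord0 :> 'I_4 by apply: val_inj.
have e2 : 2%:R = lift ord0 (lift ord0 ord0) :> 'I_4 by apply: val_inj.
have e3 : 3%:R = lift ord0 (lift ord0 (lift ord0 ord0)) :> 'I_4.
  by apply: val_inj.
have e0 : 0 = ord0 :> 'I_4 by apply: val_inj.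
rewrite e3 e2 e1 e0 !cons_arg0 !cons_argS /bump /=.
ring.
Qed.
End FourForms.

(** * Nilpotent Lie algebras *)

Section LieBracket.
Variables (R : realType) (g : lieAlgebra R).
Implicit Types (x y z : g) (a : R).

Lemma lieDl x y z : ⁅x + y, z⁆ = ⁅x, z⁆ + ⁅y, z⁆.
Proof. by have := br_linearl (lie_brP g) z 1 x y; rewrite /= !scale1r. Qed.
Lemma lieDr x y z : ⁅z, x + y⁆ = ⁅z, x⁆ + ⁅z, y⁆.
Proof. by have := br_linearr (lie_brP g) z 1 x y; rewrite /= !scale1r. Qed.
Lemma lie0l x : ⁅0, x⁆ = 0.
Proof. by apply: (addIr ⁅0, x⁆); rewrite -lieDl !add0r. Qed.
Lemma lie0r x : ⁅x, 0⁆ = 0.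
Proof. by apply: (addIr ⁅x, 0⁆); rewrite -lieDr !add0r. Qed.
Lemma lieZl a x y : ⁅a *: x, y⁆ = a *: ⁅x, y⁆.
Proof.
by have := br_linearl (lie_brP g) y a x 0; rewrite /= lie0l !addr0.
Qed.
Lemma lieZr a x y : ⁅x, a *: y⁆ = a *: ⁅x, y⁆.
Proof.
by have := br_linearr (lie_brP g) x a y 0; rewrite /= lie0r !addr0.
Qed.
Lemma lieNl x y : ⁅- x, y⁆ = - ⁅x, y⁆.
Proof. by rewrite -scaleN1r lieZl scaleN1r. Qed.
Lemma lieNr x y : ⁅x, - y⁆ = - ⁅x, y⁆.
Proof. by rewrite -scaleN1r lieZr scaleN1r. Qed.
Lemma liexx x : ⁅x, x⁆ = 0.
Proof. exact: (br_alt (lie_brP g)). Qed.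
Lemma lieC x y : ⁅y, x⁆ = - ⁅x, y⁆.
Proof.
apply/eqP; rewrite -addr_eq0.
by have := liexx (x + y); rewrite lieDl !lieDr !liexx add0r addr0 addrC => ->.
Qed.
Lemma lie_jacobi x y z : ⁅x, ⁅y, z⁆⁆ = ⁅⁅x, y⁆, z⁆ + ⁅y, ⁅x, z⁆⁆.
Proof.
have := br_jacobi (lie_brP g) x y z.
rewrite (lieC x z) lieNr (lieC ⁅x, y⁆ z) => /eqP.
by rewrite -addrA -opprD subr_eq0 => /eqP->; rewrite addrC.
Qed.
End LieBracket.

Definition lieE := (lieDl, lieDr, lieZl, lieZr, lieNl, lieNr, lie0l, lie0r,
  liexx).

Section Linearity.
Variables (R : realType) (V : vectType R).

Lemma endoD (f : 'End(V)) x y : f (x + y) = f x + f y.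
Proof. exact: linearD. Qed.
Lemma endoZ (f : 'End(V)) (a : R) x : f (a *: x) = a *: f x.
Proof. exact: linearZ. Qed.
Lemma endoN (f : 'End(V)) x : f (- x) = - f x.
Proof. exact: linearN. Qed.
Lemma endo0 (f : 'End(V)) : f 0 = 0.
Proof. exact: linear0. Qed.

(** Turns an equation between vectors into one between scalars, which ring
    can solve. *)
Lemma functional_ext (v w : V) :
  (forall f : V -> R, (forall x y, f (x + y) = f x + f y) ->
     (forall a x, f (a *: x) = a * f x) -> (forall x, f (- x) = - f x) ->
     f 0 = 0 -> f v = f w) ->
  v = w.
Proof.
move=> vw; rewrite (coord_vbasis (memvf v)) (coord_vbasis (memvf w)).
apply: eq_bigr => i _; congr (_ *: _).
apply: (vw (coord (vbasis fullv) i : V -> R)).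
- exact: linearD.
- by move=> a x; rewrite linearZ.
- exact: linearN.
- exact: linear0.
Qed.
End Linearity.

Definition endoE := (endoD, endoZ, endoN, endo0).

Ltac by_functional :=
  let f := fresh "f" in let fD := fresh "fD" in let fZ := fresh "fZ" in
  let fN := fresh "fN" in let f0 := fresh "f0" in
  apply: functional_ext; intros f fD fZ fN f0;
  rewrite ?endoE ?lieE ?endoE ?(fD, fZ, fN, f0); ring.

Definition subspace_pred (R : realType) (V : lmodType R) (S : V -> Prop) :=
  S 0 /\ forall (a : R) x y, S x -> S y -> S (a *: x + y).

Section SubspacePred.
Variables (R : realType) (V : lmodType R) (S : V -> Prop).
Hypothesis subS : subspace_pred S.

Lemma subspaceD x y : S x -> S y -> S (x + y).
Proof. by move=> Sx Sy; rewrite -[x]scale1r; apply: subS.2. Qed.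
Lemma subspaceZ a x : S x -> S (a *: x).
Proof. by move=> Sx; rewrite -[_ *: _]addr0; apply: subS.2 => //; case: subS. Qed.
Lemma subspaceN x : S x -> S (- x).
Proof. by move=> Sx; rewrite -scaleN1r; apply: subspaceZ. Qed.
Lemma subspaceB x y : S x -> S y -> S (x - y).
Proof. by move=> Sx Sy; apply: subspaceD => //; apply: subspaceN. Qed.
End SubspacePred.

Lemma subspace_zero (R : realType) (V : lmodType R) :
  subspace_pred (fun v : V => v = 0).
Proof. by split=> // a x y -> ->; rewrite scaler0 addr0. Qed.

Section Nilpotent.
Variables (R : realType) (g : lieAlgebra R).
Hypothesis nilp : lie_nilpotent g.

Lemma ad_nilpotent : exists k, forall x y : g, iter k (lie_br x) y = 0.
Proof.
have [k kP] := nilp; exists k => x y.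
have <- : foldr (fun x z => ⁅x, z⁆) y (nseq k x) = iter k (lie_br x) y.
  by elim: k {kP} => //= k ->.
exact: (kP (nseq_tuple k x)).
Qed.

Lemma foldr_lie0 (s : seq g) : foldr (fun x z => ⁅x, z⁆) 0 s = 0.
Proof. by elim: s => //= x s ->; rewrite lie0r. Qed.

Lemma nilpotent_foldr : exists k, forall (s : seq g) y, (k <= size s)%N ->
  foldr (fun x z => ⁅x, z⁆) y s = 0.
Proof.
have [k kP] := nilp; exists k => s y ks.
have sz : size (drop (size s - k) s) == k by rewrite size_drop subKn.
rewrite -(cat_take_drop (size s - k) s) foldr_cat.
by rewrite -[drop _ _]/(tval (Tuple sz)) kP foldr_lie0.
Qed.

(** Among the iterated brackets outside S, w is one of maximal length. *)
Lemma nilpotent_center_mod (S : g -> Prop) :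
  S 0 -> (exists y, ~ S y) -> exists2 w, ~ S w & forall x, S ⁅x, w⁆.
Proof.
move=> S0 [y nSy]; have [k kP] := nilp.
have {kP} : forall s : seq g, size s = k ->
    forall z, S (foldr (fun x z => ⁅x, z⁆) z s).
  by move=> s sk z; rewrite (kP (Tuple (introT eqP sk)) z).
elim: k => [|k IHk] kP; first by case: nSy; apply: (kP [::]).
case: (pselect (forall s : seq g, size s = k ->
    forall z, S (foldr (fun x z => ⁅x, z⁆) z s))) => [/IHk //|].
move=> /existsNP[s /not_implyP[sk /existsNP[z nSz]]].
exists (foldr (fun x z => ⁅x, z⁆) z s) => // x.
by apply: (kP (x :: s)) => /=; rewrite sk.
Qed.

(** Iterating ad x multiplies v by powers of a modulo S, whereas ad x is
    nilpotent. *)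
Lemma ad_eigenvalue0 (S : g -> Prop) x v (a : R) : subspace_pred S ->
  (forall y, S y -> S ⁅x, y⁆) -> S (⁅x, v⁆ - a *: v) -> ~ S v -> a = 0.
Proof.
move=> subS Sx Sv nSv; have [k kP] := ad_nilpotent.
have : S (iter k (lie_br x) v - a ^+ k *: v).
  elim: k {kP} => [|k IHk]; first by rewrite scale1r subrr; case: subS.
  rewrite iterS -[iter k _ _](subrK (a ^+ k *: v)) lieDr lieZr -addrA.
  apply: subspaceD => //; first exact: Sx.
  by rewrite exprSr -scalerA -scalerBr; apply: subspaceZ.
rewrite kP sub0r => /(subspaceN subS); rewrite opprK => akS.
have [/eqP|ak] := eqVneq (a ^+ k) 0; first by rewrite expf_eq0 => /andP[_ /eqP].
by case: nSv; rewrite -[v](scalerK ak); apply: subspaceZ.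
Qed.

(** On the plane of v and J v modulo S, the k-th iterate of ad x acts as
    (a + i b)^k; it vanishes for some k, so that (a^2 + b^2)^k annihilates v
    modulo S. *)
Lemma ad_complex_eigenvalue0 (J : 'End(g)) (S : g -> Prop) x v (a b : R) :
  (forall y, J (J y) = - y) -> subspace_pred S -> (forall y, S y -> S (J y)) ->
  (forall y, S y -> S ⁅x, y⁆) ->
  S (⁅x, v⁆ - (a *: v + b *: J v)) -> S (⁅x, J v⁆ - (a *: J v - b *: v)) ->
  ~ S v -> a = 0 /\ b = 0.
Proof.
move=> JJ subS SJ Sx Sv SJv nSv; have [k kP] := ad_nilpotent.
have [c [d [cd]]] : exists c d, c ^+ 2 + d ^+ 2 = (a ^+ 2 + b ^+ 2) ^+ k /\
    S (iter k (lie_br x) v - (c *: v + d *: J v)).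
  elim: k {kP} => [|k [c [d [cd IHk]]]].
    exists 1, 0; split; first by ring.
    by rewrite /= scale1r scale0r addr0 subrr; case: subS.
  exists (c * a - d * b), (c * b + d * a); split.
    by rewrite [RHS]exprSr -cd; ring.
  rewrite iterS -[iter k _ _](subrK (c *: v + d *: J v)) lieDr -addrA.
  apply: subspaceD => //; first exact: Sx.
  set u := (X in S X).
  have -> : u = c *: (⁅x, v⁆ - (a *: v + b *: J v)) +
      d *: (⁅x, J v⁆ - (a *: J v - b *: v)).
    by rewrite /u; by_functional.
  by apply: subspaceD => //; apply: subspaceZ.
rewrite kP sub0r => /(subspaceN subS); rewrite opprK => Scd.
have : S ((c ^+ 2 + d ^+ 2) *: v).
  have -> : (c ^+ 2 + d ^+ 2) *: v =
      c *: (c *: v + d *: J v) - d *: J (c *: v + d *: J v).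
    by rewrite !endoE JJ; by_functional.
  apply: subspaceB => //; apply: subspaceZ => //; exact: SJ.
have [cd0 _|nz] := eqVneq (c ^+ 2 + d ^+ 2) 0; last first.
  by move=> Sv0; case: nSv; rewrite -[v](scalerK nz); apply: subspaceZ.
move: cd; rewrite cd0 => /esym/eqP; rewrite expf_eq0 => /andP[_].
by rewrite paddr_eq0 ?sqr_ge0 // !sqrf_eq0 => /andP[/eqP-> /eqP->].
Qed.

Inductive bracket_span (P : g -> Prop) : g -> Prop :=
| BrSpanCentral z of (forall x, ⁅x, z⁆ = 0) : bracket_span P z
| BrSpanBracket (a : R) x v w of P v & bracket_span P w :
    bracket_span P (a *: ⁅x, v⁆ + w).

(** Nakayama's principle: substituting the hypothesis into itself writes each
    element of P, modulo the center, as a combination of brackets of any given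
    length. *)
Lemma bracket_span_central (P : g -> Prop) :
  (forall v, P v -> bracket_span P v) -> forall v, P v -> forall x, ⁅x, v⁆ = 0.
Proof.
move=> Pspan.
(* Downward induction on the number of brackets applied to v: long ones are
   zero, and the hypothesis on P trades a bracket less for a bracket more. *)
suff main k : forall s : seq g, size s = k.+1 -> forall v, P v ->
    foldr (fun x z => ⁅x, z⁆) v s = 0.
  by move=> v Pv x; apply: (main 0%N [:: x]).
have [N NP] := nilpotent_foldr; have [n] := ubnP (N - k).
elim: n k => // n IHn k; rewrite ltnS => Nkn s sk v Pv.
have [Nk|kN] := leqP N k; first by apply: NP; rewrite sk leqW.
elim: (Pspan v Pv) => [z z0|a x u w Pu _ IHw].
  case/lastP: s sk => // s x; rewrite size_rcons => -[sk].
  rewrite foldr_rcons z0.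
  exact: foldr_lie0.
have lin t y z : foldr (fun x z : g => ⁅x, z⁆) (a *: y + z) t =
    a *: foldr (fun x z : g => ⁅x, z⁆) y t + foldr (fun x z : g => ⁅x, z⁆) z t.
  by elim: t => //= b t ->; rewrite lieDr lieZr.
rewrite lin IHw addr0 -foldr_rcons (IHn k.+1) ?scaler0 ?size_rcons ?sk //.
by apply: leq_trans Nkn; rewrite ltn_sub2l.
Qed.
End Nilpotent.

(** * Linear algebra in dimension six *)

Section Functionals.
Variables (R : realType) (V : vectType R).

Definition functional (f : V -> R) (fL : linear (f : V -> R^o)) :
  'Hom(V, R^o) :=
  linfun (HB.pack_for {linear V -> R^o} (f : V -> R^o)
    (GRing.isLinear.Build R V R^o *:%R (f : V -> R^o) fL)).

Lemma functionalE f fL v : @functional f fL v = f v.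
Proof. by rewrite /functional lfunE. Qed.

Variable k : nat.
Variable e : 'I_k -> 'Hom(V, R^o).

Definition coords (v : V) : 'rV[R]_k := \row_i e i v.

Fact coords_linear : linear coords.
Proof. by move=> a x y; apply/rowP => i; rewrite !mxE linearP. Qed.
HB.instance Definition _ := GRing.isLinear.Build R V 'rV[R]_k _ coords
  coords_linear.

Lemma exists_common_kernel : (k < \dim {:V})%N ->
  exists2 v, v != 0 & forall i, e i v = 0.
Proof.
move=> kV; have : lker (linfun coords) != 0%VS.
  have := limg_ker_dim (linfun coords) fullv; rewrite capfv => dimE.
  rewrite -dimv_eq0 -lt0n -(ltn_add2r (\dim (limg (linfun coords)))) dimE.
  rewrite add0n (leq_ltn_trans _ kV) //.
  by rewrite (leq_trans (dimvS (subvf _))) // dimvf /dim /= mul1n.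
move=> /negP ker0; exists (vpick (lker (linfun coords))).
  by rewrite vpick0; apply/negP.
move=> i; have := memv_pick (lker (linfun coords)).
by rewrite memv_ker lfunE /= => /eqP/rowP/(_ i); rewrite !mxE.
Qed.

Lemma coords_surjective : \dim {:V} = k ->
  (forall v, (forall i, e i v = 0) -> v = 0) ->
  forall r : 'I_k -> R, exists v, forall i, e i v = r i.
Proof.
move=> dimV inj r.
have ker0 : lker (linfun coords) = 0%VS.
  apply/eqP; rewrite -subv0; apply/subvP => v.
  rewrite memv_ker lfunE memv0 /= => /eqP/rowP v0.
  by apply/eqP/inj => i; have := v0 i; rewrite !mxE.
have full : limg (linfun coords) = fullv.
  apply/eqP; rewrite eqEdim subvf /=.
  have := limg_ker_dim (linfun coords) fullv.
  by rewrite ker0 capv0 dimv0 add0n dimV dimvf /dim /= mul1n => ->.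
have : \row_i r i \in limg (linfun coords) by rewrite full memvf.
move=> /memv_imgP[v _]; rewrite lfunE /= => rE; exists v => i.
by have /rowP/(_ i) := rE; rewrite !mxE.
Qed.

Lemma coords_injective (b : 'I_k -> V) : \dim {:V} = k ->
  (forall i j, e i (b j) = (i == j)%:R) ->
  forall v, v = \sum_i e i v *: b i.
Proof.
move=> dimV dual v.
have full : limg (linfun coords) = fullv.
  apply/eqP; rewrite eqEsubv subvf /=.
  apply/subvP => r _; apply/memv_imgP; exists (\sum_i r 0 i *: b i).
    exact: memvf.
  rewrite lfunE; apply/rowP => i; rewrite !mxE linear_sum (bigD1 i) //=.
  rewrite linearZ /= dual eqxx big1 => [|j /negPf ji].
    by rewrite addr0; rewrite -[_ *: _]/(_ * _) mulr1.
  by rewrite linearZ /= dual eq_sym ji scaler0.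
have ker0 : lker (linfun coords) == 0%VS.
  have := limg_ker_dim (linfun coords) fullv.
  rewrite full dimV capfv [\dim {: 'rV_k}]dimvf /dim /= mul1n.
  by rewrite -[RHS]add0n => /addIn /eqP; rewrite dimv_eq0.
apply/(lker0P ker0); rewrite !lfunE; apply/rowP => i; rewrite !mxE.
rewrite linear_sum (bigD1 i) //= linearZ /= dual eqxx.
rewrite big1 => [|j /negPf ji].
  by rewrite addr0 -[_ *: 1]/(_ * _) mulr1.
by rewrite linearZ /= dual eq_sym ji scaler0.
Qed.
End Functionals.

(** The characteristic polynomial of a nilpotent matrix divides a power of X,
    hence is one, and the trace is one of its coefficients. *)
Lemma nilpotent_mxtrace (F : fieldType) n (A : 'M[F]_n.+1) k :
  A ^+ k = 0 -> \tr A = 0.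
Proof.
move=> Ak; pose B : 'M[{poly F}]_n.+1 := map_mx polyC A.
have Bk : B ^+ k = 0 by rewrite /B -rmorphXn /= Ak map_mx0.
have : (char_poly A %| ('X ^+ k) ^+ n.+1)%R.
  have XB : GRing.comm ('X%:M : 'M[{poly F}]_n.+1) B.
    by rewrite /GRing.comm -mulmxE scalar_mxC.
  have /(congr1 determinant) := subrXX_comm k XB.
  rewrite Bk subr0 -rmorphXn /= det_scalar -mulmxE det_mulmx => ->.
  exact: dvdp_mulr.
rewrite -exprM -['X]subr0 -polyC0 => /dvdp_exp_XsubCP[j] /=.
move=> jk; rewrite polyC0 subr0.
rewrite eqp_monic ?monicXn ?char_poly_monic // => /eqP charE.
have := size_char_poly A; rewrite charE size_polyXn => -[jn].
have := char_poly_trace A (isT : (0 < n.+1)%N).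
rewrite charE jn /= coefXn eqn_leq ltnn andbF => /esym/eqP.
by rewrite oppr_eq0 => /eqP.
Qed.

(** * Hermitian geometry on the Lie algebra *)

Section Hermitian.
Variables (R : realType) (g : lieAlgebra R) (J : 'End(g)).
Variable m : {dot g for idfun}.

Lemma dotDl x y z : m (x + y) z = m x z + m y z.
Proof. exact: linearDl. Qed.
Lemma dotDr x y z : m z (x + y) = m z x + m z y.
Proof. exact: linearDr. Qed.
Lemma dotZl a x z : m (a *: x) z = a * m x z.
Proof. exact: linearZl_LR. Qed.
Lemma dotZr a x z : m z (a *: x) = a * m z x.
Proof. exact: linearZr_LR. Qed.
Lemma dotNl x z : m (- x) z = - m x z.
Proof. exact: linearNl. Qed.
Lemma dotNr x z : m z (- x) = - m z x.
Proof. exact: linearNr. Qed.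
Lemma dot0l z : m 0 z = 0.
Proof. exact: linear0l. Qed.
Lemma dot0r z : m z 0 = 0.
Proof. exact: linear0r. Qed.
Lemma dotC x y : m x y = m y x.
Proof. by rewrite (hermC m x y) expr0 mul1r. Qed.
Lemma dot_gt0 x : x != 0 -> 0 < m x x.
Proof. exact: neq0_dnorm_gt0. Qed.

Lemma dot_suml n (F : 'I_n -> g) z : m (\sum_i F i) z = \sum_i m (F i) z.
Proof. exact: linear_sumlz. Qed.

Definition dotE := (dotDl, dotDr, dotZl, dotZr, dotNl, dotNr, dot0l, dot0r).

Lemma dot_eq0 x : m x x = 0 -> x = 0.
Proof. by have [//|/dot_gt0] := eqVneq x 0; move=> /[swap] ->; rewrite ltxx. Qed.

Fact dot_linear u : linear (m u : g -> R^o).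
Proof. by move=> a x y; rewrite dotDr dotZr. Qed.
Definition dotf u := functional (dot_linear u).
Lemma dotfE u v : dotf u v = m u v.
Proof. exact: functionalE. Qed.

Lemma exists_unit_scale x : x != 0 -> exists2 a : R, 0 < a &
  m (a *: x) (a *: x) = 1.
Proof.
move=> /dot_gt0 x_gt0; exists (Num.sqrt (m x x))^-1.
  by rewrite invr_gt0 sqrtr_gt0.
rewrite dotZl dotZr mulrA -expr2 exprVn sqr_sqrtr ?ltW // mulVf //.
exact: lt0r_neq0.
Qed.

Lemma exists_unit_orthogonal k (u : 'I_k -> g) : (k < \dim {:g})%N ->
  exists2 v, m v v = 1 & forall i, m v (u i) = 0.
Proof.
move=> kg; have [v v0 vu] := exists_common_kernel (fun i => dotf (u i)) kg.
have [a _ a1] := exists_unit_scale v0; exists (a *: v) => // i.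
by have := vu i; rewrite dotfE dotZl dotC => ->; rewrite mulr0.
Qed.

Hypotheses (JJ : forall x, J (J x) = - x) (hJ : hermitian_metric J m).

Lemma dotJl x y : m (J x) y = - m x (J y).
Proof. by rewrite -[in LHS](opprK y) dotNr -JJ hJ. Qed.

Lemma dotxJx x : m x (J x) = 0.
Proof. by have := dotJl x x; rewrite dotC; lra. Qed.

Record unitary_frame (u1 u2 u3 : g) : Prop := UnitaryFrame {
  uf11 : m u1 u1 = 1; uf22 : m u2 u2 = 1; uf33 : m u3 u3 = 1;
  uf12 : m u1 u2 = 0; uf13 : m u1 u3 = 0; uf23 : m u2 u3 = 0;
  uf1J2 : m u1 (J u2) = 0; uf1J3 : m u1 (J u3) = 0; uf2J3 : m u2 (J u3) = 0 }.

Lemma unitary_frame_rot u1 u2 u3 :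
  unitary_frame u1 u2 u3 -> unitary_frame u2 u3 u1.
Proof.
case=> *; split=> //; rewrite dotC // dotJl; apply/eqP; rewrite oppr_eq0.
  exact/eqP.
exact/eqP.
Qed.

Definition frame_vec (u1 u2 u3 : g) (i : 'I_6) : g :=
  nth 0 [:: u1; J u1; u2; J u2; u3; J u3] i.

Section Frame.
Variables (u1 u2 u3 : g).
Hypothesis uf : unitary_frame u1 u2 u3.
Hypothesis dim6 : \dim {:g} = 6%N.
Let b := frame_vec u1 u2 u3.

Lemma frame_vec_orthonormal i j : m (b i) (b j) = (i == j)%:R.
Proof.
case: uf => h11 h22 h33 h12 h13 h23 h1J2 h1J3 h2J3.
have h21 : m u2 u1 = 0 by rewrite dotC.
have h31 : m u3 u1 = 0 by rewrite dotC.
have h32 : m u3 u2 = 0 by rewrite dotC.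
have hJ21 : m u2 (J u1) = 0 by rewrite dotC dotJl h1J2 oppr0.
have hJ31 : m u3 (J u1) = 0 by rewrite dotC dotJl h1J3 oppr0.
have hJ32 : m u3 (J u2) = 0 by rewrite dotC dotJl h2J3 oppr0.
case: i => [[|[|[|[|[|[|//]]]]]] ?]; case: j => [[|[|[|[|[|[|//]]]]]] ?] //=;
  by rewrite ?hJ ?dotJl ?dotxJx ?h11 ?h22 ?h33 ?h12 ?h13 ?h23 ?h1J2 ?h1J3
    ?h2J3 ?h21 ?h31 ?h32 ?hJ21 ?hJ31 ?hJ32 ?oppr0.
Qed.

Lemma frame_vec_expand v : v = \sum_i m v (b i) *: b i.
Proof.
rewrite {1}(@coords_injective _ _ _ (fun i => dotf (b i)) b dim6 _ v).
  by apply: eq_bigr => i _; rewrite dotfE dotC.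
by move=> i j; rewrite dotfE frame_vec_orthonormal.
Qed.

Lemma unitary_expand v : v =
  m v u1 *: u1 + m v (J u1) *: J u1 + m v u2 *: u2 + m v (J u2) *: J u2 +
  m v u3 *: u3 + m v (J u3) *: J u3.
Proof.
rewrite {1}[v]frame_vec_expand !big_ord_recl big_ord0 /b /frame_vec /=.
by rewrite !addrA addr0.
Qed.

Lemma unitary_ext v w : m v u1 = m w u1 -> m v (J u1) = m w (J u1) ->
  m v u2 = m w u2 -> m v (J u2) = m w (J u2) ->
  m v u3 = m w u3 -> m v (J u3) = m w (J u3) -> v = w.
Proof.
by move=> *; rewrite [v]unitary_expand [w]unitary_expand; do !congr (_ + _);
  congr (_ *: _).
Qed.

(** The matrix of ad y in an orthonormal basis is nilpotent. *)
Lemma trace_ad0 y : lie_nilpotent g ->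
  m ⁅y, u1⁆ u1 + m ⁅y, J u1⁆ (J u1) + m ⁅y, u2⁆ u2 + m ⁅y, J u2⁆ (J u2) +
  m ⁅y, u3⁆ u3 + m ⁅y, J u3⁆ (J u3) = 0.
Proof.
move=> nilp; have [k kP] := ad_nilpotent nilp.
pose A : 'M[R]_6 := \matrix_(i, j) m ⁅y, b i⁆ (b j).
have AkE n i j : (A ^+ n) i j = m (iter n (lie_br y) (b i)) (b j).
  elim: n i => [|n IHn] i; first by rewrite expr0 mxE /= frame_vec_orthonormal.
  rewrite exprS mxE iterSr [in RHS](frame_vec_expand ⁅y, b i⁆).
  have -> : iter n (lie_br y) (\sum_l m ⁅y, b i⁆ (b l) *: b l) =
      \sum_l m ⁅y, b i⁆ (b l) *: iter n (lie_br y) (b l).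
    elim: n {IHn} => //= n ->.
    elim/big_rec2: _ => [|l _ z _ <-]; first by rewrite lie0r.
    by rewrite lieDr lieZr.
  rewrite dot_suml; apply: eq_bigr => l _.
  by rewrite IHn mxE dotZl.
have : \tr A = 0.
  apply: (@nilpotent_mxtrace _ _ _ k); apply/matrixP => i j.
  by rewrite AkE kP dot0l mxE.
by rewrite /mxtrace !big_ord_recl big_ord0 !mxE /b /frame_vec /= !addrA addr0.
Qed.

(** Evaluating d (F ∧ F) = 0 at u1, J u1, u2, J u2, y expresses the product of
    [u1, J u1] + [u2, J u2] with J y as the trace of ad y on the first two
    planes. For y in the third plane the total trace is zero, so this is minus
    the trace on the third plane, that is, minus the product of [u3, J u3] with
    J y. *)
Lemma balanced_dot : lie_nilpotent g -> balanced J m ->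
  m (⁅u1, J u1⁆ + ⁅u2, J u2⁆ + ⁅u3, J u3⁆) u3 = 0 /\
  m (⁅u1, J u1⁆ + ⁅u2, J u2⁆ + ⁅u3, J u3⁆) (J u3) = 0.
Proof.
move=> nilp bal.
pose phi x y := m x (J y).
pose Phi x y z t :=
  2%:R * (phi x y * phi z t - phi x z * phi y t + phi x t * phi y z).
have FF : wedge_form (fundamental J m) (fundamental J m) =
    (fun Y : 'I_4 -> g => Phi (Y 0) (Y 1) (Y 2%:R) (Y 3%:R)) :> kform R g 4.
  apply: funext => Y; apply: (wedge22E (phi := phi)).
    by rewrite pnatr_eq0.
  by move=> x y; rewrite /phi -dotJl dotC.
move: bal; rewrite /balanced FF => dFF.
have main y : m y u1 = 0 -> m y (J u1) = 0 -> m y u2 = 0 -> m y (J u2) = 0 ->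
   m (⁅u1, J u1⁆ + ⁅u2, J u2⁆) (J y) =
   m ⁅y, u1⁆ u1 + m ⁅y, J u1⁆ (J u1) + m ⁅y, u2⁆ u2 + m ⁅y, J u2⁆ (J u2).
  move=> y1 yJ1 y2 yJ2.
  have := congr1 (fun f => f (fun i : 'I_5 =>
    nth 0 [:: u1; J u1; u2; J u2; y] i)) dFF.
  rewrite /= ext_d4E.
  case: uf => h11 h22 h33 h12 h13 h23 h1J2 h1J3 h2J3.
  have h21 : m u2 u1 = 0 by rewrite dotC.
  have hJ21 : m u2 (J u1) = 0 by rewrite dotC dotJl h1J2 oppr0.
  have yy1 : m u1 y = 0 by rewrite dotC.
  have yy2 : m u2 y = 0 by rewrite dotC.
  have yyJ1 : m u1 (J y) = 0 by rewrite dotC dotJl yJ1 oppr0.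
  have yyJ2 : m u2 (J y) = 0 by rewrite dotC dotJl yJ2 oppr0.
  rewrite -[X in _ = X]/(0 : R).
  rewrite /Phi /phi !(JJ, endoN, dotNr, hJ, dotJl) !(h11, h22, h12, h21, h1J2, hJ21,
    yy1, yy2, yyJ1, yyJ2, dotxJx) !dotDl.
  rewrite (lieC u1 y) (lieC (J u1) y) (lieC u2 y) (lieC (J u2) y) !dotNl.
  lra.
have tr y := trace_ad0 y nilp.
case: (unitary_frame_rot uf) => h22 h33 h11 h23 h21 h31 h2J3 h2J1 h3J1.
case: uf => _ _ _ _ h13 _ _ h1J3 _.
have h32 : m u3 u2 = 0 by rewrite dotC.
have hJ32 : m u3 (J u2) = 0 by rewrite dotC dotJl h2J3 oppr0.
have := main u3; have := main (J u3); have := tr u3; have := tr (J u3).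
rewrite !(dotJl, hJ, JJ, dotNr) h31 h3J1 h32 hJ32 !(liexx, dot0l, oppr0).
move=> t1 t2 /(_ erefl erefl erefl erefl) m1 /(_ erefl erefl erefl erefl) m2.
move: t1 t2 m1 m2; rewrite (lieC (J u3) u3) !(dotDl, dotNl).
by split; lra.
Qed.
End Frame.

(** The sum is the metric trace of (X, Y) |-> [X, J Y], which is dual to the
    codifferential of F up to a factor. Its components vanish because each plane
    of the frame can play the part of the third one. *)
Lemma balanced_bracket_sum u1 u2 u3 : \dim {:g} = 6%N -> lie_nilpotent g ->
  balanced J m -> unitary_frame u1 u2 u3 ->
  ⁅u1, J u1⁆ + ⁅u2, J u2⁆ + ⁅u3, J u3⁆ = 0.
Proof.
move=> dim6 nilp bal uf1.
have uf2 := unitary_frame_rot uf1; have uf3 := unitary_frame_rot uf2.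
have [e1 e2] := balanced_dot uf1 dim6 nilp bal.
have [e3 e4] := balanced_dot uf2 dim6 nilp bal.
have [e5 e6] := balanced_dot uf3 dim6 nilp bal.
apply: (unitary_ext uf1 dim6); rewrite dot0l //.
- by rewrite -addrA addrC.
- by rewrite -addrA addrC.
- by rewrite addrC addrA.
- by rewrite addrC addrA.
Qed.
End Hermitian.

(** * The J-invariant part of the center *)

Definition complex_line (R : realType) (g : lieAlgebra R) (J : 'End(g))
    (c v : g) :=
  exists a b : R, v = a *: c + b *: J c.

Section ComplexLine.
Variables (R : realType) (g : lieAlgebra R) (J : 'End(g)) (c : g).
Hypothesis JJ : forall x, J (J x) = - x.

Lemma complex_line_subspace : subspace_pred (complex_line J c).
Proof.
split; first by exists 0, 0; rewrite !scale0r addr0.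
move=> a _ _ [p [q ->]] [r [s ->]]; exists (a * p + r), (a * q + s).
by_functional.
Qed.

Lemma complex_lineJ v : complex_line J c v -> complex_line J c (J v).
Proof.
move=> [p [q ->]]; exists (- q), p; rewrite !endoE JJ; by_functional.
Qed.
End ComplexLine.

Section Classification.
Variables (R : realType) (g : lieAlgebra R) (J : 'End(g)).
Variable m : {dot g for idfun}.
Hypotheses (csJ : complex_structure J) (hJ : hermitian_metric J m).
Hypotheses (dim6 : \dim {:g} = 6%N) (nilp : lie_nilpotent g).
Hypothesis bal : balanced J m.

Let JJ : forall x, J (J x) = - x := csJ.1.
Let Nij := csJ.2.

(** In the integrability condition for w and y, the two terms that contain w
    itself vanish modulo S. *)
Lemma center_ad_J (S : g -> Prop) w : subspace_pred S ->
  (forall y, S y -> S (J y)) -> (forall x, S ⁅x, w⁆) ->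
  forall y, S (⁅J w, J y⁆ - J ⁅J w, y⁆).
Proof.
move=> subS SJ Sw y; rewrite Nij.
have -> : J ⁅J w, y⁆ + J ⁅w, J y⁆ + ⁅w, y⁆ - J ⁅J w, y⁆ =
    - (J ⁅J y, w⁆ + ⁅y, w⁆).
  by rewrite (lieC w (J y)) (lieC w y); by_functional.
by apply: subspaceN => //; apply: subspaceD => //; apply: SJ.
Qed.

(** J has no real eigenvector, also modulo S. *)
Lemma notin_complex_line (S : g -> Prop) w a : subspace_pred S ->
  (forall y, S y -> S (J y)) -> ~ S w -> ~ S (J w - a *: w).
Proof.
move=> subS SJ nSw Sw; apply: nSw.
have a1 : 1 + a ^+ 2 != 0 by rewrite lt0r_neq0 // ltr_wpDr ?sqr_ge0.
rewrite -[w](scalerK a1); apply: subspaceZ => //.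
have -> : (1 + a ^+ 2) *: w = - (J (J w - a *: w) + a *: (J w - a *: w)).
  by rewrite !endoE JJ; by_functional.
apply: subspaceN => //; apply: subspaceD; rewrite //; first exact: SJ.
exact: subspaceZ.
Qed.

(** As ad (J w) is complex linear modulo S, the vector J w is an eigenvector of
    ad x with eigenvalue - b and of ad (J x) with eigenvalue - a, modulo S and
    w; nilpotency makes both zero. *)
Lemma ad_J_center (S : g -> Prop) w x (a b : R) : subspace_pred S ->
  (forall y, S y -> S (J y)) -> (forall x y, S y -> S ⁅x, y⁆) ->
  (forall x, S ⁅x, w⁆) -> ~ S w ->
  S (⁅J w, x⁆ - (a *: w + b *: J w)) -> S ⁅J w, x⁆.
Proof.
move=> subS SJ Sideal Sw nSw Sab.
pose S' y := exists c : R, S (y - c *: w).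
have S'sub : subspace_pred S'.
  split; first by exists 0; rewrite scale0r subr0; case: subS.
  move=> e y z [c Sc] [d Sd]; exists (e * c + d).
  have -> : e *: y + z - (e * c + d) *: w = e *: (y - c *: w) + (z - d *: w).
    by_functional.
  exact: subS.2.
have nS' : ~ S' (J w) by move=> [c]; apply: notin_complex_line.
have S'ad z y : S' y -> S' ⁅z, y⁆.
  move=> [c Sc]; exists 0; rewrite scale0r subr0 -[y](subrK (c *: w)) lieDr lieZr.
  by apply: subspaceD => //; [apply: Sideal | apply: subspaceZ].
have b0 : - b = 0.
  apply: (ad_eigenvalue0 nilp (x := x) (v := J w) S'sub _ _ nS').
    by move=> y; apply: S'ad.
  exists (- a); rewrite (lieC (J w) x).
  have -> : - ⁅J w, x⁆ - - b *: J w - - a *: w =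
      - (⁅J w, x⁆ - (a *: w + b *: J w)) by by_functional.
  exact: subspaceN.
have a0 : - a = 0.
  apply: (ad_eigenvalue0 nilp (x := J x) (v := J w) S'sub _ _ nS').
    by move=> y; apply: S'ad.
  exists b; rewrite (lieC (J w) (J x)).
  have -> : - ⁅J w, J x⁆ - - a *: J w - b *: w =
      - ((⁅J w, J x⁆ - J ⁅J w, x⁆) + J (⁅J w, x⁆ - (a *: w + b *: J w))).
    by rewrite !endoE JJ; by_functional.
  apply: subspaceN => //; apply: subspaceD => //; first exact: center_ad_J.
  exact: SJ.
move: Sab; have -> : a = 0 by rewrite -[a]opprK a0 oppr0.
have -> : b = 0 by rewrite -[b]opprK b0 oppr0.
by rewrite !scale0r addr0 subr0.
Qed.

Lemma exists_unit_orthogonal_seq (s : seq g) : (size s < 6)%N ->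
  exists2 v, m v v = 1 & forall u, u \in s -> m v u = 0.
Proof.
move=> s6; have [|v v1 vs] := exists_unit_orthogonal m
    (fun i : 'I_(size s) => nth 0 s i); first by rewrite dim6.
exists v => // u us; have := vs (Ordinal (introT idP (etrans (index_mem u s) us))).
by rewrite /= nth_index.
Qed.

Lemma exists_frame2 u3 : m u3 u3 = 1 ->
  exists u1 u2, unitary_frame J m u1 u2 u3.
Proof.
move=> h33; have [u2 h22 h2] := exists_unit_orthogonal_seq (s := [:: u3; J u3]) isT.
have [u1 h11 h1] := exists_unit_orthogonal_seq (s := [:: u2; J u2; u3; J u3]) isT.
exists u1, u2; split=> //; by rewrite ?h1 ?h2 // !inE eqxx ?orbT.
Qed.

Lemma exists_frame1 u2 u3 : m u2 u2 = 1 -> m u3 u3 = 1 -> m u2 u3 = 0 ->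
  m u2 (J u3) = 0 -> exists u1, unitary_frame J m u1 u2 u3.
Proof.
move=> h22 h33 h23 h2J3.
have [u1 h11 h1] := exists_unit_orthogonal_seq (s := [:: u2; J u2; u3; J u3]) isT.
exists u1; split=> //; by rewrite ?h1 // !inE eqxx ?orbT.
Qed.

(** Normalized projection off the complex line of c. Up to the line it is a
    multiple of v, so that it inherits what the brackets with v satisfy modulo
    the line. *)
Lemma exists_unit_off_line c v : m c c = 1 -> ~ complex_line J c v ->
  exists w (a : R), [/\ m w w = 1, m w c = 0, m w (J c) = 0, a != 0 &
    complex_line J c (w - a *: v)].
Proof.
move=> c1 nv; pose w0 := v - (m v c *: c + m v (J c) *: J c).
have w0N : w0 != 0.
  by apply/eqP => /subr0_eq w00; apply: nv; exists (m v c), (m v (J c)).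
have [a a_gt0 a1] := exists_unit_scale m w0N.
have cJ : m c (J c) = 0 by apply: dotxJx.
have Jc : m (J c) c = 0 by rewrite dotC.
exists (a *: w0), a; split=> //.
- by rewrite /w0 !dotE c1 Jc; ring.
- by rewrite /w0 !dotE cJ hJ c1; ring.
- by rewrite lt0r_neq0.
exists (- a * m v c), (- a * m v (J c)); rewrite /w0; by_functional.
Qed.

Lemma central_of_frame u1 u2 u3 v : unitary_frame J m u1 u2 u3 ->
  ⁅u1, v⁆ = 0 -> ⁅J u1, v⁆ = 0 -> ⁅u2, v⁆ = 0 -> ⁅J u2, v⁆ = 0 ->
  ⁅u3, v⁆ = 0 -> ⁅J u3, v⁆ = 0 -> forall x, ⁅x, v⁆ = 0.
Proof.
move=> uf h1 h2 h3 h4 h5 h6 x.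
rewrite (unitary_expand JJ hJ uf dim6 x).
by rewrite !lieDl !lieZl h1 h2 h3 h4 h5 h6 !scaler0 !addr0.
Qed.

(** Everything is modulo the plane of c. The quotient is nilpotent and has a
    central unit vector w; in a unitary frame x, w, c the balanced condition
    kills [x, J x], and ad (J w) is complex linear and nilpotent with the plane
    of w in its kernel, so that [J w, x] is in the plane of w and then zero. *)
Lemma abelian_mod_central_plane u1 u2 c : unitary_frame J m u1 u2 c ->
  (forall x, ⁅x, c⁆ = 0) -> (forall x, ⁅x, J c⁆ = 0) ->
  forall x y, complex_line J c ⁅x, y⁆.
Proof.
move=> uf0 c0 Jc0; have c1 := uf33 uf0.
have subS := complex_line_subspace J c.
have SJ := @complex_lineJ _ _ J c JJ.
set S := complex_line J c in subS SJ *.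
have S0 v : S v -> forall x, ⁅x, v⁆ = 0.
  by move=> [a [b ->]] x; rewrite lieDr !lieZr c0 Jc0 !scaler0 addr0.
have Sideal x y : S y -> S ⁅x, y⁆ by move=> /S0->; case: subS.
have nSu1 : ~ S u1.
  move=> [a [b u1E]]; have := uf11 uf0.
  rewrite {2}u1E dotDr !dotZr (uf13 uf0) (uf1J3 uf0) => /eqP.
  by rewrite !mulr0 addr0 eq_sym oner_eq0.
have [w0 nw0 Sw0] := nilpotent_center_mod nilp subS.1 (ex_intro _ u1 nSu1).
have [w [r [w1 wc wJc r0 Sw]]] := exists_unit_off_line c1 nw0.
have {w0 nw0 Sw0 r r0} Sw x : S ⁅x, w⁆.
  rewrite -[w](subrK (r *: w0)) lieDr lieZr (S0 _ Sw) add0r.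
  exact: subspaceZ.
have nSw : ~ S w.
  move=> [a [b wE]]; have := w1.
  by rewrite {2}wE dotDr !dotZr wc wJc => /eqP; rewrite !mulr0 addr0 eq_sym oner_eq0.
have [x uf] := exists_frame1 w1 c1 wc wJc.
have Swl y : S ⁅w, y⁆ by rewrite lieC; apply: subspaceN.
have SxJx : S ⁅x, J x⁆.
  have := balanced_bracket_sum JJ hJ dim6 nilp bal uf.
  rewrite Jc0 addr0 => /eqP; rewrite addr_eq0 => /eqP->.
  by apply: subspaceN.
have expand := unitary_expand JJ hJ uf dim6.
pose S2 y := m y x = 0 /\ m y (J x) = 0.
have subS2 : subspace_pred S2.
  split; first by split; rewrite dot0l.
  by move=> a y z [y1 y2] [z1 z2]; split; rewrite !dotE ?y1 ?y2 ?z1 ?z2; ring.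
have S2J y : S2 y -> S2 (J y).
  by move=> [y1 y2]; split; rewrite ?hJ // (dotJl JJ hJ) y2 oppr0.
have cx : m c x = 0 by rewrite dotC (uf13 uf).
have cJx : m c (J x) = 0.
  by rewrite dotC (dotJl JJ hJ) (uf1J3 uf) oppr0.
have SS2 y : S y -> S2 y.
  by move=> [a [b ->]]; split; rewrite !dotE ?hJ ?(dotJl JJ hJ) cx cJx; ring.
have S2ad y : S2 y -> S2 ⁅J w, y⁆.
  move=> [y1 y2]; apply: SS2; rewrite (expand y) y1 y2 !scale0r !add0r.
  rewrite !lieDr !lieZr liexx c0 Jc0 !scaler0 !addr0; apply: subspaceZ => //.
have nS2x : ~ S2 x by move=> [/eqP]; rewrite (uf11 uf) oner_eq0.
have xJx : m x (J x) = 0 by apply: dotxJx.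
have Jxx : m (J x) x = 0 by rewrite dotC.
(* Modulo the vectors orthogonal to x and J x, the bracket with J w is a
   complex scalar on x. *)
have [p0 q0] : m ⁅J w, x⁆ x = 0 /\ m ⁅J w, x⁆ (J x) = 0.
  apply: (ad_complex_eigenvalue0 nilp (x := J w) (v := x) JJ subS2) => //.
    by split; rewrite !dotE ?hJ (uf11 uf) ?xJx ?Jxx; ring.
  rewrite -[⁅J w, J x⁆](subrK (J ⁅J w, x⁆)) -addrA; apply: subspaceD => //.
    by apply: SS2; apply: center_ad_J.
  by split; rewrite !dotE ?hJ ?(dotJl JJ hJ) (uf11 uf) ?xJx; ring.
have SJwx : S ⁅J w, x⁆.
  apply: (ad_J_center subS SJ Sideal Sw nSw (a := m ⁅J w, x⁆ w)
    (b := m ⁅J w, x⁆ (J w))).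
  exists (m ⁅J w, x⁆ c), (m ⁅J w, x⁆ (J c)).
  rewrite {1}(expand ⁅J w, x⁆) p0 q0; by_functional.
have SJwJx : S ⁅J w, J x⁆.
  rewrite -[⁅J w, J x⁆](subrK (J ⁅J w, x⁆)); apply: subspaceD => //.
    exact: center_ad_J.
  exact: SJ.
have SxJw : S ⁅x, J w⁆ by rewrite lieC; apply: subspaceN.
have SJxJw : S ⁅J x, J w⁆ by rewrite lieC; apply: subspaceN.
have SJxx : S ⁅J x, x⁆ by rewrite lieC; apply: subspaceN.
have SZ := subspaceZ subS; have SD := subspaceD subS.
move=> y z; rewrite (expand y) !lieDl !lieZl (expand z) !lieDr !lieZr.
have zero : S 0 by case: subS.
rewrite !liexx !c0 !Jc0.
have cl v : ⁅c, v⁆ = 0 by rewrite lieC c0 oppr0.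
have Jcl v : ⁅J c, v⁆ = 0 by rewrite lieC Jc0 oppr0.
rewrite !cl !Jcl !scaler0 ?addr0 ?add0r.
by repeat first [assumption | exact: Sw | exact: Swl | apply: (SD) | apply: (SZ)].
Qed.
End Classification.

(** * Complex structures without an invariant central plane *)

(** Real and imaginary parts of (p + i q) (a + i b): the phase p + i q is that
    of the conjugate of a + i b. *)
Lemma unit_rotation (R : realType) (a b : R) : exists p q : R,
  [/\ p ^+ 2 + q ^+ 2 = 1, 0 <= p * a - q * b & p * b + q * a = 0].
Proof.
have [n0|n0] := eqVneq (a ^+ 2 + b ^+ 2) 0.
  exists 1, 0; move/eqP: n0; rewrite paddr_eq0 ?sqr_ge0 // !sqrf_eq0.
  by move=> /andP[/eqP-> /eqP->]; split; [ring | rewrite !mulr0 subr0 | ring].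
have n_ge0 : 0 <= a ^+ 2 + b ^+ 2 by rewrite addr_ge0 ?sqr_ge0.
pose n := Num.sqrt (a ^+ 2 + b ^+ 2).
have nn : n ^+ 2 = a ^+ 2 + b ^+ 2 by rewrite sqr_sqrtr.
have n_gt0 : 0 < n by rewrite sqrtr_gt0 lt0r n0.
have nz : n != 0 by rewrite lt0r_neq0.
exists (a / n), (- b / n); split.
- by rewrite !exprMn sqrrN -mulrDl -nn exprVn divff // sqrf_eq0.
- have -> : a / n * a - - b / n * b = (a ^+ 2 + b ^+ 2) / n by field.
  by rewrite divr_ge0 // ltW.
- by field.
Qed.

Section NonNilpotent.
Variables (R : realType) (g : lieAlgebra R) (J : 'End(g)).
Variable m : {dot g for idfun}.
Hypotheses (csJ : complex_structure J) (hJ : hermitian_metric J m).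
Hypotheses (dim6 : \dim {:g} = 6%N) (nilp : lie_nilpotent g).
Hypothesis bal : balanced J m.
Hypothesis noJcenter : forall v,
  (forall x, ⁅x, v⁆ = 0) -> (forall x, ⁅x, J v⁆ = 0) -> v = 0.

Let JJ : forall x, J (J x) = - x := csJ.1.
Let Nij := csJ.2.
Let zeroS : subspace_pred (fun v : g => v = 0) := subspace_zero g.

Lemma zeroJ (y : g) : y = 0 -> J y = 0.
Proof. by move->; rewrite endo0. Qed.
Lemma zero_ideal (x y : g) : y = 0 -> ⁅x, y⁆ = 0.
Proof. by move->; rewrite lie0r. Qed.

(** As ad x is nilpotent, a vector outside S has a last iterate outside S. *)
Lemma ad_kernel_mod (S : g -> Prop) x :
  S 0 -> (exists y, ~ S y) -> exists2 w, ~ S w & S ⁅x, w⁆.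
Proof.
move=> S0 [y nSy]; have [k kP] := ad_nilpotent nilp.
have : S (iter k (lie_br x) y) by rewrite kP.
elim: k {kP} => [//|k IHk] Sk.
case: (pselect (S (iter k (lie_br x) y))) => [/IHk //|nS].
by exists (iter k (lie_br x) y).
Qed.

(** Modulo the complex line of the central vector w, the complex linear
    nilpotent map ad (J w) has a kernel vector x, and [J w, x] in the line of w
    forces [J w, x] = 0. By nilpotency [J w, u] has no component along u, J u,
    and the component along x, J x is not zero, as otherwise J w would be
    central. The phases of u and x make the coefficients real. *)
Lemma exists_triangular_frame : exists u x w mu nu,
  [/\ unitary_frame J m u x w, 0 < mu /\ 0 <= nu, forall y, ⁅y, w⁆ = 0,
      ⁅J w, u⁆ = mu *: x + nu *: w /\ ⁅J w, J u⁆ = mu *: J x + nu *: J w &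
      ⁅J w, x⁆ = 0 /\ ⁅J w, J x⁆ = 0].
Proof.
have [|w0 w00 cw0] := nilpotent_center_mod (S := fun v => v = 0) nilp erefl.
  have [v v1 _] := exists_unit_orthogonal_seq m dim6 (s := [::]) isT.
  by exists v => v0; move: v1; rewrite v0 dot0l => /esym/eqP; rewrite oner_eq0.
have [w w1 cw] : exists2 w, m w w = 1 & forall y, ⁅y, w⁆ = 0.
  have [a _ w1] := exists_unit_scale m (introN eqP w00).
  by exists (a *: w0) => // y; rewrite lieZr cw0 scaler0.
have cwl y : ⁅w, y⁆ = 0 by rewrite lieC cw oppr0.
have nw0 : ~ (w = 0).
  by move=> wz; move: w1; rewrite wz dot0l => /esym/eqP; rewrite oner_eq0.
have DJ y : ⁅J w, J y⁆ = J ⁅J w, y⁆.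
  apply/eqP; rewrite -subr_eq0; apply/eqP.
  by apply: (center_ad_J csJ zeroS zeroJ cw).
have noline x p q : ⁅J w, x⁆ - (p *: w + q *: J w) = 0 -> ⁅J w, x⁆ = 0.
  exact: (ad_J_center csJ nilp zeroS zeroJ zero_ideal cw nw0).
have subS := complex_line_subspace J w.
have [x0 nx0 [p [q px0]]] : exists2 x, ~ complex_line J w x &
    complex_line J w ⁅J w, x⁆.
  apply: ad_kernel_mod; first by case: subS.
  have [v v1 vw] := exists_unit_orthogonal_seq m dim6 (s := [:: w; J w]) isT.
  have vw0 : m v w = 0 by rewrite vw // !inE eqxx.
  have vJw0 : m v (J w) = 0 by rewrite vw // !inE eqxx orbT.
  exists v => -[p [q vE]]; have /eqP := v1.
  by rewrite {2}vE dotDr !dotZr vw0 vJw0 !mulr0 addr0 eq_sym oner_eq0.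
have [x [r [x1 xw xJw r0 [s [t xE]]]]] := exists_unit_off_line csJ hJ w1 nx0.
have Dx : ⁅J w, x⁆ = 0.
  apply: (noline _ (r * p) (r * q)).
  rewrite -[x](subrK (r *: x0)) xE !lieE px0 cw; by_functional.
have DJx : ⁅J w, J x⁆ = 0 by rewrite DJ Dx endo0.
have [u uf] := exists_frame1 dim6 x1 w1 xw xJw.
have expand := unitary_expand JJ hJ uf dim6.
have xu : m x u = 0 by rewrite dotC (uf12 uf).
have wu : m w u = 0 by rewrite dotC (uf13 uf).
have xJu : m x (J u) = 0 by rewrite dotC (dotJl JJ hJ) (uf1J2 uf) oppr0.
have wJu : m w (J u) = 0 by rewrite dotC (dotJl JJ hJ) (uf1J3 uf) oppr0.
have uJu : m u (J u) = 0 by apply: dotxJx.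
have Juu : m (J u) u = 0 by rewrite dotC.
have wJx : m w (J x) = 0 by rewrite dotC (dotJl JJ hJ) xJw oppr0.
have wx : m w x = 0 by rewrite dotC.
pose S2 y := m y u = 0 /\ m y (J u) = 0.
have subS2 : subspace_pred S2.
  split; first by split; rewrite dot0l.
  by move=> b y z [y1 y2] [z1 z2]; split; rewrite !dotE ?y1 ?y2 ?z1 ?z2; ring.
have [al0 be0] : m ⁅J w, u⁆ u = 0 /\ m ⁅J w, u⁆ (J u) = 0.
  apply: (ad_complex_eigenvalue0 nilp (x := J w) (v := u) JJ subS2).
  - by move=> y [y1 y2]; split; rewrite ?hJ // (dotJl JJ hJ) y2 oppr0.
  - move=> y [y1 y2]; rewrite (expand y) y1 y2 !scale0r !add0r.
    by rewrite !lieDr !lieZr Dx DJx cw liexx !scaler0 !addr0; case: subS2.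
  - by split; rewrite !dotE ?hJ (uf11 uf) ?uJu ?Juu; ring.
  - by split; rewrite DJ !dotE ?hJ ?(dotJl JJ hJ) (uf11 uf) ?uJu; ring.
  - by move=> [/eqP]; rewrite (uf11 uf) oner_eq0.
set d1 := m ⁅J w, u⁆ x; set d2 := m ⁅J w, u⁆ (J x).
set n1 := m ⁅J w, u⁆ w; set n2 := m ⁅J w, u⁆ (J w).
have Du : ⁅J w, u⁆ = d1 *: x + d2 *: J x + n1 *: w + n2 *: J w.
  by rewrite [LHS]expand al0 be0 !scale0r !add0r.
have d0 : d1 ^+ 2 + d2 ^+ 2 != 0.
  apply/negP; rewrite paddr_eq0 ?sqr_ge0 // !sqrf_eq0 => /andP[/eqP d10 /eqP d20].
  have Du0 : ⁅J w, u⁆ = 0.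
    by apply: (noline _ n1 n2); rewrite Du d10 d20; by_functional.
  apply: nw0; apply: noJcenter => // y; rewrite lieC.
  rewrite (expand y) !lieDr !lieZr Dx DJx cw liexx DJ Du0 endo0.
  by rewrite !scaler0 !addr0 oppr0.
have [p' [q' [pq n_ge0 n0]]] := unit_rotation n1 n2.
set nu := p' * n1 - q' * n2 in n_ge0.
pose e1 := p' * d1 - q' * d2; pose e2 := p' * d2 + q' * d1.
have ee : e1 ^+ 2 + e2 ^+ 2 = d1 ^+ 2 + d2 ^+ 2.
  have -> : e1 ^+ 2 + e2 ^+ 2 = (p' ^+ 2 + q' ^+ 2) * (d1 ^+ 2 + d2 ^+ 2).
    by rewrite /e1 /e2; ring.
  by rewrite pq mul1r.
pose mu := Num.sqrt (e1 ^+ 2 + e2 ^+ 2).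
have mu2 : mu ^+ 2 = e1 ^+ 2 + e2 ^+ 2.
  by rewrite sqr_sqrtr // addr_ge0 ?sqr_ge0.
have mu_gt0 : 0 < mu by rewrite sqrtr_gt0 ee lt0r d0 addr_ge0 ?sqr_ge0.
have mu0 : mu != 0 by rewrite lt0r_neq0.
pose x' := (e1 / mu) *: x + (e2 / mu) *: J x.
pose u' := p' *: u + q' *: J u.
have mux' : mu *: x' = e1 *: x + e2 *: J x.
  by rewrite scalerDr !scalerA !(mulrC mu) !divfK.
have Du' : ⁅J w, u'⁆ = mu *: x' + nu *: w.
  rewrite mux' /u' lieDr !lieZr DJ Du !endoE !JJ -[RHS]addr0.
  rewrite -(scale0r (J w)) -[in RHS]n0 /nu /e1 /e2; by_functional.
exists u', x', w, mu, nu; split=> //.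
- have x'e : (e1 / mu) ^+ 2 + (e2 / mu) ^+ 2 = 1.
    by rewrite !exprMn -mulrDl -mu2 exprVn divff // sqrf_eq0.
  have xJx : m x (J x) = 0 by apply: dotxJx.
  have Jxx : m (J x) x = 0 by rewrite dotC.
  have ux := uf12 uf; have uJx := uf1J2 uf.
  have uw := uf13 uf; have uJw := uf1J3 uf.
  split; rewrite /u' /x' ?endoE ?JJ ?dotE ?hJ ?(dotJl JJ hJ) ?JJ ?dotNr
    ?x1 ?w1 ?(uf11 uf) ?uJu ?Juu ?xJx ?Jxx ?ux ?uJx ?xw ?xJw ?uw ?uJw.
  all: try (by ring).
  - by rewrite -[RHS]pq; ring.
  - by rewrite -[RHS]x'e; ring.
- by rewrite DJ Du' !endoE.
- by rewrite /x' !endoE JJ !lieDr !lieZr lieNr Dx DJx oppr0 !scaler0 addr0.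
Qed.

Section TriangularFrame.
Variables (u x w : g) (mu nu : R).
Hypotheses (uf : unitary_frame J m u x w) (mu_gt0 : 0 < mu).
Hypothesis cw : forall y, ⁅y, w⁆ = 0.
Hypotheses (Du : ⁅J w, u⁆ = mu *: x + nu *: w)
  (DJu : ⁅J w, J u⁆ = mu *: J x + nu *: J w).
Hypotheses (Dx : ⁅J w, x⁆ = 0) (DJx : ⁅J w, J x⁆ = 0).

Let expand := unitary_expand JJ hJ uf dim6.
Let t := mu *: x + nu *: w.
Let mu0 : mu != 0 := lt0r_neq0 mu_gt0.

Let JtE : J t = mu *: J x + nu *: J w.
Proof. by rewrite /t !endoE. Qed.

Let xu : m x u = 0. Proof. by rewrite dotC (uf12 uf). Qed.
Let wu : m w u = 0. Proof. by rewrite dotC (uf13 uf). Qed.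
Let wx : m w x = 0. Proof. by rewrite dotC (uf23 uf). Qed.
Let xJu : m x (J u) = 0.
Proof. by rewrite dotC (dotJl JJ hJ) (uf1J2 uf) oppr0. Qed.
Let wJu : m w (J u) = 0.
Proof. by rewrite dotC (dotJl JJ hJ) (uf1J3 uf) oppr0. Qed.
Let wJx : m w (J x) = 0.
Proof. by rewrite dotC (dotJl JJ hJ) (uf2J3 uf) oppr0. Qed.
Let xJx : m x (J x) = 0. Proof. exact: dotxJx. Qed.
Let Jxx : m (J x) x = 0. Proof. by rewrite dotC. Qed.

Let cwl y : ⁅w, y⁆ = 0. Proof. by rewrite lieC cw oppr0. Qed.
Let Dxr : ⁅x, J w⁆ = 0. Proof. by rewrite lieC Dx oppr0. Qed.
Let DJxr : ⁅J x, J w⁆ = 0. Proof. by rewrite lieC DJx oppr0. Qed.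

Let adJwE y : ⁅J w, y⁆ = m y u *: t + m y (J u) *: J t.
Proof.
rewrite {1}(expand y) !lieDr !lieZr Du DJu Dx DJx cw liexx JtE /t.
by rewrite !scaler0 !addr0.
Qed.

Let t_free a b c : a *: t + b *: J t + c *: w = 0 -> a = 0 /\ b = 0.
Proof.
move=> abt; have := congr1 (m^~ x) abt; have := congr1 (m^~ (J x)) abt.
rewrite JtE /t !dotE !(dotJl JJ hJ) !JJ !dotNr opprK (uf22 uf) xJx wx wJx.
rewrite !(mulr0, mulr1, addr0, add0r, oppr0) => /eqP + /eqP.
by rewrite !mulf_eq0 (negPf mu0) !orbF => /eqP-> /eqP->.
Qed.

(** Jacobi's identity for J w, u, J x gives mu [x, J x] = [J w, [u, J x]], a
    vector p t + q J t. Thus J x is an eigenvector of ad x with eigenvalue q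
    modulo x, w, J w, and x is one of ad (J x) with eigenvalue - p modulo
    J x, w, J w. *)
Let xJx0 : ⁅x, J x⁆ = 0.
Proof.
set p := m ⁅u, J x⁆ u; set q := m ⁅u, J x⁆ (J u).
have xE : mu *: ⁅x, J x⁆ = p *: t + q *: J t.
  rewrite -adJwE lie_jacobi DJx lie0r addr0 Du lieDl !lieZl cwl.
  by rewrite scaler0 addr0.
have {}xE : ⁅x, J x⁆ = (p / mu) *: t + (q / mu) *: J t.
  by rewrite -[LHS](scalerK mu0) xE scalerDr !scalerA !(mulrC mu^-1).
have q0 : q = 0.
  apply: (ad_eigenvalue0 nilp (x := x) (v := J x)
    (S := fun v => exists a b c, v = a *: x + b *: w + c *: J w)).
  - split; first by exists 0, 0, 0; rewrite !scale0r !addr0.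
    move=> e _ _ [a [b [c ->]]] [a' [b' [c' ->]]].
    exists (e * a + a'), (e * b + b'), (e * c + c'); by_functional.
  - move=> _ [a [b [c ->]]]; exists 0, 0, 0.
    by rewrite !lieDr !lieZr liexx cw Dxr !scaler0 !scale0r !addr0.
  - exists p, (p / mu * nu), (q / mu * nu).
    rewrite xE JtE /t; apply: functional_ext => f fD fZ fN f0.
    by rewrite !(fD, fZ, fN); field.
  - move=> [a [b [c /(congr1 (m^~ (J x)))]]].
    rewrite !dotE !hJ (uf22 uf) xJx wJx wx => /eqP.
    by rewrite !mulr0 !addr0 oner_eq0.
have p0 : - p = 0.
  apply: (ad_eigenvalue0 nilp (x := J x) (v := x)
    (S := fun v => exists a b c, v = a *: J x + b *: w + c *: J w)).
  - split; first by exists 0, 0, 0; rewrite !scale0r !addr0.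
    move=> e _ _ [a [b [c ->]]] [a' [b' [c' ->]]].
    exists (e * a + a'), (e * b + b'), (e * c + c'); by_functional.
  - move=> _ [a [b [c ->]]]; exists 0, 0, 0.
    by rewrite !lieDr !lieZr liexx cw DJxr !scaler0 !scale0r !addr0.
  - exists (- q), (- (p / mu * nu)), (- (q / mu * nu)).
    rewrite (lieC x (J x)) xE JtE /t; apply: functional_ext => f fD fZ fN f0.
    by rewrite !(fD, fZ, fN); field.
  - move=> [a [b [c /(congr1 (m^~ x))]]].
    rewrite !dotE !(dotJl JJ hJ) (uf22 uf) xJx wJx wx => /eqP.
    by rewrite !(mulr0, addr0, oppr0) oner_eq0.
rewrite xE q0; move/eqP: p0; rewrite oppr_eq0 => /eqP->.
by rewrite !mul0r !scale0r addr0.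
Qed.

Let uJu0 : ⁅u, J u⁆ = 0.
Proof.
have := balanced_bracket_sum JJ hJ dim6 nilp bal uf.
by rewrite xJx0 cwl !addr0.
Qed.

Lemma exists_bracket_coords y : ⁅J w, y⁆ = 0 -> exists a b c d,
  y = a *: t + b *: J t + c *: w + d *: J w.
Proof.
rewrite adJwE => y0; have [|yu yJu] := @t_free (m y u) (m y (J u)) 0.
  by rewrite y0 scale0r addr0.
exists (m y x / mu), (m y (J x) / mu), (m y w - m y x / mu * nu),
  (m y (J w) - m y (J x) / mu * nu).
rewrite {1}(expand y) yu yJu JtE /t; apply: functional_ext => f fD fZ fN f0.
by rewrite !(fD, fZ, fN); field.
Qed.

Let Dt : ⁅J w, t⁆ = 0.
Proof. by rewrite /t lieDr !lieZr Dx cw !scaler0 addr0. Qed.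
Let DJt : ⁅J w, J t⁆ = 0.
Proof. by rewrite JtE lieDr !lieZr DJx liexx !scaler0 addr0. Qed.

Let xt0 : ⁅x, t⁆ = 0.
Proof. by rewrite /t lieDr !lieZr liexx cw !scaler0 addr0. Qed.
Let Jxt0 : ⁅J x, t⁆ = 0.
Proof. by rewrite /t lieDr !lieZr (lieC x) xJx0 cw oppr0 !scaler0 addr0. Qed.
Let xJt0 : ⁅x, J t⁆ = 0.
Proof. by rewrite JtE lieDr !lieZr xJx0 Dxr !scaler0 addr0. Qed.
Let JxJt0 : ⁅J x, J t⁆ = 0.
Proof. by rewrite JtE lieDr !lieZr liexx DJxr !scaler0 addr0. Qed.

Let tt0 : ⁅t, J t⁆ = 0.
Proof. by rewrite {1}/t lieDl !lieZl xJt0 cwl !scaler0 addr0. Qed.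

(** The Jacobi identity for J w and two of the vectors u, J u, t, J t puts
    [u, t] and [u, J t] into the kernel of ad (J w), and identifies [J u, t]
    with [u, J t]. *)
Let adut : ⁅J w, ⁅u, t⁆⁆ = 0.
Proof. by rewrite lie_jacobi Dt lie0r Du -/t liexx addr0. Qed.
Let aduJt : ⁅J w, ⁅u, J t⁆⁆ = 0.
Proof. by rewrite lie_jacobi DJt lie0r Du -/t tt0 addr0. Qed.
Let JuE : ⁅J u, t⁆ = ⁅u, J t⁆.
Proof.
have : ⁅J w, ⁅u, J u⁆⁆ = 0 by rewrite uJu0 lie0r.
rewrite lie_jacobi Du DJu -JtE -/t (lieC (J u) t) => /eqP.
by rewrite addrC subr_eq0 => /eqP.
Qed.
Let JuJt : ⁅J u, J t⁆ = ⁅u, t⁆ + 2%:R *: J ⁅u, J t⁆.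
Proof. by rewrite Nij JuE; by_functional. Qed.

Let t_not_central : ~ ((forall y, ⁅y, t⁆ = 0) /\ (forall y, ⁅y, J t⁆ = 0)).
Proof.
move=> [t1 t2]; have t0 := noJcenter t1 t2.
have [] := @t_free 1 0 0.
  by rewrite t0 !scaler0 endo0 scaler0 scale0r !addr0.
by move=> /eqP; rewrite oner_eq0.
Qed.

Let tspan v := v = t \/ v = J t \/ v = J w.

Let tspan_t : bracket_span tspan t.
Proof.
have -> : t = (-1) *: ⁅u, J w⁆ + 0.
  by rewrite (lieC (J w) u) Du -/t; by_functional.
apply: BrSpanBracket; first by right; right.
by apply: BrSpanCentral => y; rewrite lie0r.
Qed.

Let tspan_Jt : bracket_span tspan (J t).
Proof.
have -> : J t = (-1) *: ⁅J u, J w⁆ + 0.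
  by rewrite (lieC (J w) (J u)) DJu JtE; by_functional.
apply: BrSpanBracket; first by right; right.
by apply: BrSpanCentral => y; rewrite lie0r.
Qed.

(** Otherwise t, J t, J w would lie in the span of their own brackets and of w,
    so that J w would be central. *)
Let no_Jw_component y v a b c d : tspan v ->
  ⁅y, v⁆ = a *: t + b *: J t + c *: w + d *: J w -> d = 0.
Proof.
move=> Pv yv; apply: contrapT => /eqP d0.
have JwE : J w = d^-1 *: ⁅y, v⁆ + (a / d *: ⁅u, J w⁆ + (b / d *: ⁅J u, J w⁆ +
    - (c / d) *: w)).
  rewrite yv (lieC (J w) u) (lieC (J w) (J u)) Du DJu -JtE -/t.
  by apply: functional_ext => f fD fZ fN f0; rewrite !(fD, fZ, fN); field.
have Jw_central : forall z, ⁅z, J w⁆ = 0.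
  apply: (bracket_span_central nilp (P := tspan)); last by right; right.
  move=> _ [->|[->|->]] //.
  rewrite [X in bracket_span _ X]JwE; apply: BrSpanBracket => //.
  apply: BrSpanBracket; first by right; right.
  apply: BrSpanBracket; first by right; right.
  by apply: BrSpanCentral => z; rewrite lieZr cw scaler0.
have w0 := noJcenter cw Jw_central.
by have := uf33 uf; rewrite w0 dot0l => /eqP; rewrite eq_sym oner_eq0.
Qed.

(** The brackets [u, t] and [u, J t] are combinations of t, J t, w, J w, and so
    is [J u, J t] = [u, t] + 2 J [u, J t]. None of them has a component along
    J w, which also removes the component of [u, J t] along w. If [u, J t] were
    not zero, t and J t would be in the span of their own brackets. The
    components of [u, t] along t and J t are then eigenvalues of ad u and of
    ad (J u), and c = 0 would make t and J t central. *)
Lemma triangular_frame_brackets : exists2 c, c != 0 &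
  [/\ ⁅u, J u⁆ = 0, ⁅x, J x⁆ = 0 &
   [/\ ⁅u, t⁆ = c *: w, ⁅J u, J t⁆ = c *: w, ⁅u, J t⁆ = 0 & ⁅J u, t⁆ = 0]].
Proof.
have Pt : tspan t by left.
have PJt : tspan (J t) by right; left.
have [a1 [a2 [a3 [a4 aE]]]] := exists_bracket_coords adut.
have [b1 [b2 [b3 [b4 bE]]]] := exists_bracket_coords aduJt.
have a40 := no_Jw_component Pt aE; have b40 := no_Jw_component PJt bE.
have cE : ⁅J u, J t⁆ = (a1 - 2%:R * b2) *: t + (a2 + 2%:R * b1) *: J t +
    (a3 - 2%:R * b4) *: w + (a4 + 2%:R * b3) *: J w.
  by rewrite JuJt aE bE !endoE !JJ; by_functional.
have := no_Jw_component PJt cE; rewrite a40 add0r => /eqP.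
rewrite mulf_eq0 pnatr_eq0 /= => /eqP b30.
move: aE bE cE; rewrite a40 b40 b30 !mulr0 subr0 !addr0 !scale0r !addr0 => aE bE cE.
have b_eq0 : b1 ^+ 2 + b2 ^+ 2 = 0.
  (* Here [u, J t] = b1 t + b2 J t, while [u, t] - [J u, J t] is
     2 (b2 t - b1 J t); the two are independent unless b1 = b2 = 0. *)
  apply: contrapT => /eqP b_neq0; apply: t_not_central.
  pose P v := v = t \/ v = J t.
  have PP : forall v, P v -> bracket_span P v.
    move=> _ [->|->].
    - have -> : t = (b1 / (b1 ^+ 2 + b2 ^+ 2)) *: ⁅u, J t⁆ +
          ((b2 / (b1 ^+ 2 + b2 ^+ 2) / 2%:R) *: ⁅u, t⁆ +
          (- (b2 / (b1 ^+ 2 + b2 ^+ 2) / 2%:R) *: ⁅J u, J t⁆ + 0)).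
        rewrite aE bE cE; apply: functional_ext => f fD fZ fN f0.
        by rewrite !(fD, fZ, fN, f0); field.
      apply: BrSpanBracket; first by right.
      apply: BrSpanBracket; first by left.
      apply: BrSpanBracket; first by right.
      by apply: BrSpanCentral => z; rewrite lie0r.
    - have -> : J t = (b2 / (b1 ^+ 2 + b2 ^+ 2)) *: ⁅u, J t⁆ +
          (- (b1 / (b1 ^+ 2 + b2 ^+ 2) / 2%:R) *: ⁅u, t⁆ +
          ((b1 / (b1 ^+ 2 + b2 ^+ 2) / 2%:R) *: ⁅J u, J t⁆ + 0)).
        rewrite aE bE cE; apply: functional_ext => f fD fZ fN f0.
        by rewrite !(fD, fZ, fN, f0); field.
      apply: BrSpanBracket; first by right.
      apply: BrSpanBracket; first by left.
      apply: BrSpanBracket; first by right.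
      by apply: BrSpanCentral => z; rewrite lie0r.
  by split; apply: (bracket_span_central nilp PP); [left | right].
move/eqP: b_eq0; rewrite paddr_eq0 ?sqr_ge0 // !sqrf_eq0.
move=> /andP[/eqP b10 /eqP b20].
move: bE cE; rewrite b10 b20 !mulr0 subr0 !addr0 !scale0r addr0 => bE cE.
have a10 : a1 = 0.
  apply: (ad_eigenvalue0 nilp (x := u) (v := t)
    (S := fun v => exists a b, v = a *: J t + b *: w)).
  - split; first by exists 0, 0; rewrite !scale0r !addr0.
    move=> e _ _ [a [b ->]] [a' [b' ->]].
    exists (e * a + a'), (e * b + b'); by_functional.
  - move=> _ [a [b ->]]; exists 0, 0.
    by rewrite !lieDr !lieZr bE cw !scaler0 !scale0r !addr0.
  - by exists a2, a3; rewrite aE; by_functional.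
  - move=> [a [b tE]].
    have [] := @t_free 1 (- a) (- b); first by rewrite [in 1 *: t]tE; by_functional.
    by move=> /eqP; rewrite oner_eq0.
have a20 : a2 = 0.
  apply: (ad_eigenvalue0 nilp (x := J u) (v := J t)
    (S := fun v => exists a b, v = a *: t + b *: w)).
  - split; first by exists 0, 0; rewrite !scale0r !addr0.
    move=> e _ _ [a [b ->]] [a' [b' ->]].
    exists (e * a + a'), (e * b + b'); by_functional.
  - move=> _ [a [b ->]]; exists 0, 0.
    by rewrite !lieDr !lieZr JuE bE cw !scaler0 !scale0r !addr0.
  - by exists a1, a3; rewrite cE; by_functional.
  - move=> [a [b tE]].
    have [] := @t_free (- a) 1 (- b); first by rewrite [in 1 *: J t]tE; by_functional.
    by move=> _ /eqP; rewrite oner_eq0.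
move: aE cE; rewrite a10 a20 !scale0r !add0r => aE cE.
exists a3; last by split=> //; split=> //; rewrite JuE.
apply/eqP => a30; apply: t_not_central.
rewrite a30 scale0r in aE cE.
by split; apply: (central_of_frame csJ hJ dim6 uf) => //; rewrite ?JuE ?cwl.
Qed.
End TriangularFrame.
End NonNilpotent.

(** * Unitary coframes *)

Section ComplexNumbers.
Local Open Scope complex_scope.
Variable R : realType.
Implicit Types x y z : R[i].

Lemma complex_ext x y :
  complex.Re x = complex.Re y -> complex.Im x = complex.Im y -> x = y.
Proof. by case: x y => [a b] [c d] /= -> ->. Qed.
Lemma ReD x y : complex.Re (x + y) = complex.Re x + complex.Re y.
Proof. by case: x y => [a b] [c d]. Qed.
Lemma ImD x y : complex.Im (x + y) = complex.Im x + complex.Im y.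
Proof. by case: x y => [a b] [c d]. Qed.
Lemma ReN x : complex.Re (- x) = - complex.Re x.
Proof. by case: x. Qed.
Lemma ImN x : complex.Im (- x) = - complex.Im x.
Proof. by case: x. Qed.
Lemma ReM x y : complex.Re (x * y) =
  complex.Re x * complex.Re y - complex.Im x * complex.Im y.
Proof. by case: x y => [a b] [c d]. Qed.
Lemma ImM x y : complex.Im (x * y) =
  complex.Re x * complex.Im y + complex.Im x * complex.Re y.
Proof. by case: x y => [a b] [c d]. Qed.
Lemma ReJ x : complex.Re x^*%C = complex.Re x.
Proof. by case: x. Qed.
Lemma ImJ x : complex.Im x^*%C = - complex.Im x.
Proof. by case: x. Qed.
Definition ReImE := (ReD, ImD, ReN, ImN, ReM, ImM, ReJ, ImJ).

Lemma conjD x y : (x + y)^*%C = x^*%C + y^*%C.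
Proof. exact: rmorphD. Qed.
Lemma conjN x : (- x)^*%C = - x^*%C.
Proof. exact: rmorphN. Qed.
Lemma conjM x y : (x * y)^*%C = x^*%C * y^*%C.
Proof. exact: rmorphM. Qed.
Lemma conj_real (a : R) : a%:C^*%C = a%:C.
Proof. exact: conjc_real. Qed.
Definition conjE := (conjD, conjN, conjM, @conjcK R, conj_real).

Lemma exists_phase z : exists2 e : R[i], e * e^*%C = 1 & exists2 r : R, 0 <= r &
  e * z = r%:C.
Proof.
have [p [q [pq r_ge0 r0]]] := unit_rotation (complex.Re z) (complex.Im z).
exists (p +i* q).
  by apply: complex_ext; rewrite !ReImE /=; last (by ring); rewrite -[RHS]pq; ring.
exists (p * complex.Re z - q * complex.Im z) => //.
by apply: complex_ext; rewrite !ReImE.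
Qed.

Lemma exists_sqrt_phase (e : R[i]) :
  e * e^*%C = 1 -> exists2 y : R[i], y * y^*%C = 1 & y ^+ 2 = e.
Proof.
move=> e1; exists (sqrtc e); last exact: sqr_sqrtc.
set y := sqrtc e; have ye : y ^+ 2 = e by rewrite sqr_sqrtc.
have : (y * y^*%C) ^+ 2 = 1 by rewrite exprMn -[y^*%C ^+ 2]conjM -expr2 ye.
move/eqP; rewrite sqrf_eq1 => /orP[/eqP //|/eqP yN].
have := mulcJ_ge0 y; rewrite yN.
by rewrite oppr_ge0 => /le_lt_trans/(_ (@ltr01 R[i])); rewrite ltxx.
Qed.
End ComplexNumbers.

Section Coframes.
Local Open Scope complex_scope.
Variables (R : realType) (g : lieAlgebra R) (J : 'End(g)).
Variable m : {dot g for idfun}.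
Hypotheses (JJ : forall x, J (J x) = - x) (hJ : hermitian_metric J m).
Hypothesis dim6 : \dim {:g} = 6%N.
Implicit Types (w : g -> R[i]) (X Y : g).

Lemma form10D w X Y : is_10_form J w -> w (X + Y) = w X + w Y.
Proof. by case=> wL _; have := wL 1 X Y; rewrite scale1r mul1r. Qed.
Lemma form10_0 w : is_10_form J w -> w 0 = 0.
Proof. by move=> w10; apply: (addIr (w 0)); rewrite -form10D // !add0r. Qed.
Lemma form10Z w (a : R) X : is_10_form J w -> w (a *: X) = a%:C * w X.
Proof. by move=> w10; have := w10.1 a X 0; rewrite form10_0 // !addr0. Qed.
Lemma form10N w X : is_10_form J w -> w (- X) = - w X.
Proof. by move=> w10; rewrite -scaleN1r form10Z // rmorphN mulN1r. Qed.
Lemma form10J w X : is_10_form J w -> w (J X) = - ('i%C * w X).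
Proof. by move=> w10; rewrite -w10.2 opprK. Qed.

Lemma form10_lin w1 w2 (a b : R[i]) : is_10_form J w1 -> is_10_form J w2 ->
  is_10_form J (fun X => a * w1 X + b * w2 X).
Proof.
move=> h1 h2; split=> [c X Y|X]; first by rewrite /= h1.1 h2.1; ring.
by rewrite /= !form10J //; ring.
Qed.

Lemma form10_scale w (a : R[i]) : is_10_form J w ->
  is_10_form J (fun X => a * w X).
Proof.
move=> h1; split=> [c X Y|X]; first by rewrite /= h1.1; ring.
by rewrite /= !form10J //; ring.
Qed.

Lemma form10_re_linear w : is_10_form J w ->
  linear ((fun X => complex.Re (w X)) : g -> R^o).
Proof.
by move=> w10 a X Y; rewrite w10.1 ReD ReM /= mul0r subr0.
Qed.
Lemma form10_im_linear w : is_10_form J w ->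
  linear ((fun X => complex.Im (w X)) : g -> R^o).
Proof.
by move=> w10 a X Y; rewrite w10.1 ImD ImM /= mul0r addr0.
Qed.

Record unitary_coframe w1 w2 w3 : Prop := UnitaryCoframe {
  uc1 : is_10_form J w1; uc2 : is_10_form J w2; uc3 : is_10_form J w3;
  uc_metric : forall X Y,
    m X Y = complex.Re (w1 X * (w1 Y)^*%C + w2 X * (w2 Y)^*%C + w3 X * (w3 Y)^*%C) }.

Lemma coframe_inj w1 w2 w3 X : unitary_coframe w1 w2 w3 ->
  w1 X = 0 -> w2 X = 0 -> w3 X = 0 -> X = 0.
Proof.
move=> [_ _ _ wm] h1 h2 h3; apply: (dot_eq0 (m := m)).
by rewrite wm h1 h2 h3 !mul0r !addr0.
Qed.

(** The (1,0)-form with value 1 at u that vanishes on the orthogonal complement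
    of u and J u, for a unit vector u. *)
Definition frame_form u (X : g) : R[i] := m X u +i* (- m X (J u)).

Lemma frame_form10 u : is_10_form J (frame_form u).
Proof.
split=> [a X Y|X]; rewrite /frame_form; apply: complex_ext.
- by rewrite !ReImE /= !dotE; ring.
- by rewrite !ReImE /= !dotE; ring.
- by rewrite !ReImE /= (dotJl JJ hJ); ring.
- by rewrite !ReImE /= hJ; ring.
Qed.

Lemma frame_coframe u1 u2 u3 : unitary_frame J m u1 u2 u3 ->
  unitary_coframe (frame_form u1) (frame_form u2) (frame_form u3).
Proof.
move=> uf; split; try exact: frame_form10.
move=> X Y; rewrite {1}(unitary_expand JJ hJ uf dim6 X) !dotE !ReImE /=.
rewrite ![m _ Y]dotC; ring.
Qed.

Lemma coframe_surj (w1 w2 w3 : g -> R[i]) (z1 z2 z3 : R[i]) :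
  is_10_form J w1 -> is_10_form J w2 -> is_10_form J w3 ->
  (forall X, w1 X = 0 -> w2 X = 0 -> w3 X = 0 -> X = 0) ->
  exists X, [/\ w1 X = z1, w2 X = z2 & w3 X = z3].
Proof.
move=> h1 h2 h3 inj.
pose e (i : 'I_6) : 'Hom(g, R^o) := nth 0 [:: functional (form10_re_linear h1);
  functional (form10_im_linear h1); functional (form10_re_linear h2);
  functional (form10_im_linear h2); functional (form10_re_linear h3);
  functional (form10_im_linear h3)] i.
pose r (i : 'I_6) := nth 0 [:: complex.Re z1; complex.Im z1; complex.Re z2;
  complex.Im z2; complex.Re z3; complex.Im z3] i.
have lt6 i : (i < 6)%N -> (i < 6)%N by [].
have [v v0|X Xr] := @coords_surjective _ _ 6 e dim6 _ r.
  have v0E i (i6 : (i < 6)%N) := v0 (Ordinal i6).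
  apply: inj; apply: complex_ext.
  - by have := v0E 0%N isT; rewrite functionalE.
  - by have := v0E 1%N isT; rewrite functionalE.
  - by have := v0E 2%N isT; rewrite functionalE.
  - by have := v0E 3%N isT; rewrite functionalE.
  - by have := v0E 4%N isT; rewrite functionalE.
  - by have := v0E 5%N isT; rewrite functionalE.
have XrE i (i6 : (i < 6)%N) := Xr (Ordinal i6).
exists X; split; apply: complex_ext.
- by have := XrE 0%N isT; rewrite functionalE.
- by have := XrE 1%N isT; rewrite functionalE.
- by have := XrE 2%N isT; rewrite functionalE.
- by have := XrE 3%N isT; rewrite functionalE.
- by have := XrE 4%N isT; rewrite functionalE.
- by have := XrE 5%N isT; rewrite functionalE.
Qed.

(** The (1,0)-form e^i + i e^{i+1} of an adapted basis, for i = 1, 3, 5. *)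
Definition cform (e : 6.-tuple (dual_space g)) i (X : g) : R[i] :=
  coform e i X +i* coform e i.+1 X.

Lemma coformP (e : 6.-tuple (dual_space g)) i (a : R) X Y :
  coform e i (a *: X + Y) = a * coform e i X + coform e i Y.
Proof. exact: linearP. Qed.

Lemma adapted_coframe e : adapted_basis e J m ->
  unitary_coframe (cform e 1) (cform e 3) (cform e 5).
Proof.
case=> _ J1 J3 J5 fund.
have Jodd i : J_dual J (coform e i) = - coform e i.+1 ->
    forall X, coform e i (J X) = coform e i.+1 X.
  move=> Ji X; have := congr1 (fun f : dual_space g => f X) Ji.
  by rewrite /J_dual !opp_lfunE comp_lfunE => /oppr_inj.
have Jeven i : J_dual J (coform e i) = - coform e i.+1 ->
    forall X, coform e i.+1 (J X) = - coform e i X.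
  by move=> /Jodd Ji X; rewrite -Ji JJ linearN.
have form10 i : J_dual J (coform e i) = - coform e i.+1 ->
    is_10_form J (cform e i).
  move=> Ji; split=> [a X Y|X]; rewrite /cform; apply: complex_ext.
  - by rewrite !ReImE /= coformP; ring.
  - by rewrite !ReImE /= coformP; ring.
  - by rewrite !ReImE /= (Jodd _ Ji); ring.
  - by rewrite !ReImE /= (Jeven _ Ji); ring.
split; try exact: form10.
move=> X Y; have := congr1 (fun f => f (fun i => if i == 0 then X else J Y)) fund.
rewrite /fundamental /= JJ dotNr.
rewrite -[X in _ = X]/(_ + _ + _) /= !wedge11E /=.
rewrite !(Jodd _ J1) !(Jodd _ J3) !(Jodd _ J5).
rewrite !(Jeven _ J1) !(Jeven _ J3) !(Jeven _ J5) => mE.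
lra.
Qed.

Lemma coframe_adapted w1 w2 w3 : unitary_coframe w1 w2 w3 ->
  exists2 e, adapted_basis e J m &
  [/\ forall X, cform e 1 X = w1 X, forall X, cform e 3 X = w2 X &
      forall X, cform e 5 X = w3 X].
Proof.
move=> uc; have [h1 h2 h3 wm] := uc.
pose e : 6.-tuple (dual_space g) := [tuple functional (form10_re_linear h1);
  functional (form10_im_linear h1); functional (form10_re_linear h2);
  functional (form10_im_linear h2); functional (form10_re_linear h3);
  functional (form10_im_linear h3)].
have [e1 e2 e3] : [/\ forall X, cform e 1 X = w1 X, forall X, cform e 3 X = w2 X &
      forall X, cform e 5 X = w3 X].
  by split=> X; apply: complex_ext; rewrite /= /coform /= functionalE.
have eJ w (h : is_10_form J w) : J_dual J (functional (form10_re_linear h)) =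
    - functional (form10_im_linear h).
  apply/lfunP => X; rewrite /J_dual !opp_lfunE comp_lfunE !functionalE.
  by rewrite form10J // !ReImE /=; ring.
exists e => //; split=> //; try exact: eJ; last first.
  apply: funext => X; rewrite /fundamental wm.
  rewrite -[RHS]/(_ + _ + _) /= !wedge11E /coform /= !functionalE.
  by rewrite !form10J // !ReImE /=; ring.
have eE X : [/\ coform e 1 X = complex.Re (w1 X), coform e 2 X = complex.Im (w1 X),
    coform e 3 X = complex.Re (w2 X), coform e 4 X = complex.Im (w2 X) &
    coform e 5 X = complex.Re (w3 X) /\ coform e 6 X = complex.Im (w3 X)].
  by rewrite -e1 -e2 -e3.
have dimD : \dim {:dual_space g} = 6%N.
  by rewrite dimvf /dim /= muln1 -dim6 dimvf.
rewrite basisEfree subvf size_tuple dimD leqnn !andbT.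
apply/freeP => k k0 i.
have k0E X : k ord0 * complex.Re (w1 X) + k 1 * complex.Im (w1 X) +
    k 2%:R * complex.Re (w2 X) + k 3%:R * complex.Im (w2 X) +
    k 4%:R * complex.Re (w3 X) + k 5%:R * complex.Im (w3 X) = 0.
  have := congr1 (fun f : dual_space g => f X) k0.
  rewrite sum_lfunE !big_ord_recl big_ord0 !scale_lfunE /=.
  have -> : (0 : dual_space g) X = 0 by rewrite lfunE.
  rewrite !functionalE addr0 !addrA => kE; rewrite -[RHS]kE.
  do !congr (_ + _); congr (k _ * _); exact: val_inj.
have surj z1 z2 z3 := @coframe_surj w1 w2 w3 z1 z2 z3 h1 h2 h3
  (fun X => coframe_inj uc).
have [X0 [x01 x02 x03]] := surj 1 0 0.
have [X1 [x11 x12 x13]] := surj 'i%C 0 0.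
have [X2 [x21 x22 x23]] := surj 0 1 0.
have [X3 [x31 x32 x33]] := surj 0 'i%C 0.
have [X4 [x41 x42 x43]] := surj 0 0 1.
have [X5 [x51 x52 x53]] := surj 0 0 'i%C.
have := k0E X0; rewrite x01 x02 x03 /= => k00.
have := k0E X1; rewrite x11 x12 x13 /= => k01.
have := k0E X2; rewrite x21 x22 x23 /= => k02.
have := k0E X3; rewrite x31 x32 x33 /= => k03.
have := k0E X4; rewrite x41 x42 x43 /= => k04.
have := k0E X5; rewrite x51 x52 x53 /= => k05.
case: i => [[|[|[|[|[|[|//]]]]]] i6].
- by rewrite (_ : Ordinal i6 = ord0); [lra | apply: val_inj].
- by rewrite (_ : Ordinal i6 = 1); [lra | apply: val_inj].
- by rewrite (_ : Ordinal i6 = 2%:R); [lra | apply: val_inj].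
- by rewrite (_ : Ordinal i6 = 3%:R); [lra | apply: val_inj].
- by rewrite (_ : Ordinal i6 = 4%:R); [lra | apply: val_inj].
- by rewrite (_ : Ordinal i6 = 5%:R); [lra | apply: val_inj].
Qed.
End Coframes.

(** * Two-step structure equations *)

Section TwoStep.
Local Open Scope complex_scope.
Variables (R : realType) (g : lieAlgebra R) (J : 'End(g)).
Variable m : {dot g for idfun}.
Hypotheses (csJ : complex_structure J) (hJ : hermitian_metric J m).
Hypothesis dim6 : \dim {:g} = 6%N.
Implicit Types (w : g -> R[i]) (X Y : g).

Let JJ : forall x, J (J x) = - x := csJ.1.

Definition wconj (a b : g -> R[i]) X Y : R[i] :=
  a X * (b Y)^*%C - a Y * (b X)^*%C.

Definition wform (a b : g -> R[i]) X Y : R[i] := a X * b Y - a Y * b X.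

(** The (2,0)-part and the primitive (1,1)-part of dw3. *)
Definition prim_form w1 w2 (rho A B C : R[i]) X Y : R[i] :=
  rho * wform w1 w2 X Y + A * (wconj w1 w1 X Y - wconj w2 w2 X Y) +
  B * wconj w1 w2 X Y + C * wconj w2 w1 X Y.

(** The equations dw1 = dw2 = 0 and dw3 = prim_form; the sign is that of
    d a (X, Y) = - a [X, Y]. *)
Definition two_step w1 w2 w3 (rho A B C : R[i]) := forall X Y,
  [/\ w1 ⁅X, Y⁆ = 0, w2 ⁅X, Y⁆ = 0 &
      w3 ⁅X, Y⁆ = - prim_form w1 w2 rho A B C X Y].

Lemma unitary_rotate w1 w2 w3 (p q : R[i]) : p * p^*%C + q * q^*%C = 1 ->
  unitary_coframe J m w1 w2 w3 ->
  unitary_coframe J m (fun X => p * w1 X + q * w2 X)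
    (fun X => (- q^*%C) * w1 X + p^*%C * w2 X) w3.
Proof.
move=> pq [h1 h2 h3 wm]; split=> //; try exact: form10_lin.
move=> X Y; rewrite wm; congr (complex.Re (_ + _)).
rewrite !conjE -[LHS]mul1r -pq; ring.
Qed.

(** The rotation has determinant one, so it fixes the (2,0)-part, and it
    conjugates the matrix [[A, B], [C, - A]] of the (1,1)-part. *)
Lemma two_step_rotate w1 w2 w3 (p q rho A B C : R[i]) :
  p * p^*%C + q * q^*%C = 1 -> two_step w1 w2 w3 rho A B C ->
  two_step (fun X => p * w1 X + q * w2 X)
    (fun X => (- q^*%C) * w1 X + p^*%C * w2 X) w3 rho
    (p^*%C * (A * p + B * q) + q^*%C * (C * p - A * q))
    (p^*%C * (B * p^*%C - A * q^*%C) - q^*%C * (C * q^*%C + A * p^*%C))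
    (p * (C * p - A * q) - q * (A * p + B * q)).
Proof.
move=> pq ts X Y; have [h1 h2 ->] := ts X Y; rewrite h1 h2.
split; rewrite ?mulr0 ?addr0 //; congr (- _).
have wE Z : w1 Z = p^*%C * (p * w1 Z + q * w2 Z) -
    q * (- q^*%C * w1 Z + p^*%C * w2 Z).
  by rewrite -[LHS]mul1r -pq; ring.
have w2E Z : w2 Z = q^*%C * (p * w1 Z + q * w2 Z) +
    p * (- q^*%C * w1 Z + p^*%C * w2 Z).
  by rewrite -[LHS]mul1r -pq; ring.
rewrite /prim_form /wform /wconj.
move: (wE X) (wE Y) (w2E X) (w2E Y).
set x1 := p * w1 X + _; set y1 := p * w1 Y + _.
set x2 := _ * w1 X + _; set y2 := _ * w1 Y + _.
move: x1 y1 x2 y2 => x1 y1 x2 y2 -> -> -> ->; rewrite !conjE.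
have -> : rho * (x1 * y2 - y1 * x2) =
  (p * p^*%C + q * q^*%C) * (rho * (x1 * y2 - y1 * x2)) by rewrite pq mul1r.
ring.
Qed.

Lemma unitary_phase w1 w2 w3 (p q r : R[i]) :
  p * p^*%C = 1 -> q * q^*%C = 1 -> r * r^*%C = 1 ->
  unitary_coframe J m w1 w2 w3 ->
  unitary_coframe J m (fun X => p * w1 X) (fun X => q * w2 X)
    (fun X => r * w3 X).
Proof.
move=> p1 q1 r1 [h1 h2 h3 wm]; split=> //; try exact: form10_scale.
move=> X Y; rewrite wm; congr (complex.Re (_ + _ + _)); rewrite conjE.
- by rewrite -[LHS]mul1r -p1; ring.
- by rewrite -[LHS]mul1r -q1; ring.
- by rewrite -[LHS]mul1r -r1; ring.
Qed.

Lemma two_step_phase w1 w2 w3 (p q r rho A B C : R[i]) :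
  p * p^*%C = 1 -> q * q^*%C = 1 -> two_step w1 w2 w3 rho A B C ->
  two_step (fun X => p * w1 X) (fun X => q * w2 X) (fun X => r * w3 X)
    (r * p^*%C * q^*%C * rho) (r * A) (r * p^*%C * q * B) (r * p * q^*%C * C).
Proof.
move=> p1 q1 ts X Y; have [-> -> ->] := ts X Y.
split; rewrite ?mulr0 // mulrN; congr (- _).
rewrite /prim_form /wform /wconj !conjE.
set x1 := w1 X; set x2 := w2 X; set y1 := w1 Y; set y2 := w2 Y.
transitivity (r * (rho * ((p * p^*%C) * (q * q^*%C) * (x1 * y2 - y1 * x2)) +
   A * ((p * p^*%C) * (x1 * y1^*%C - y1 * x1^*%C)
       - (q * q^*%C) * (x2 * y2^*%C - y2 * x2^*%C)) +
   B * ((p * p^*%C) * (q * q^*%C) * (x1 * y2^*%C - y1 * x2^*%C)) +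
   C * ((p * p^*%C) * (q * q^*%C) * (x2 * y1^*%C - y2 * x1^*%C)))); last by ring.
by rewrite p1 q1; ring.
Qed.

Lemma two_step_ext w1 w2 w3 w1' w2' w3' rho A B C : (forall X, w1 X = w1' X) ->
  (forall X, w2 X = w2' X) -> (forall X, w3 X = w3' X) ->
  two_step w1 w2 w3 rho A B C -> two_step w1' w2' w3' rho A B C.
Proof. by move=> /funext <- /funext <- /funext <-. Qed.

(** A unit eigenvector (p, q) of the trace-free matrix [[A, B], [C, - A]]; the
    eigenvalues are the square roots of A^2 + B C. *)
Lemma exists_unit_eigenvector (A B C : R[i]) : exists p q : R[i],
  p * p^*%C + q * q^*%C = 1 /\ p * (C * p - A * q) - q * (A * p + B * q) = 0.
Proof.
pose l := sqrtc (A ^+ 2 + B * C).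
have l2 : l ^+ 2 = A ^+ 2 + B * C by rewrite sqr_sqrtc.
have [x [y [xy0 xy]]] : exists x y : R[i], (x != 0) || (y != 0) /\
    x * (C * x - A * y) - y * (A * x + B * y) = 0.
  have [B0|B0] := eqVneq B 0.
    by exists 0, 1; rewrite oner_eq0 orbT B0; split=> //; ring.
  exists B, (l - A); rewrite B0; split=> //.
  have -> : B * (C * B - A * (l - A)) - (l - A) * (A * B + B * (l - A)) =
     B * (A ^+ 2 + B * C - l ^+ 2) by ring.
  by rewrite l2 subrr mulr0.
pose n2 := complex.Re x ^+ 2 + complex.Im x ^+ 2 + complex.Re y ^+ 2 +
  complex.Im y ^+ 2.
have n2E : x * x^*%C + y * y^*%C = n2%:C.
  by apply: complex_ext; rewrite !ReImE /= /n2; ring.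
have n2_ge0 : 0 <= n2 by rewrite !addr_ge0 ?sqr_ge0.
have n2_neq0 : n2 != 0.
  apply: contraTneq xy0 => n0; rewrite negb_or !negbK.
  move/eqP: n0; rewrite /n2 !paddr_eq0 ?addr_ge0 ?sqr_ge0 // !sqrf_eq0.
  move=> /andP[/andP[/andP[/eqP a /eqP b] /eqP c] /eqP d].
  by apply/andP; split; apply/eqP; apply: complex_ext.
pose n : R[i] := (Num.sqrt n2)%:C.
have nn : n * n = n2%:C.
  by rewrite /n -rmorphM /= -expr2 sqr_sqrtr.
have n2C : n2%:C != 0 :> R[i].
  by rewrite -(rmorph0 (real_complex R)) (inj_eq (@complexI R)).
have n0 : n != 0 by apply: contraNneq n2C => n0; rewrite -nn n0 mul0r.
have nJ : n^-1^*%C = n^-1 by rewrite conjc_inv /n conj_real.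
exists (x / n), (y / n); split.
  rewrite !conjE nJ.
  transitivity ((x * x^*%C + y * y^*%C) / (n * n)); first by field.
  by rewrite nn n2E divff.
by rewrite -[RHS](mul0r (n^-1 * n^-1)) -xy; ring.
Qed.

(** Schur triangularization makes C vanish; phases then make the remaining
    coefficients real and nonnegative. The three phases x, y, r of w1, w2, w3
    multiply the coefficients by r / (x y), r and r y / x, which can be
    prescribed independently: y is a square root of the ratio of the last to the
    first. *)
Lemma two_step_normal_form w1 w2 w3 rho A B C :
  unitary_coframe J m w1 w2 w3 -> two_step w1 w2 w3 rho A B C ->
  exists w1' w2' w3' (r l b : R), [/\ unitary_coframe J m w1' w2' w3',
    [/\ 0 <= r, 0 <= l & 0 <= b] & two_step w1' w2' w3' r%:C l%:C b%:C 0].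
Proof.
move=> uc ts; have [p [q [pq C0]]] := exists_unit_eigenvector A B C.
have {uc ts C0} [v1 [v2 [l [b [uc ts]]]]] : exists v1 v2 (l b : R[i]),
    unitary_coframe J m v1 v2 w3 /\ two_step v1 v2 w3 rho l b 0.
  have := two_step_rotate pq ts; rewrite C0 => ts'.
  by do 4!eexists; split; first exact: (unitary_rotate pq uc); exact: ts'.
have [r r1 [l' l'_ge0 rl]] := exists_phase l.
have [s s1 [rho' rho'_ge0 srho]] := exists_phase rho.
have [t t1 [b' b'_ge0 tb]] := exists_phase b.
have [|y y1 y2] := @exists_sqrt_phase _ (t * s^*%C).
  rewrite !conjE; transitivity ((t * t^*%C) * (s * s^*%C)); first by ring.
  by rewrite t1 s1 mulr1.
pose x := s^*%C * r * y^*%C.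
have x1 : x * x^*%C = 1.
  rewrite /x !conjE; transitivity ((s * s^*%C) * (r * r^*%C) * (y * y^*%C)).
    by ring.
  by rewrite s1 r1 y1 !mul1r.
exists (fun X => x * v1 X), (fun X => y * v2 X), (fun X => r * w3 X).
exists rho', l', b'; split=> //; first exact: (unitary_phase x1 y1 r1 uc).
have := two_step_phase r x1 y1 ts; rewrite mulr0 rl.
have -> : r * x^*%C * y^*%C * rho = rho'%:C.
  rewrite /x !conjE -srho.
  transitivity ((r * r^*%C) * (y * y^*%C) * (s * rho)); first by ring.
  by rewrite r1 y1 !mul1r.
have -> // : r * x^*%C * y * b = b'%:C.
rewrite /x !conjE -tb.
transitivity ((r * r^*%C) * (s * y ^+ 2 * b)); first by ring.
rewrite y2 r1; transitivity ((s * s^*%C) * (t * b)); first by ring.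
by rewrite s1 mul1r.
Qed.
End TwoStep.

Section TwoStepCases.
Local Open Scope complex_scope.
Variables (R : realType) (g : lieAlgebra R) (J : 'End(g)).
Variable m : {dot g for idfun}.
Hypotheses (csJ : complex_structure J) (hJ : hermitian_metric J m).
Hypothesis dim6 : \dim {:g} = 6%N.
Implicit Types (w : g -> R[i]) (X Y : g) (e : 6.-tuple (dual_space g)).

Let JJ : forall x, J (J x) = - x := csJ.1.

Local Notation d e i := (ext_d (form1 (coform e i))).

Lemma dform_eqP (a : dual_space g) (Phi : kform R g 2) :
  ext_d (form1 a) = Phi <-> forall X : 'I_2 -> g, a ⁅X 0, X 1⁆ = - Phi X.
Proof.
split=> [<- X|aPhi]; first by rewrite ext_d1E opprK.
by apply: funext => X; rewrite ext_d1E aPhi opprK.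
Qed.

Lemma two_step_adapted e (Phi5 Phi6 : kform R g 2) (rho A B C : R[i]) :
  (forall X : 'I_2 -> g, Phi5 X +i* Phi6 X =
     prim_form (cform e 1) (cform e 3) rho A B C (X 0) (X 1)) ->
  [/\ closed1234 e, d e 5 = Phi5 & d e 6 = Phi6] <->
  two_step (cform e 1) (cform e 3) (cform e 5) rho A B C.
Proof.
move=> PhiE; split=> [[[]]|ts].
  move=> /dform_eqP d1 /dform_eqP d2 /dform_eqP d3 /dform_eqP d4.
  move=> /dform_eqP d5 /dform_eqP d6 X Y.
  pose Z (i : 'I_2) := if i == 0 then X else Y.
  have := PhiE Z; rewrite /Z /= => <-.
  have := d1 Z; have := d2 Z; have := d3 Z; have := d4 Z.
  have := d5 Z; have := d6 Z; rewrite /Z /= => z6 z5 z4 z3 z2 z1.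
  split; apply: complex_ext; rewrite ?ReImE /=.
  - by rewrite z1 oppr0.
  - by rewrite z2 oppr0.
  - by rewrite z3 oppr0.
  - by rewrite z4 oppr0.
  - by rewrite z5.
  - by rewrite z6.
split; last 2 first.
- apply/dform_eqP => X; have [_ _] := ts (X 0) (X 1).
  by rewrite -PhiE => -[].
- apply/dform_eqP => X; have [_ _] := ts (X 0) (X 1).
  by rewrite -PhiE => -[].
split; apply/dform_eqP => X; have [] := ts (X 0) (X 1).
- by move=> [] -> _ _ _; rewrite oppr0.
- by move=> [] _ -> _ _; rewrite oppr0.
- by move=> _ [] -> _ _; rewrite oppr0.
- by move=> _ [] _ -> _; rewrite oppr0.
Qed.

Lemma case_A_two_step e t : case_A e t <-> t != 0 /\
  two_step (cform e 1) (cform e 3) (cform e 5) t%:C 0 0 0.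
Proof.
have [X|to from] := @two_step_adapted e
    (t *: (wedge_form (form1 (coform e 1)) (form1 (coform e 3))
         - wedge_form (form1 (coform e 2)) (form1 (coform e 4))))
    (t *: (wedge_form (form1 (coform e 1)) (form1 (coform e 4))
         + wedge_form (form1 (coform e 2)) (form1 (coform e 3))))
    t%:C 0 0 0.
  by apply: complex_ext; rewrite /= !kformE /prim_form /wform /wconj ?ReImE /=;
    ring.
by split=> [[t0 c d5 d6]|[t0 /from[c d5 d6]]]; split=> //; apply: to.
Qed.

Lemma case_B_two_step e rho b s t : case_B e rho b s t <->
  [/\ rho = 0 \/ rho = 1, s != 0 /\ t != 0 &
  two_step (cform e 1) (cform e 3) (cform e 5) (t / s * rho)%:C t%:C
    (t / s * b ^+ 2)%:C 0].
Proof.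
have [X|to from] := @two_step_adapted e
    ((t / s * (rho + b ^+ 2)) *:
       wedge_form (form1 (coform e 1)) (form1 (coform e 3))
     - (t / s * (rho - b ^+ 2)) *:
       wedge_form (form1 (coform e 2)) (form1 (coform e 4)))
    (- (2 * t) *: (wedge_form (form1 (coform e 1)) (form1 (coform e 2))
                   - wedge_form (form1 (coform e 3)) (form1 (coform e 4)))
     + (t / s * (rho - b ^+ 2)) *:
        wedge_form (form1 (coform e 1)) (form1 (coform e 4))
     + (t / s * (rho + b ^+ 2)) *:
        wedge_form (form1 (coform e 2)) (form1 (coform e 3)))
    (t / s * rho)%:C t%:C (t / s * b ^+ 2)%:C 0.
  by apply: complex_ext; rewrite /= !kformE /prim_form /wform /wconj ?ReImE /=;
    ring.
by split=> [[r0 st c d5 d6]|[r0 st /from[c d5 d6]]]; split=> //; apply: to.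
Qed.

Lemma case_C_two_step e rho b s t u1 u2 :
  let modu := Num.sqrt (u1 ^+ 2 + u2 ^+ 2) in
  let Y := 2 * Num.sqrt (s ^+ 2 - modu ^+ 2) / (modu * t) in
  let uJ := u1 -i* u2 in
  case_C e rho b s t u1 u2 <->
  [/\ rho = 0 \/ rho = 1, t != 0 & 0 < modu ^+ 2 < s ^+ 2] /\
  two_step (cform e 1) (cform e 3) (cform e 5)
    ((s * Y * (2 * rho * s))%:C * uJ)
    ((s * Y * modu)%:C * ((b ^+ 2)%:C * 'i%C * uJ - (2 * s ^+ 2)%:C))
    ((s * Y * b ^+ 2 * (s - modu * t * Y / 2))%:C * uJ)
    ((s * Y * b ^+ 2 * (s + modu * t * Y / 2))%:C * uJ).
Proof.
move=> modu Y uJ.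
pose E i j := wedge_form (form1 (coform e i)) (form1 (coform e j)).
have [X|to from] := @two_step_adapted e
   ((s * Y) *:
        ((2 * b ^+ 2 * u1 * modu) *: (E 1 2 - E 3 4)
         - (b ^+ 2 * t * u1 * modu * Y) *: (E 1 3 + E 2 4)
         + (2 * rho * s * u1) *: (E 1 3 - E 2 4)
         + (2 * s * u2) *: ((rho - b ^+ 2) *: E 1 4
                            + (rho + b ^+ 2) *: E 2 3)))
   ((s * Y) *:
        ((2 * (2 * s ^+ 2 - b ^+ 2 * u2) * modu) *: (E 1 2 - E 3 4)
         + (b ^+ 2 * t * u2 * modu * Y) *: (E 1 3 + E 2 4)
         - (2 * rho * s * u2) *: (E 1 3 - E 2 4)
         + (2 * s * u1) *: ((rho - b ^+ 2) *: E 1 4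
                            + (rho + b ^+ 2) *: E 2 3)))
    ((s * Y * (2 * rho * s))%:C * uJ)
    ((s * Y * modu)%:C * ((b ^+ 2)%:C * 'i%C * uJ - (2 * s ^+ 2)%:C))
    ((s * Y * b ^+ 2 * (s - modu * t * Y / 2))%:C * uJ)
    ((s * Y * b ^+ 2 * (s + modu * t * Y / 2))%:C * uJ).
  have n2 : 2 != 0 :> R by rewrite pnatr_eq0.
  rewrite /E; move: modu Y @uJ => md y; rewrite /=.
  apply: complex_ext; rewrite /= !kformE /prim_form /wform /wconj ?ReImE /=.
    by field.
  by field.
by split=> [[r0 c d5 d6]|[r0 /from[c d5 d6]]]; split=> //; apply: to.
Qed.
End TwoStepCases.

Section TwoStepProperties.
Local Open Scope complex_scope.
Variables (R : realType) (g : lieAlgebra R) (J : 'End(g)).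
Variable m : {dot g for idfun}.
Hypotheses (csJ : complex_structure J) (hJ : hermitian_metric J m).
Hypothesis dim6 : \dim {:g} = 6%N.
Implicit Types (w : g -> R[i]) (X Y : g).

Let JJ : forall x, J (J x) = - x := csJ.1.

Section Given.
Variables (w1 w2 w3 : g -> R[i]) (rho A B C : R[i]).
Hypothesis uc : unitary_coframe J m w1 w2 w3.
Hypothesis ts : two_step w1 w2 w3 rho A B C.

Let h1 := uc1 uc.
Let h2 := uc2 uc.
Let h3 := uc3 uc.

Lemma two_step_central X : w1 X = 0 -> w2 X = 0 -> forall Y, ⁅X, Y⁆ = 0.
Proof.
move=> x1 x2 Y; have [y1 y2 y3] := ts X Y.
apply: (coframe_inj uc) => //; rewrite y3 /prim_form /wform /wconj x1 x2.
by rewrite !conjc0; ring.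
Qed.

Lemma two_step_nilpotent : nilpotent_cs J.
Proof.
exists 2%N; apply/seteqP; split=> // X _ /= Y; split=> Z; rewrite /=.
all: have [x1 x2 _] := ts X Y; have [y1 y2 _] := ts (J X) Y.
all: by split; apply: two_step_central; rewrite ?form10J // ?x1 ?x2 ?y1 ?y2
  ?mulr0 ?oppr0.
Qed.

(** From (X, Y) to (J X, J Y) the (2,0)-part changes sign and the (1,1)-part
    does not. *)
Lemma two_step_abelian_cs : abelian_cs J <-> rho = 0.
Proof.
have JE X Y : w3 ⁅J X, J Y⁆ = w3 ⁅X, Y⁆ + 2 * rho * wform w1 w2 X Y.
  have [_ _ ->] := ts (J X) (J Y); have [_ _ ->] := ts X Y.
  rewrite /prim_form /wform /wconj !form10J // !conjE.
  have -> : 'i%C^*%C = - 'i%C :> R[i] by apply: complex_ext; rewrite /= ?oppr0.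
  have i2 : 'i%C * 'i%C = -1 :> R[i] by rewrite -expr2 sqr_i.
  transitivity (- (rho * (('i%C * 'i%C) * (w1 X * w2 Y - w1 Y * w2 X))) +
     ('i%C * 'i%C) * (A * (w1 X * (w1 Y)^*%C - w1 Y * (w1 X)^*%C
       - (w2 X * (w2 Y)^*%C - w2 Y * (w2 X)^*%C)) +
      B * (w1 X * (w2 Y)^*%C - w1 Y * (w2 X)^*%C) +
      C * (w2 X * (w1 Y)^*%C - w2 Y * (w1 X)^*%C))); first by ring.
  by rewrite i2; ring.
split=> [ab|rho0 X Y].
  have surj z1 z2 z3 := @coframe_surj _ _ _ dim6 w1 w2 w3 z1 z2 z3 h1 h2 h3
    (fun X => coframe_inj uc).
  have [X [x1 x2 _]] := surj 1 0 0; have [Y [y1 y2 _]] := surj 0 1 0.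
  have := JE X Y; rewrite ab /wform x1 x2 y1 y2 mulr1 mul0r subr0 mulr1.
  move=> /eqP; rewrite -[X in X == _]addr0 (inj_eq (addrI _)) eq_sym.
  by rewrite mulf_eq0 pnatr_eq0 /= => /eqP.
have [x1 x2 _] := ts (J X) (J Y); have [y1 y2 _] := ts X Y.
apply/eqP; rewrite -subr_eq0; apply/eqP; apply: (coframe_inj uc).
- by rewrite (form10D _ _ h1) (form10N _ h1) x1 y1 subrr.
- by rewrite (form10D _ _ h2) (form10N _ h2) x2 y2 subrr.
- by rewrite (form10D _ _ h3) (form10N _ h3) JE rho0 mulr0 mul0r addr0 subrr.
Qed.

Lemma two_step_eq0 : rho = 0 -> A = 0 -> B = 0 -> C = 0 -> lie_abelian g.
Proof.
move=> r0 A0 B0 C0 X Y; have [x1 x2 x3] := ts X Y.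
by apply: (coframe_inj uc) => //; rewrite x3 /prim_form r0 A0 B0 C0; ring.
Qed.
End Given.

(** The right hand sides are the values of - prim_form on the pairs (u1, J u1),
    (u1, u2), (u1, J u2), (J u1, u2) of a unitary frame; the system is
    invertible. *)
Lemma exists_prim_coefficients (a b11 b12 b21 : R[i]) :
  exists rho A B C : R[i], [/\ a = - (2 * 'i%C * A), b11 = C - B - rho,
    b12 = 'i%C * (rho - B - C) & b21 = 'i%C * (rho + B + C)].
Proof.
have [k ik] : exists k : R[i], 2 * 'i%C * k = -1.
  exists ('i%C / 2); transitivity (2 / 2 * 'i%C ^+ 2 : R[i]); first by ring.
  by rewrite sqr_i divff ?pnatr_eq0 // mul1r.
have [c c2] : exists c : R[i], 2 * c = 1.
  by exists 2^-1; rewrite divff ?pnatr_eq0.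
pose rho := - k * (b12 + b21).
exists rho, (k * a), ((k * (b12 - b21) - b11 - rho) * c),
  ((k * (b12 - b21) + b11 + rho) * c).
split.
- by rewrite mulrA ik mulN1r opprK.
- by transitivity (2 * c * (b11 + rho) - rho); [rewrite c2 | ]; ring.
- transitivity (- ('i%C * k * (b12 + b21)) - 2 * c * ('i%C * k * (b12 - b21))).
    rewrite c2; transitivity (- (2 * 'i%C * k) * b12); last by ring.
    by rewrite ik opprK mul1r.
  by rewrite /rho; ring.
- transitivity (- ('i%C * k * (b12 + b21)) + 2 * c * ('i%C * k * (b12 - b21))).
    rewrite c2; transitivity (- (2 * 'i%C * k) * b21); last by ring.
    by rewrite ik opprK mul1r.
  by rewrite /rho; ring.
Qed.

(** A 2-form on the planes of u1 and u2 has six complex values on pairs of frame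
    vectors. The balanced condition and integrability are one linear relation
    each, and the four values that remain determine rho, A, B, C. *)
Lemma two_step_of_central_plane u1 u2 c : unitary_frame J m u1 u2 c ->
  (forall x, ⁅x, c⁆ = 0) -> (forall x, ⁅x, J c⁆ = 0) ->
  lie_nilpotent g -> balanced J m ->
  exists rho A B C : R[i],
  two_step (frame_form J m u1) (frame_form J m u2) (frame_form J m c) rho A B C.
Proof.
move=> uf cc cJ nilp bal.
have line := abelian_mod_central_plane csJ hJ dim6 nilp bal uf cc cJ.
have cl X : ⁅c, X⁆ = 0 by rewrite lieC cc oppr0.
have cJl X : ⁅J c, X⁆ = 0 by rewrite lieC cJ oppr0.
have sumE : ⁅u2, J u2⁆ = - ⁅u1, J u1⁆.
  have := balanced_bracket_sum JJ hJ dim6 nilp bal uf.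
  by rewrite cl addr0 => /eqP; rewrite addrC addr_eq0 => /eqP.
have h3 := frame_form10 JJ hJ c; set w3 := frame_form J m c in h3 *.
have nij : w3 ⁅J u1, J u2⁆ = w3 ⁅u1, u2⁆ - 'i%C * (w3 ⁅J u1, u2⁆ + w3 ⁅u1, J u2⁆).
  by rewrite csJ.2 !(form10D _ _ h3) !(form10J _ h3); ring.
have [rho [A [B [C [aE b11E b12E b21E]]]]] := exists_prim_coefficients
  (w3 ⁅u1, J u1⁆) (w3 ⁅u1, u2⁆) (w3 ⁅u1, J u2⁆) (w3 ⁅J u1, u2⁆).
exists rho, A, B, C => X Y.
have [p [q pq]] := line X Y.
have c1 : m c u1 = 0 by rewrite dotC (uf13 uf).
have c2 : m c u2 = 0 by rewrite dotC (uf23 uf).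
have c1J : m c (J u1) = 0.
  by rewrite dotC (dotJl JJ hJ) (uf1J3 uf) oppr0.
have c2J : m c (J u2) = 0.
  by rewrite dotC (dotJl JJ hJ) (uf2J3 uf) oppr0.
split.
- rewrite pq; apply: complex_ext; rewrite /frame_form /=;
    by rewrite !dotE ?hJ ?(dotJl JJ hJ) c1 c1J; ring.
- rewrite pq; apply: complex_ext; rewrite /frame_form /=;
    by rewrite !dotE ?hJ ?(dotJl JJ hJ) c2 c2J; ring.
have expand := unitary_expand JJ hJ uf dim6.
transitivity (
  (m X u1 * m Y (J u1) - m X (J u1) * m Y u1)%:C * w3 ⁅u1, J u1⁆
  - (m X u2 * m Y (J u2) - m X (J u2) * m Y u2)%:C * w3 ⁅u1, J u1⁆
  + (m X u1 * m Y u2 - m X u2 * m Y u1)%:C * w3 ⁅u1, u2⁆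
  + (m X u1 * m Y (J u2) - m X (J u2) * m Y u1)%:C * w3 ⁅u1, J u2⁆
  + (m X (J u1) * m Y u2 - m X u2 * m Y (J u1))%:C * w3 ⁅J u1, u2⁆
  + (m X (J u1) * m Y (J u2) - m X (J u2) * m Y (J u1))%:C * w3 ⁅J u1, J u2⁆).
  rewrite {1}(expand X) {1}(expand Y) !lieDl !lieDr !lieZl !lieZr.
  rewrite !cc !cJ !cl !cJl !liexx (lieC u1 (J u1)) (lieC u1 u2) (lieC u1 (J u2)).
  rewrite (lieC (J u1) u2) (lieC (J u1) (J u2)) (lieC u2 (J u2)) sumE.
  rewrite !(form10D _ _ h3, form10Z _ _ h3, form10N _ h3, form10_0 h3).
  move: (w3 ⁅u1, J u1⁆) (w3 ⁅u1, u2⁆) (w3 ⁅u1, J u2⁆) (w3 ⁅J u1, u2⁆).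
  move: (w3 ⁅J u1, J u2⁆) => b22 a b11 b12 b21; rewrite !rmorphB !rmorphM /=.
  move: (m X u1)%:C (m X (J u1))%:C (m X u2)%:C (m X (J u2))%:C.
  move: (m Y u1)%:C (m Y (J u1))%:C (m Y u2)%:C (m Y (J u2))%:C.
  by clear => *; ring.
pose P u v := m X u * m Y v - m X v * m Y u.
have e12 : wform (frame_form J m u1) (frame_form J m u2) X Y =
    (P u1 u2 - P (J u1) (J u2)) +i* (- (P u1 (J u2) + P (J u1) u2)).
  by apply: complex_ext; rewrite /wform /frame_form /P /=; ring.
have e11 : wconj (frame_form J m u1) (frame_form J m u1) X Y =
    0 +i* (2 * P u1 (J u1)).
  by apply: complex_ext; rewrite /wconj /frame_form /P /=; ring.
have e22 : wconj (frame_form J m u2) (frame_form J m u2) X Y =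
    0 +i* (2 * P u2 (J u2)).
  by apply: complex_ext; rewrite /wconj /frame_form /P /=; ring.
have e1b2 : wconj (frame_form J m u1) (frame_form J m u2) X Y =
    (P u1 u2 + P (J u1) (J u2)) +i* (P u1 (J u2) - P (J u1) u2).
  by apply: complex_ext; rewrite /wconj /frame_form /P /=; ring.
have e2b1 : wconj (frame_form J m u2) (frame_form J m u1) X Y =
    - (P u1 u2 + P (J u1) (J u2)) +i* (P u1 (J u2) - P (J u1) u2).
  by apply: complex_ext; rewrite /wconj /frame_form /P /=; ring.
rewrite nij b12E b21E aE b11E /prim_form e12 e11 e22 e1b2 e2b1.
rewrite -/(P u1 (J u1)) -/(P u2 (J u2)) -/(P u1 u2) -/(P u1 (J u2)).
rewrite -/(P (J u1) u2) -/(P (J u1) (J u2)).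
move: (P u1 (J u1)) (P u2 (J u2)) (P u1 u2) (P u1 (J u2)) (P (J u1) u2).
move: (P (J u1) (J u2)).
clear -rho A B C; move: rho A B C => [r1 r2] [A1 A2] [B1 B2] [C1 C2] *.
by apply: complex_ext; rewrite /= ?ReImE; ring.
Qed.
End TwoStepProperties.

(** * Isomorphisms with the model Lie algebras *)

Section Models.
Local Open Scope complex_scope.
Variables (R : realType) (g : lieAlgebra R).
Hypothesis dim6 : \dim {:g} = 6%N.
Local Notation form := ('Hom(g, R^o)).
Implicit Types (f h : form) (X Y : g).

Lemma homD f h X : (f + h) X = f X + h X :> R.
Proof. by rewrite add_lfunE. Qed.
Lemma homN f X : (- f) X = - f X :> R.
Proof. by rewrite opp_lfunE. Qed.
Lemma homZ (a : R) f X : (a *: f) X = a * f X :> R.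
Proof. by rewrite scale_lfunE. Qed.
Definition homE := (homD, homN, homZ).

Lemma lie_iso_model (br : 'rV[R]_6 -> 'rV[R]_6 -> 'rV[R]_6)
    (brP : is_lie_bracket br) (f1 f2 f3 f4 f5 f6 : form) :
  let phi X := row6 [:: f1 X : R; f2 X : R; f3 X : R; f4 X : R; f5 X : R;
                        f6 X : R] in
  (forall X Y, phi ⁅X, Y⁆ = br (phi X) (phi Y)) ->
  (forall X, f1 X = 0 -> f2 X = 0 -> f3 X = 0 -> f4 X = 0 -> f5 X = 0 ->
     f6 X = 0 -> X = 0) ->
  lie_iso g (LieAlgebra brP).
Proof.
move=> phi phi_br inj.
pose e (i : 'I_6) : form := nth 0 [:: f1; f2; f3; f4; f5; f6] i.
have phiE X : linfun (coords e) X = phi X.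
  rewrite lfunE; apply/rowP => i; rewrite !mxE /e.
  by case: i => [[|[|[|[|[|[|//]]]]]] ?].
have ker0 : lker (linfun (coords e)) == 0%VS.
  apply/eqP; apply/eqP; rewrite -subv0; apply/subvP => X.
  rewrite memv_ker lfunE memv0 /= => /eqP/rowP X0.
  have X0E i (i6 : (i < 6)%N) := X0 (Ordinal i6).
  apply/eqP/inj.
  - by have := X0E 0%N isT; rewrite !mxE.
  - by have := X0E 1%N isT; rewrite !mxE.
  - by have := X0E 2%N isT; rewrite !mxE.
  - by have := X0E 3%N isT; rewrite !mxE.
  - by have := X0E 4%N isT; rewrite !mxE.
  - by have := X0E 5%N isT; rewrite !mxE.
exists (linfun (coords e) : 'Hom(g, lie_space (LieAlgebra brP))).
  have img : limg (linfun (coords e)) = fullv.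
    apply/eqP; rewrite eqEdim subvf /=.
    have := limg_ker_dim (linfun (coords e)) fullv.
    rewrite (eqP ker0) capv0 dimv0 add0n dim6 => ->.
    by rewrite dimvf /dim /= mul1n.
  exists ((linfun (coords e))^-1)%VF => X; first exact: lker0_lfunK.
  by apply: limg_lfunVK; rewrite img memvf.
by move=> X Y; rewrite !phiE phi_br.
Qed.

Section NormalForm.
Variables (x1 x2 x3 x4 x5 x6 : form) (P Q l : R).
Hypothesis inj : forall X, x1 X = 0 -> x2 X = 0 -> x3 X = 0 -> x4 X = 0 ->
  x5 X = 0 -> x6 X = 0 -> X = 0.
Local Notation w i j X Y := ((i X : R) * (j Y : R) - (j X : R) * (i Y : R)).
Hypotheses (x1E : forall X Y, x1 ⁅X, Y⁆ = 0) (x2E : forall X Y, x2 ⁅X, Y⁆ = 0)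
  (x3E : forall X Y, x3 ⁅X, Y⁆ = 0) (x4E : forall X Y, x4 ⁅X, Y⁆ = 0).
Hypothesis x5E : forall X Y, x5 ⁅X, Y⁆ = - (P * w x1 x3 X Y - Q * w x2 x4 X Y).
Hypothesis x6E : forall X Y, x6 ⁅X, Y⁆ = - (- (2 * l) * (w x1 x2 X Y - w x3 x4 X Y)
  + Q * w x1 x4 X Y + P * w x2 x3 X Y).

Ltac model_bracket :=
  let i := fresh "i" in
  move=> ? ?; apply: crd_ext; move=> i;
  do 6?[case: i => [_|i]]; rewrite // ?/br_h2 ?/br_h3 ?/br_h4 ?/br_h5 ?/br_h6
    !crd_row6 //= /crd2 ?crd_row6 //= ?homE ?x1E ?x2E ?x3E ?x4E ?x5E ?x6E.

Lemma normal_form_h3 : P = 0 -> Q = 0 -> l != 0 -> lie_iso g (h3 R).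
Proof.
move=> P0 Q0 l0.
have n2 : 2 != 0 :> R by rewrite pnatr_eq0.
apply: (@lie_iso_model _ (h3P R) x1 x2 x4 x3 x5 (- (2 * l)^-1 *: x6)) => [|X].
  by model_bracket; rewrite ?P0 ?Q0; field.
move=> a1 a2 a3 a4 a5; rewrite homE => /eqP.
rewrite mulf_eq0 oppr_eq0 invr_eq0 mulf_eq0 (negPf l0) (negPf n2) /= => /eqP a6.
exact: inj.
Qed.

Lemma normal_form_h6_P : P != 0 -> Q = 0 -> l = 0 -> lie_iso g (h6 R).
Proof.
move=> P0 Q0 l0.
apply: (@lie_iso_model _ (h6P R) x3 x1 x2 x4 (- P^-1 *: x5) (- P^-1 *: x6)) => [|X].
  by model_bracket; rewrite ?l0 ?Q0; field.
move=> a3 a1 a2 a4; rewrite !homE => /eqP + /eqP.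
by rewrite !mulf_eq0 oppr_eq0 invr_eq0 (negPf P0) /= => /eqP ? /eqP ?; apply: inj.
Qed.

Lemma normal_form_h6_Q : P = 0 -> Q != 0 -> l = 0 -> lie_iso g (h6 R).
Proof.
move=> P0 Q0 l0.
apply: (@lie_iso_model _ (h6P R) x4 x2 x1 x3 (Q^-1 *: x5) (- Q^-1 *: x6)) => [|X].
  by model_bracket; rewrite ?l0 ?P0; field.
move=> a4 a2 a1 a3; rewrite !homE => /eqP + /eqP.
by rewrite !mulf_eq0 oppr_eq0 invr_eq0 (negPf Q0) /= => /eqP ? /eqP ?; apply: inj.
Qed.

Lemma normal_form_h4_P : P != 0 -> Q = 0 -> l != 0 -> lie_iso g (h4 R).
Proof.
move=> P0 Q0 l0.
apply: (@lie_iso_model _ (h4P R) x1 x3 ((2 * l) *: x4 - P *: x2)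
  (- (2 * l) *: x2) (P^-1 *: x5) x6) => [|X].
  by model_bracket; rewrite ?Q0; field.
move=> a1 a3; rewrite !homE => + /eqP + /eqP + a6.
rewrite !mulf_eq0 oppr_eq0 mulf_eq0 invr_eq0 (negPf P0) (negPf l0) pnatr_eq0 /=.
move=> + /eqP a2 /eqP a5; rewrite a2 mulr0 subr0 => /eqP.
by rewrite !mulf_eq0 (negPf l0) pnatr_eq0 /= => /eqP a4; apply: inj.
Qed.

Lemma normal_form_h4_Q : P = 0 -> Q != 0 -> l != 0 -> lie_iso g (h4 R).
Proof.
move=> P0 Q0 l0.
apply: (@lie_iso_model _ (h4P R) x2 x4 (- (2 * l) *: x3 - Q *: x1)
  ((2 * l) *: x1) (- Q^-1 *: x5) x6) => [|X].
  by model_bracket; rewrite ?P0; field.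
move=> a2 a4; rewrite !homE => + /eqP + /eqP + a6.
rewrite !mulf_eq0 oppr_eq0 invr_eq0 (negPf Q0) (negPf l0) pnatr_eq0 /=.
move=> + /eqP a1 /eqP a5; rewrite a1 mulr0 subr0 => /eqP.
rewrite !mulf_eq0 oppr_eq0 mulf_eq0 (negPf l0) pnatr_eq0 /= => /eqP a3.
exact: inj.
Qed.

(** When neither P nor Q vanishes, dx5 and dx6 span a pencil of 2-forms. The
    wedge square of x dx5 + y dx6 is proportional to the quadratic form
    PQ x^2 + (PQ - 4 l^2) y^2, whose zeros are the decomposable members. If the
    form is degenerate, dx6 is decomposable and spans its radical: h4. *)
Lemma normal_form_h4 : P * Q = (2 * l) ^+ 2 -> P * Q != 0 -> lie_iso g (h4 R).
Proof.
move=> PQ; rewrite mulf_eq0 negb_or => /andP[P0 Q0].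
have l0 : l != 0.
  apply/eqP => l0; move/eqP: PQ; rewrite l0 mulr0 expr0n /= mulf_eq0.
  by rewrite (negPf P0) (negPf Q0).
have n2 : 2 != 0 :> R by rewrite pnatr_eq0.
have QE : Q = (2 * l) ^+ 2 / P by rewrite -PQ mulrAC mulfV ?mul1r.
apply: (@lie_iso_model _ (h4P R) (x1 + (P / (2 * l)) *: x3)
  (Q *: x4 - (2 * l) *: x2) x2 (P *: x3) x6 x5) => [|X].
  by model_bracket; rewrite ?QE; field; rewrite ?P0 ?l0.
rewrite !homE => + + a2 /eqP; rewrite mulf_eq0 (negPf P0) /= => + + /eqP a3.
rewrite a2 a3 !mulr0 subr0 addr0 => a1 /eqP.
by rewrite mulf_eq0 (negPf Q0) /= => /eqP a4 a6 a5; apply: inj.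
Qed.

(** The form is indefinite: the two real members dx5 + k dx6 and dx5 - k dx6
    are decomposable. *)
Lemma normal_form_h2 : 0 < P * Q < (2 * l) ^+ 2 -> lie_iso g (h2 R).
Proof.
set c := P * Q; set a := 2 * l => /andP[c_gt0 ca].
have /andP[P0 Q0] : (P != 0) && (Q != 0).
  by rewrite -negb_or -mulf_eq0 -/c lt0r_neq0.
pose k := Num.sqrt (c / (a ^+ 2 - c)).
have d_gt0 : 0 < a ^+ 2 - c by rewrite subr_gt0.
have k_gt0 : 0 < k by rewrite sqrtr_gt0 divr_gt0.
have k0 : k != 0 by rewrite lt0r_neq0.
have d0 : a ^+ 2 - c != 0 by rewrite lt0r_neq0.
have k2 : k ^+ 2 * (a ^+ 2 - c) = c.
  by rewrite sqr_sqrtr ?divfK // ltW // divr_gt0.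
apply: (@lie_iso_model _ (h2P R)
  (x1 + k *: x2 - (k * a / P) *: x4) (P *: x3 - (k * a) *: x2 + (k * Q) *: x4)
  (x1 - k *: x2 + (k * a / P) *: x4) (P *: x3 + (k * a) *: x2 - (k * Q) *: x4)
  (x5 + k *: x6) (x5 - k *: x6)) => [|X].
  have k1 : 1 + k ^+ 2 != 0 by rewrite lt0r_neq0 // ltr_wpDr ?sqr_ge0.
  have QE : Q = k ^+ 2 * a ^+ 2 / (P * (1 + k ^+ 2)).
    apply: (mulIf (mulf_neq0 P0 k1)); rewrite divfK ?mulf_neq0 //.
    by rewrite -[k ^+ 2 * a ^+ 2](subrK (k ^+ 2 * c)) -mulrBr k2 /c; ring.
  by model_bracket; rewrite -/a ?QE; field; rewrite ?P0 ?k1.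
rewrite !homE => b1 b2 b3 b4 b5 b6.
have z1 : x1 X = 0 by lra.
have z5 : x5 X = 0 by lra.
have /eqP : k * x6 X = 0 by lra.
rewrite mulf_eq0 (negPf k0) /= => /eqP z6.
have /eqP : P * x3 X = 0 by lra.
rewrite mulf_eq0 (negPf P0) /= => /eqP z3.
have /eqP : (k / P) * (a ^+ 2 - c) * x4 X = 0.
  transitivity (k * a * x2 X - k * Q * x4 X - a * (k * x2 X - k * a / P * x4 X)).
    by rewrite /c; field.
  have -> : k * a * x2 X - k * Q * x4 X = 0 by lra.
  have -> : k * x2 X - k * a / P * x4 X = 0 by lra.
  by rewrite mulr0 subr0.
rewrite !mulf_eq0 invr_eq0 (negPf k0) (negPf P0) (negPf d0) /= => /eqP z4.
have /eqP : k * x2 X = 0 by move: b1; rewrite z1 z4 mulr0 subr0 add0r.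
by rewrite mulf_eq0 (negPf k0) /= => /eqP z2; apply: inj.
Qed.

(** The form is definite: the conjugate complex members dx5 + i k dx6 and
    dx5 - i k dx6 are decomposable. *)
Lemma normal_form_h5 : P * Q != 0 -> P * Q < 0 \/ (2 * l) ^+ 2 < P * Q ->
  lie_iso g (h5 R).
Proof.
set c := P * Q; set a := 2 * l => c0 ca.
have /andP[P0 Q0] : (P != 0) && (Q != 0) by rewrite -negb_or -mulf_eq0.
have d0 : c - a ^+ 2 != 0.
  rewrite subr_eq0; case: ca => [c_lt0|/gt_eqF->//].
  by rewrite lt_eqF // (lt_le_trans c_lt0) ?sqr_ge0.
have ca_gt0 : 0 < c / (c - a ^+ 2).
  case: ca => ca.
    rewrite -mulrNN -invrN divr_gt0 // oppr_gt0 // subr_lt0.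
    by rewrite (lt_le_trans ca) ?sqr_ge0.
  by rewrite divr_gt0 ?subr_gt0 // (le_lt_trans _ ca) ?sqr_ge0.
pose k := Num.sqrt (c / (c - a ^+ 2)).
have k0 : k != 0 by rewrite sqrtr_eq0 -ltNge.
have k2 : k ^+ 2 * (c - a ^+ 2) = c by rewrite sqr_sqrtr ?divfK // ltW.
have k1 : k ^+ 2 * c - c = k ^+ 2 * a ^+ 2 by rewrite -{2}k2; ring.
apply: (@lie_iso_model _ (h5P R) x1 (k *: x2 - (k * a / P) *: x4)
  (P *: x3) ((k * Q) *: x4 - (k * a) *: x2) x5 (k *: x6)) => [|X].
  have QE : Q = k ^+ 2 * Q - k ^+ 2 * a ^+ 2 / P.
    by rewrite -k1 /c; field.
  model_bracket; rewrite -/a ?mulr0 ?subr0 //; last by field.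
  by rewrite [in LHS]QE; field.
rewrite !homE => z1 b2 /eqP + b4 z5 /eqP.
rewrite !mulf_eq0 (negPf k0) (negPf P0) /= => /eqP z3 /eqP z6.
have /eqP : (k / P) * (c - a ^+ 2) * x4 X = 0.
  transitivity ((k * Q * x4 X - k * a * x2 X) + a * (k * x2 X - k * a / P * x4 X)).
    by rewrite /c; field.
  by rewrite b2 b4 mulr0 addr0.
rewrite !mulf_eq0 invr_eq0 (negPf k0) (negPf P0) (negPf d0) /= => /eqP z4.
have /eqP : k * x2 X = 0 by move: b2; rewrite z4 mulr0 subr0.
by rewrite mulf_eq0 (negPf k0) /= => /eqP z2; apply: inj.
Qed.

Lemma normal_form_models : (P, Q, l) != (0, 0, 0) ->
  lie_iso g (h2 R) \/ lie_iso g (h3 R) \/ lie_iso g (h4 R) \/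
  lie_iso g (h5 R) \/ lie_iso g (h6 R).
Proof.
have [P0|P0] := eqVneq P 0; have [Q0|Q0] := eqVneq Q 0;
  have [l0|l0] := eqVneq l 0 => nz.
- by move: nz; rewrite P0 Q0 l0 eqxx.
- by do 1!right; left; apply: normal_form_h3.
- by do 4!right; apply: normal_form_h6_Q.
- by do 2!right; left; apply: normal_form_h4_Q.
- by do 4!right; apply: normal_form_h6_P.
- by do 2!right; left; apply: normal_form_h4_P.
all: have PQ0 : P * Q != 0 by rewrite mulf_neq0.
all: have [PQ|PQ|PQ] := ltgtP (P * Q) ((2 * l) ^+ 2);
  last by do 2!right; left; apply: normal_form_h4.
all: try by do 3!right; left; apply: normal_form_h5 => //; right.
all: have [PQ'|PQ'] := ltP (P * Q) 0;
  first by do 3!right; left; apply: normal_form_h5 => //; left.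
all: by left; apply: normal_form_h2; rewrite PQ lt_neqAle eq_sym PQ0 PQ'.
Qed.
End NormalForm.
End Models.

(** * Two-step balanced structures: the equations (A), (B) and (C) *)

Section TwoStepClassification.
Local Open Scope complex_scope.
Variables (R : realType) (g : lieAlgebra R) (J : 'End(g)).
Variable m : {dot g for idfun}.
Hypotheses (csJ : complex_structure J) (hJ : hermitian_metric J m).
Hypotheses (dim6 : \dim {:g} = 6%N) (nab : ~ lie_abelian g).
Implicit Types (w : g -> R[i]) (X Y : g).

Let JJ : forall x, J (J x) = - x := csJ.1.

Lemma two_step_real_forms w1 w2 w3 (r l b : R) : unitary_coframe J m w1 w2 w3 ->
  two_step w1 w2 w3 r%:C l%:C b%:C 0 ->
  exists x1 x2 x3 x4 x5 x6 : 'Hom(g, R^o),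
  [/\ forall X, x1 X = 0 -> x2 X = 0 -> x3 X = 0 -> x4 X = 0 -> x5 X = 0 ->
        x6 X = 0 -> X = 0,
     (forall X Y, x1 ⁅X, Y⁆ = 0) /\ (forall X Y, x2 ⁅X, Y⁆ = 0),
     (forall X Y, x3 ⁅X, Y⁆ = 0) /\ (forall X Y, x4 ⁅X, Y⁆ = 0),
     forall X Y, x5 ⁅X, Y⁆ =
       - ((r + b) * (x1 X * x3 Y - x3 X * x1 Y)
          - (r - b) * (x2 X * x4 Y - x4 X * x2 Y)) &
     forall X Y, x6 ⁅X, Y⁆ =
       - (- (2 * l) * (x1 X * x2 Y - x2 X * x1 Y - (x3 X * x4 Y - x4 X * x3 Y))
          + (r - b) * (x1 X * x4 Y - x4 X * x1 Y)
          + (r + b) * (x2 X * x3 Y - x3 X * x2 Y))].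
Proof.
move=> uc ts; have [h1 h2' h3' _] := uc.
exists (functional (form10_re_linear h1)), (functional (form10_im_linear h1)).
exists (functional (form10_re_linear h2')), (functional (form10_im_linear h2')).
exists (functional (form10_re_linear h3')), (functional (form10_im_linear h3')).
split.
- by move=> X; rewrite !functionalE => *; apply: (coframe_inj uc); apply: complex_ext.
- by split=> X Y; rewrite functionalE; have [-> _ _] := ts X Y.
- by split=> X Y; rewrite functionalE; have [_ -> _] := ts X Y.
- move=> X Y; rewrite !functionalE; have [_ _ ->] := ts X Y.
  by rewrite /prim_form /wform /wconj !ReImE /=; ring.
move=> X Y; rewrite !functionalE; have [_ _ ->] := ts X Y.
by rewrite /prim_form /wform /wconj !ReImE /=; ring.
Qed.

Lemma two_step_models w1 w2 w3 (rho A B C : R[i]) :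
  unitary_coframe J m w1 w2 w3 -> two_step w1 w2 w3 rho A B C ->
  [/\ lie_iso g (h2 R) \/ lie_iso g (h3 R) \/ lie_iso g (h4 R) \/
      lie_iso g (h5 R) \/ lie_iso g (h6 R) &
      abelian_cs J -> lie_iso g (h3 R) \/ lie_iso g (h5 R)].
Proof.
move=> uc0 ts0.
have [v1 [v2 [v3 [r [l [b [uc [r0 l0 b0] ts]]]]]]] := two_step_normal_form uc0 ts0.
have [x1 [x2 [x3 [x4 [x5 [x6 [inj [x1E x2E] [x3E x4E] x5E x6E]]]]]]] :=
  two_step_real_forms uc ts.
have nz : [|| r != 0, b != 0 | l != 0].
  apply/negPn/negP; rewrite !negb_or !negbK => /and3P[/eqP rz /eqP bz /eqP lz].
  by apply: nab; apply: (two_step_eq0 uc ts); rewrite ?rz ?bz ?lz.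
split.
  apply: (normal_form_models dim6 inj x1E x2E x3E x4E x5E x6E).
  apply: contraTneq nz => -[rb1 rb2 lz]; rewrite lz eqxx orbF negb_or !negbK.
  by apply/andP; split; apply/eqP; lra.
move=> /(two_step_abelian_cs dim6 uc ts) /(congr1 (@complex.Re R)) /= rz.
have [bz|bz] := eqVneq b 0.
  left; apply: (normal_form_h3 dim6 inj x1E x2E x3E x4E x5E x6E).
  - by rewrite rz bz addr0.
  - by rewrite rz bz subr0.
  - by move: nz; rewrite rz bz eqxx.
have bb : (r + b) * (r - b) < 0.
  by rewrite rz add0r sub0r mulrN oppr_lt0 -expr2 exprn_even_gt0.
right; apply: (normal_form_h5 dim6 inj x1E x2E x3E x4E x5E x6E); last by left.
by rewrite lt_eqF.
Qed.

(** Up to unitary conjugation a nilpotent 2 x 2 matrix is determined by its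
    norm. The matrix of (C) has determinant - 4 s^4 Y^2 |u|^2 (s^2 - i b^2 v),
    where v is the conjugate of u, so it is nilpotent for u = i s^2 / b^2. *)
Lemma two_step_case_C w1 w2 w3 (r b : R) : unitary_coframe J m w1 w2 w3 ->
  two_step w1 w2 w3 r%:C 0 b%:C 0 -> 0 <= r -> 0 < b ->
  exists e, adapted_basis e J m /\
    exists rho b s t u1 u2, case_C e rho b s t u1 u2.
Proof.
move=> uc ts r_ge0 b_gt0.
(* The rotation by (3, - 4 i) / 5 makes the entries of the conjugated nilpotent
   matrix those of (C) for s = 25 k and |u| = 24 k, where the square root of
   s^2 - |u|^2 is 7 k; k is then fixed by the quotient of r by b, and y, the Y
   of (C), by the size of b. *)
pose p : R[i] := (3 / 5)%:C; pose q : R[i] := 0 +i* - (4 / 5).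
have pq : p * p^*%C + q * q^*%C = 1.
  by apply: complex_ext; rewrite !ReImE /=; field.
have i1 : (- 'i%C) * (- 'i%C)^*%C = 1 :> R[i].
  by apply: complex_ext; rewrite !ReImE /=; ring.
have one1 : 1 * 1^*%C = 1 :> R[i] by rewrite conjc1 mulr1.
have uc' := unitary_phase one1 one1 i1 (unitary_rotate pq uc).
have ts' := two_step_phase (- 'i%C) one1 one1 (two_step_rotate pq ts).
have [e ae [e1 e2 e3]] := coframe_adapted dim6 uc'.
exists e; split=> //.
have {}ts' := two_step_ext (fsym e1) (fsym e2) (fsym e3) ts'.
have [rho [k [rho01 k_gt0 rE]]] : exists rho k : R, [/\ rho = 0 \/ rho = 1,
    0 < k & rho * (24 * b) = 625 * k * r].
  have [rz|rz] := eqVneq r 0.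
    by exists 0, 1; split; [left | exact: ltr01 | rewrite rz; ring].
  have r_gt0 : 0 < r by rewrite lt0r rz.
  exists 1, (24 * b / (625 * r)); split; first by right.
    have num_gt0 : 0 < 24 * b by lra.
    have den_gt0 : 0 < 625 * r by lra.
    exact: divr_gt0.
  by field.
have k0 : k != 0 by rewrite lt0r_neq0.
have b0 : b != 0 by rewrite lt0r_neq0.
pose y := 12 * b / (25 * (25 * k) ^+ 3 * (24 * k)).
have y_gt0 : 0 < y.
  apply: divr_gt0; first by lra.
  apply: mulr_gt0; last by lra.
  by apply: mulr_gt0; [lra | apply: exprn_gt0; lra].
have y0 : y != 0 by rewrite lt0r_neq0.
exists rho, (Num.sqrt (625 * k / 24)), (25 * k), (7 / (12 * y)), 0, (24 * k).
have b2 : Num.sqrt (625 * k / 24) ^+ 2 = 625 * k / 24 by rewrite sqr_sqrtr; lra.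
apply/case_C_two_step.
have -> : Num.sqrt (0 ^+ 2 + (24 * k) ^+ 2) = 24 * k.
  by rewrite expr0n add0r sqrtr_sqr ger0_norm //; lra.
have -> : Num.sqrt ((25 * k) ^+ 2 - (24 * k) ^+ 2) = 7 * k.
  have -> : (25 * k) ^+ 2 - (24 * k) ^+ 2 = (7 * k) ^+ 2 by ring.
  by rewrite sqrtr_sqr ger0_norm //; lra.
have -> : 2 * (7 * k) / (24 * k * (7 / (12 * y))) = y by field; rewrite k0 y0.
split.
  split=> //; first by apply: mulf_neq0; [lra | apply: invr_neq0; lra].
  by apply/andP; split; [apply: exprn_gt0; lra | nra].
have bE : b = y * (25 * (25 * k) ^+ 3 * (24 * k)) / 12 by rewrite /y; field.
have rE' : r = rho * y * (2 * 25 ^+ 2 * 24) * k ^+ 3.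
  have k625 : 625 * k != 0 by lra.
  by apply: (mulfI k625); rewrite -rE bE; field.
rewrite b2; clearbody y; move: ts'; rewrite bE rE'.
congr (two_step _ _ _ _ _ _ _).
- by apply: complex_ext; rewrite /p /q /=; field; rewrite ?y0.
- by apply: complex_ext; rewrite /p /q /=; field; rewrite ?y0.
- by apply: complex_ext; rewrite /p /q /=; field; rewrite ?y0.
- by apply: complex_ext; rewrite /p /q /=; field; rewrite ?y0.
Qed.

Lemma two_step_cases w1 w2 w3 (rho A B C : R[i]) :
  unitary_coframe J m w1 w2 w3 -> two_step w1 w2 w3 rho A B C ->
  exists e, adapted_basis e J m /\
    [\/ exists t, case_A e t, exists rho b s t, case_B e rho b s t |
        exists rho b s t u1 u2, case_C e rho b s t u1 u2].
Proof.
move=> uc0 ts0.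
have [v1 [v2 [v3 [r [l [b [uc [r_ge0 l_ge0 b_ge0] ts]]]]]]] :=
  two_step_normal_form uc0 ts0.
have [lz|l0] := eqVneq l 0.
  have [bz|b0] := eqVneq b 0.
    have [e ae [e1 e2 e3]] := coframe_adapted dim6 uc.
    exists e; split=> //; constructor 1; exists r; apply/case_A_two_step; split.
      apply/eqP => rz; apply: nab.
      by apply: (two_step_eq0 uc ts); rewrite ?rz ?bz ?lz.
    by apply: (two_step_ext (fsym e1) (fsym e2) (fsym e3)); rewrite lz bz in ts.
  have b_gt0 : 0 < b by rewrite lt0r b0.
  rewrite lz in ts; have [e [ae eC]] := two_step_case_C uc ts r_ge0 b_gt0.
  by exists e; split=> //; constructor 3.
have [e ae [e1 e2 e3]] := coframe_adapted dim6 uc.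
exists e; split=> //; constructor 2.
have {}ts := two_step_ext (fsym e1) (fsym e2) (fsym e3) ts.
have [rz|r0] := eqVneq r 0.
  exists 0, (Num.sqrt b), l, l; apply/case_B_two_step; split=> //; first by left.
  by rewrite divff // !mul1r sqr_sqrtr //; rewrite rz in ts.
exists 1, (Num.sqrt (b / r)), (l / r), l; apply/case_B_two_step; split=> //.
- by right.
- by rewrite mulf_neq0 ?invr_neq0.
have -> : l / (l / r) = r by field; rewrite r0.
by rewrite mulr1 sqr_sqrtr ?divr_ge0 // mulrCA divff // mulr1.
Qed.
End TwoStepClassification.

(** * The complex structures J0 *)

Section TenBasis.
Local Open Scope complex_scope.
Variables (R : realType) (g : lieAlgebra R) (J : 'End(g)).
Variable m : {dot g for idfun}.
Hypotheses (csJ : complex_structure J) (hJ : hermitian_metric J m).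
Hypothesis dim6 : \dim {:g} = 6%N.
Implicit Types (w : g -> R[i]) (X Y : g).

Let JJ : forall x, J (J x) = - x := csJ.1.

Lemma is_10_basis_inj w1 w2 w3 X : is_10_basis J w1 w2 w3 ->
  w1 X = 0 -> w2 X = 0 -> w3 X = 0 -> X = 0.
Proof.
move=> [_ _ _ span] z1 z2 z3; apply: (dot_eq0 (m := m)).
have [c [cE _]] := span _ (frame_form10 JJ hJ X).
by have := cE X; rewrite z1 z2 z3 !mulr0 !addr0 => /(congr1 (@complex.Re R)).
Qed.

Lemma is_10_basis_of_inj w1 w2 w3 : is_10_form J w1 -> is_10_form J w2 ->
  is_10_form J w3 -> (forall X, w1 X = 0 -> w2 X = 0 -> w3 X = 0 -> X = 0) ->
  is_10_basis J w1 w2 w3.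
Proof.
move=> h1 h2 h3 inj; split=> // w h.
have surj z1 z2 z3 := @coframe_surj _ _ _ dim6 w1 w2 w3 z1 z2 z3 h1 h2 h3 inj.
have [X1 [x11 x12 x13]] := surj 1 0 0.
have [X2 [x21 x22 x23]] := surj 0 1 0.
have [X3 [x31 x32 x33]] := surj 0 0 1.
pose cv (z : R[i]) (X : g) := complex.Re z *: X - complex.Im z *: J X.
have cvE v (hv : is_10_form J v) z X : v (cv z X) = z * v X.
  rewrite /cv (form10D _ _ hv) (form10N _ hv) !(form10Z _ _ hv) (form10J _ hv).
  by apply: complex_ext; rewrite !ReImE /=; ring.
clearbody cv; have expand X : X = cv (w1 X) X1 + cv (w2 X) X2 + cv (w3 X) X3.
  apply/eqP; rewrite -subr_eq0; apply/eqP; apply: inj.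
  - by rewrite !(form10D _ _ h1, form10N _ h1) !(cvE _ h1) x11 x21 x31; ring.
  - by rewrite !(form10D _ _ h2, form10N _ h2) !(cvE _ h2) x12 x22 x32; ring.
  - by rewrite !(form10D _ _ h3, form10N _ h3) !(cvE _ h3) x13 x23 x33; ring.
exists (w X1, w X2, w X3); split=> /= [X|[[c1 c2] c3] /= cE].
  by rewrite {1}(expand X) !(form10D _ _ h) !(cvE _ h); ring.
congr (_, _, _); rewrite cE ?(x11, x12, x13, x21, x22, x23, x31, x32, x33); ring.
Qed.

(** The structure equations of J0, with eps = 1 for J0^+ and eps = -1 for
    J0^-, evaluated at two vectors; in the second one, w3 enters through the
    sum of w3 and its conjugate, twice its real part. *)
Record J0_forms (eps : R) w1 w2 w3 : Prop := J0Forms {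
  j01 : is_10_form J w1; j02 : is_10_form J w2; j03 : is_10_form J w3;
  j0_inj : forall X, w1 X = 0 -> w2 X = 0 -> w3 X = 0 -> X = 0;
  j0_d1 : forall X Y, w1 ⁅X, Y⁆ = 0;
  j0_d2 : forall X Y, w2 ⁅X, Y⁆ =
    2%:C * (w1 Y * (complex.Re (w3 X))%:C - w1 X * (complex.Re (w3 Y))%:C);
  j0_d3 : forall X Y, w3 ⁅X, Y⁆ =
    0 +i* (- (2 * eps * complex.Re (w1 X * (w2 Y)^*%C - w1 Y * (w2 X)^*%C))) }.

Lemma J0_cs_forms neg :
  J0_cs J neg <-> exists w1 w2 w3, J0_forms ((-1) ^+ neg) w1 w2 w3.
Proof.
have signE : ((-1) ^+ neg * 'i%C : R[i]) = 0 +i* (-1) ^+ neg.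
  by apply: complex_ext; case: neg; rewrite ?expr0 ?expr1 !ReImE /=; ring.
split=> [[w1 [w2 [w3 [w10 d1 d2 d3]]]]|[w1 [w2 [w3 j0]]]]; exists w1, w2, w3.
  have [h1 h2 h3 _] := w10; split=> //.
  - by move=> X; apply: is_10_basis_inj.
  - move=> X Y; have := congr1 (fun f => f (fun i => if i == 0 then X else Y)) d1.
    rewrite ext_d1E /= => /(canRL (@opprK _)) ->; exact: oppr0.
  - move=> X Y; have := congr1 (fun f => f (fun i => if i == 0 then X else Y)) d2.
    rewrite ext_d1E -[X in _ = X]/(_ + _) /= !wedge11E /= => /(canRL (@opprK _)) ->.
    by rewrite /conj_form; apply: complex_ext; rewrite !ReImE /=; ring.
  - move=> X Y; have := congr1 (fun f => f (fun i => if i == 0 then X else Y)) d3.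
    rewrite signE ext_d1E -[X in _ = X]/(_ * (_ - _)) /= !wedge11E /=.
    move=> /(canRL (@opprK _)) ->.
    by rewrite /conj_form; apply: complex_ext; rewrite !ReImE /=; ring.
have [h1 h2 h3 inj e1 e2 e3] := j0; split.
- exact: is_10_basis_of_inj.
- by apply: funext => X; rewrite ext_d1E e1 oppr0.
- apply: funext => X; rewrite ext_d1E e2 -[RHS]/(_ + _) /= !wedge11E /conj_form.
  by apply: complex_ext; rewrite !ReImE /=; ring.
- apply: funext => X; rewrite signE ext_d1E e3 -[RHS]/(_ * (_ - _)) /= !wedge11E.
  by rewrite /conj_form; apply: complex_ext; rewrite !ReImE /=; ring.
Qed.

Section Given.
Variables (eps : R) (w1 w2 w3 : g -> R[i]).
Hypotheses (eps2 : eps ^+ 2 = 1) (j0 : J0_forms eps w1 w2 w3).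

Let h1 := j01 j0.
Let h2 := j02 j0.
Let h3 := j03 j0.
Let x1 := functional (form10_re_linear h1).
Let x2 := functional (form10_im_linear h1).
Let x3 := functional (form10_re_linear h2).
Let x4 := functional (form10_im_linear h2).
Let x5 := functional (form10_re_linear h3).
Let x6 := functional (form10_im_linear h3).

Let xE X : [/\ x1 X = complex.Re (w1 X), x2 X = complex.Im (w1 X),
  x3 X = complex.Re (w2 X), x4 X = complex.Im (w2 X) &
  x5 X = complex.Re (w3 X) /\ x6 X = complex.Im (w3 X)].
Proof. by rewrite !functionalE. Qed.

Let inj X : x1 X = 0 -> x2 X = 0 -> x3 X = 0 -> x4 X = 0 -> x5 X = 0 ->
  x6 X = 0 -> X = 0.
Proof.
have [-> -> -> -> [-> ->]] := xE X => *.
by apply: (j0_inj j0); apply: complex_ext.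
Qed.

Let dx1 X Y : x1 ⁅X, Y⁆ = 0.
Proof. by have [-> _ _ _ _] := xE ⁅X, Y⁆; rewrite (j0_d1 j0). Qed.
Let dx2 X Y : x2 ⁅X, Y⁆ = 0.
Proof. by have [_ -> _ _ _] := xE ⁅X, Y⁆; rewrite (j0_d1 j0). Qed.
Let dx5 X Y : x5 ⁅X, Y⁆ = 0.
Proof. by have [_ _ _ _ [-> _]] := xE ⁅X, Y⁆; rewrite (j0_d3 j0). Qed.
Let dx3 X Y : x3 ⁅X, Y⁆ = 2 * (x1 Y * x5 X - x1 X * x5 Y).
Proof.
have [_ _ -> _ _] := xE ⁅X, Y⁆; have [-> _ _ _ [-> _]] := xE X.
have [-> _ _ _ [-> _]] := xE Y; rewrite (j0_d2 j0) !ReImE /=; ring.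
Qed.
Let dx4 X Y : x4 ⁅X, Y⁆ = 2 * (x2 Y * x5 X - x2 X * x5 Y).
Proof.
have [_ _ _ -> _] := xE ⁅X, Y⁆; have [_ -> _ _ [-> _]] := xE X.
have [_ -> _ _ [-> _]] := xE Y; rewrite (j0_d2 j0) !ReImE /=; ring.
Qed.
Let dx6 X Y : x6 ⁅X, Y⁆ =
  - (2 * eps * (x1 X * x3 Y + x2 X * x4 Y - x1 Y * x3 X - x2 Y * x4 X)).
Proof.
have [_ _ _ _ [_ ->]] := xE ⁅X, Y⁆; have [-> -> -> -> _] := xE X.
have [-> -> -> -> _] := xE Y; rewrite (j0_d3 j0) !ReImE /=; ring.
Qed.

Let x5J X : x5 (J X) = x6 X.
Proof.
have [_ _ _ _ [-> _]] := xE (J X); have [_ _ _ _ [_ ->]] := xE X.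
by rewrite (form10J _ h3) !ReImE /=; ring.
Qed.

Let surj a1 a2 a3 a4 a5 a6 : exists X, [/\ x1 X = a1, x2 X = a2, x3 X = a3,
  x4 X = a4 & x5 X = a5 /\ x6 X = a6].
Proof.
have [X [e1 e2 e3]] := @coframe_surj _ _ _ dim6 w1 w2 w3 (a1 +i* a2) (a3 +i* a4)
  (a5 +i* a6) h1 h2 h3 (j0_inj j0).
by exists X; have [-> -> -> -> [-> ->]] := xE X; rewrite e1 e2 e3.
Qed.

Lemma J0_lie_iso_h19m : lie_iso g (h19m R).
Proof.
have n2 : 2 != 0 :> R by rewrite pnatr_eq0.
have e0 : eps != 0 by apply: contra_eqN eps2 => /eqP->; rewrite expr0n eq_sym oner_eq0.
apply: (@lie_iso_model _ _ dim6 _ (h19mP R) x1 x5 x2 (2^-1 *: x3) (- 2^-1 *: x4)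
  ((2^-1 * 2^-1 * eps) *: x6)) => [X Y|X].
  apply: crd_ext; case=> [|[|[|[|[|[|//]]]]]] _; rewrite /br_h19m !crd_row6 //=
    /crd2 ?crd_row6 //= ?homE ?dx1 ?dx2 ?dx3 ?dx4 ?dx5 ?dx6 //; try by field.
  transitivity (- (2^-1 * eps ^+ 2 *
    (x1 X * x3 Y + x2 X * x4 Y - x1 Y * x3 X - x2 Y * x4 X))).
    by field.
  by rewrite eps2; field.
move=> z1 z5 z2; rewrite !homE => /eqP + /eqP + /eqP.
rewrite !mulf_eq0 oppr_eq0 !invr_eq0 (negPf n2) (negPf e0) /=.
by move=> /eqP z3 /eqP z4 /eqP z6; apply: inj.
Qed.

Lemma J0_center X : (forall Y, ⁅X, Y⁆ = 0) ->
  [/\ x1 X = 0, x2 X = 0, x3 X = 0, x4 X = 0 & x5 X = 0].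
Proof.
move=> cX.
have c3 Y : x1 Y * x5 X - x1 X * x5 Y = 0.
  by have := dx3 X Y; rewrite cX linear0 => /esym/eqP; rewrite mulf_eq0 pnatr_eq0 => /eqP.
have c4 Y : x2 Y * x5 X - x2 X * x5 Y = 0.
  by have := dx4 X Y; rewrite cX linear0 => /esym/eqP; rewrite mulf_eq0 pnatr_eq0 => /eqP.
have e0 : 2 * eps != 0.
  rewrite mulf_neq0 ?pnatr_eq0 //.
  by apply: contra_eqN eps2 => /eqP->; rewrite expr0n eq_sym oner_eq0.
have c6 Y : x1 X * x3 Y + x2 X * x4 Y - x1 Y * x3 X - x2 Y * x4 X = 0.
  have := dx6 X Y; rewrite cX linear0 => /esym/eqP.
  by rewrite oppr_eq0 mulf_eq0 (negPf e0) => /eqP.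
have [Y1 [p1 p2 p3 p4 [p5 p6]]] := surj 1 0 0 0 0 0.
have [Y2 [q1 q2 q3 q4 [q5 q6]]] := surj 0 1 0 0 0 0.
have [Y5 [r1 r2 r3 r4 [r5 r6]]] := surj 0 0 0 0 1 0.
have := c3 Y1; have := c3 Y5; have := c4 Y5; have := c6 Y1; have := c6 Y2.
rewrite p1 p2 p3 p4 p5 q1 q2 q3 q4 r1 r2 r5 => t1 t2 t3 t4 t5.
by split; lra.
Qed.

Lemma J0_no_invariant_center X :
  (forall Y, ⁅X, Y⁆ = 0) -> (forall Y, ⁅J X, Y⁆ = 0) -> X = 0.
Proof.
move=> cX cJX; have [? ? ? ? ?] := J0_center cX.
by apply: inj => //; rewrite -x5J; have [] := J0_center cJX.
Qed.

(** The ascending series of J stays at zero, since the center contains no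
    J-invariant subspace. *)
Lemma J0_not_nilpotent : ~ nilpotent_cs J.
Proof.
have asc l : ascending_J J l = [set 0]%classic.
  elim: l => [//|l IHl] /=; rewrite IHl; apply/seteqP; split=> X /=.
    by move=> XY; apply: J0_no_invariant_center => Y; have [] := XY Y.
  by move=> -> Y; rewrite endo0 lie0l.
move=> [l]; rewrite asc => all0.
have [X [X1 _ _ _ _]] := surj 1 0 0 0 0 0.
have : [set 0]%classic X by rewrite all0.
by move=> X0; move: X1; rewrite X0 linear0 => /esym/eqP; rewrite oner_eq0.
Qed.

Lemma J0_not_abelian : ~ abelian_cs J.
Proof.
have x1J X : x1 (J X) = x2 X.
  have [-> _ _ _ _] := xE (J X); have [_ -> _ _ _] := xE X.
  by rewrite (form10J _ h1) !ReImE /=; ring.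
move=> ab.
have [Y1 [p1 p2 p3 p4 [p5 p6]]] := surj 1 0 0 0 0 0.
have [Y5 [r1 r2 r3 r4 [r5 r6]]] := surj 0 0 0 0 1 0.
have := congr1 x3 (ab Y5 Y1); rewrite !dx3 !x5J !x1J p1 p2 p5 p6 r1 r2 r5 r6.
lra.
Qed.

(** Here W has only the coordinate x6 and J W only x5, as the center is the axis
    of x6; [J W, Y] then has only the coordinates x3 and x4, proportional to
    those of Y along x1 and x2. *)
Lemma J0_double_bracket W Y : (forall Z, ⁅W, Z⁆ = 0) ->
  ⁅Y, ⁅J W, Y⁆⁆ = (- eps * (4 * (x1 Y ^+ 2 + x2 Y ^+ 2))) *: W.
Proof.
move=> cW; have [W1 W2 W3 W4 W5] := J0_center cW.
have [JW1 JW2 JW3 JW4] : [/\ x1 (J W) = 0, x2 (J W) = 0, x3 (J W) = 0 & x4 (J W) = 0].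
  move: W1 W2 W3 W4; have [-> -> -> -> _] := xE W; have [-> -> -> -> _] := xE (J W).
  rewrite (form10J _ h1) (form10J _ h2) !ReImE /= => z1 z2 z3 z4.
  by rewrite z1 z2 z3 z4; split; ring.
apply/eqP; rewrite -subr_eq0; apply/eqP; apply: inj; rewrite linearB linearZ /=.
- by rewrite dx1 W1 scaler0 subr0.
- by rewrite dx2 W2 scaler0 subr0.
- by rewrite dx3 W3 dx1 dx5 scaler0 subr0; ring.
- by rewrite dx4 W4 dx2 dx5 scaler0 subr0; ring.
- by rewrite dx5 W5 scaler0 subr0.
rewrite dx6 dx1 dx2 dx3 dx4 JW1 JW2 x5J -[_ *: _]/(_ * _); ring.
Qed.

Lemma exists_J0_double_bracket : exists W Y : g,
  [/\ W != 0, forall Z, ⁅W, Z⁆ = 0 & x1 Y ^+ 2 + x2 Y ^+ 2 = 1].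
Proof.
have [W [W1 W2 W3 W4 [W5 W6]]] := surj 0 0 0 0 0 1.
have [Y [Y1 Y2 _ _ _]] := surj 1 0 0 0 0 0.
exists W, Y; split; last by rewrite Y1 Y2; ring.
  by apply: contra_eqN W6 => /eqP->; rewrite linear0 eq_sym oner_eq0.
move=> Z; apply: inj; rewrite ?dx1 ?dx2 ?dx5 //.
- by rewrite dx3 W1 W5; ring.
- by rewrite dx4 W2 W5; ring.
- by rewrite dx6 W1 W2 W3 W4; ring.
Qed.
End Given.

(** The double brackets [Y, [J W, Y]] with W central do not depend on a basis,
    and they are multiples of W whose sign is that of - eps. *)
Lemma J0_cs_sign neg neg' : J0_cs J neg -> J0_cs J neg' -> neg' = neg.
Proof.
move=> /J0_cs_forms[w1 [w2 [w3 j0]]] /J0_cs_forms[v1 [v2 [v3 j0']]].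
have sq b : ((-1) ^+ b : R) ^+ 2 = 1 by rewrite sqrr_sign.
have [W [Y [W0 cW Y1]]] := exists_J0_double_bracket j0.
have e := J0_double_bracket (sq _) j0 Y cW.
have e' := J0_double_bracket (sq _) j0' Y cW.
move: e'; rewrite e Y1 => /eqP.
rewrite -subr_eq0 -scalerBl scaler_eq0 (negPf W0) orbF => /eqP.
set q' := (X in _ - _ * (4 * X)).
have q'_ge0 : 0 <= q' by rewrite addr_ge0 ?sqr_ge0.
clearbody q'; clear e Y1 j0 j0'; case: neg neg' => [] [] //=;
  rewrite ?expr0 ?expr1 => qE; exfalso; lra.
Qed.
End TenBasis.

(** * The structure equations (D) and (E) *)

Section CaseDE.
Local Open Scope complex_scope.
Variables (R : realType) (g : lieAlgebra R) (J : 'End(g)).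
Variable m : {dot g for idfun}.
Hypotheses (csJ : complex_structure J) (hJ : hermitian_metric J m).
Hypothesis dim6 : \dim {:g} = 6%N.
Implicit Types (w : g -> R[i]) (X Y : g) (e : 6.-tuple (dual_space g)).

Let JJ : forall x, J (J x) = - x := csJ.1.

Lemma dform_pair (a : dual_space g) (Phi : kform R g 2) X Y :
  ext_d (form1 a) = Phi -> a ⁅X, Y⁆ = - Phi (fun i => if i == 0 then X else Y).
Proof. by move=> /dform_eqP/(_ (fun i => if i == 0 then X else Y)). Qed.

Lemma case_D_J0 e neg r s : adapted_basis e J m -> case_D e neg r s ->
  J0_cs J neg.
Proof.
move=> ae [[r0 s0] [d1 d2 d5] d3 d4 d6]; apply/(J0_cs_forms csJ hJ dim6).
have uc := adapted_coframe csJ.1 ae; have [h1 h2 h3 _] := uc.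
exists (fun X => (r^-1)%:C * cform e 1 X), (fun X => (s^-1)%:C * cform e 3 X),
  (cform e 5).
have ri0 : (r^-1)%:C != 0 :> R[i].
  by rewrite -(rmorph0 (real_complex R)) (inj_eq (@complexI R)) invr_eq0.
have si0 : (s^-1)%:C != 0 :> R[i].
  by rewrite -(rmorph0 (real_complex R)) (inj_eq (@complexI R)) invr_eq0.
split=> //; try exact: form10_scale.
- move=> X /eqP + /eqP +; rewrite !mulf_eq0 (negPf ri0) (negPf si0) /=.
  by move=> /eqP z1 /eqP z2 z3; apply: (coframe_inj uc).
- move=> X Y; apply: complex_ext; rewrite !ReImE /=.
    by rewrite (dform_pair X Y d1) (dform_pair X Y d2) !kformE; ring.
  by rewrite (dform_pair X Y d1) (dform_pair X Y d2) !kformE; ring.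
- move=> X Y; apply: complex_ext; rewrite !ReImE /=.
    by rewrite (dform_pair X Y d3) (dform_pair X Y d4) !kformE /=; field; rewrite ?r0 ?s0.
  by rewrite (dform_pair X Y d3) (dform_pair X Y d4) !kformE /=; field; rewrite ?r0 ?s0.
- move=> X Y; apply: complex_ext; rewrite !ReImE /=.
    by rewrite (dform_pair X Y d5) !kformE oppr0.
  by rewrite (dform_pair X Y d6) !kformE /=; field; rewrite ?r0 ?s0.
Qed.

(** The inverse of z = s t + Z is s t - Z, so Z is half of z - 1 / z; this makes
    the coefficients of (E) rational in z. *)
Lemma case_E_Z (s t : R) : 1 < s ^+ 2 * t ^+ 2 ->
  let Z := Num.sqrt (s ^+ 2 * t ^+ 2 - 1) in
  [/\ s * t + Z != 0, Z != 0 &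
      Z = ((s * t + Z) ^+ 2 - 1) / (2 * (s * t + Z))].
Proof.
move=> st1 Z; have Z2 : Z ^+ 2 = s ^+ 2 * t ^+ 2 - 1.
  by rewrite sqr_sqrtr // subr_ge0 ltW.
have n2 : 2 != 0 :> R by rewrite pnatr_eq0.
have z1 : (s * t + Z) * (s * t - Z) = 1.
  transitivity (s ^+ 2 * t ^+ 2 - Z ^+ 2); first by ring.
  by rewrite Z2; ring.
have z0 : s * t + Z != 0.
  by apply: contra_eqN z1 => /eqP->; rewrite mul0r eq_sym oner_eq0.
split=> //; first by rewrite sqrtr_eq0 -ltNge subr_gt0.
apply: (mulIf (mulf_neq0 n2 z0)); rewrite divfK ?mulf_neq0 //.
by rewrite -[X in _ = _ - X]z1; ring.
Qed.

Lemma case_E_J0 e neg r s t : adapted_basis e J m -> case_E e neg r s t ->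
  J0_cs J neg.
Proof.
move=> ae; rewrite /case_E; set Z := Num.sqrt _; set k := _ * (t ^+ 2 / _).
move=> [[r0 s0 t0 st1] [d1 d2] d3 d4 [d5 d6]]; apply/(J0_cs_forms csJ hJ dim6).
have := case_E_Z st1; rewrite -/Z /=; move: d3 d4 d5 d6.
rewrite /k => {k}; set z := s * t + Z; clearbody z Z.
move=> d3 d4 d5 d6 [z0 Z0 ZE]; rewrite ZE in d3 d4 d5 d6 Z0.
have zz0 : z ^+ 2 - 1 != 0 by apply: contraNneq Z0 => ->; rewrite mul0r.
have uc := adapted_coframe csJ.1 ae; have [h1 h2 h3 _] := uc.
(* The form e4 + e5 / z is closed and becomes the real part of w3; up to
   factors, d maps e3 - z e6 and e4 + z e5 to its products with e1 and e2, and
   these two become the real and imaginary parts of w2. *)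
pose y := t / (s * z).
have y0 : y != 0 by rewrite !mulf_neq0 ?invr_neq0 ?mulf_neq0.
exists (fun X => (- r^-1)%:C * cform e 1 X),
  (fun X => y%:C * cform e 3 X + (0 +i* (y * z)) * cform e 5 X),
  (fun X => (0 +i* -1) * cform e 3 X + (z^-1)%:C * cform e 5 X).
split=> //; [exact: form10_scale | exact: form10_lin | exact: form10_lin | | | |].
- move=> X e1 e2 e3.
  have := congr1 (@complex.Re R) e1; have := congr1 (@complex.Im R) e1.
  have := congr1 (@complex.Re R) e2; have := congr1 (@complex.Im R) e2.
  have := congr1 (@complex.Re R) e3; have := congr1 (@complex.Im R) e3.
  rewrite !ReImE /=.
  set x1 := coform e 1 X; set x2 := coform e 2 X; set x3 := coform e 3 X.
  set x4 := coform e 4 X; set x5 := coform e 5 X; set x6 := coform e 6 X.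
  move=> a6 a5 a4 a3 a2 a1.
  have x10 : x1 = 0 by apply: (mulfI (invr_neq0 r0)); rewrite mulr0; lra.
  have x20 : x2 = 0 by apply: (mulfI (invr_neq0 r0)); rewrite mulr0; lra.
  have x3E : x3 = z * x6.
    by apply: (mulfI y0); apply/eqP; rewrite -subr_eq0; apply/eqP; lra.
  have x4E : x4 = - (z * x5).
    by apply: (mulfI y0); apply/eqP; rewrite -subr_eq0; apply/eqP; lra.
  have zi0 : (z ^+ 2 - 1) / z != 0 by rewrite mulf_neq0 ?invr_neq0.
  have x60 : x6 = 0.
    apply: (mulfI zi0); rewrite mulr0.
    transitivity (x3 - z^-1 * x6); first by rewrite x3E; field.
    lra.
  have x50 : x5 = 0.
    apply: (mulfI zi0); rewrite mulr0.
    transitivity (- (x4 + z^-1 * x5)); first by rewrite x4E; field.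
    lra.
  apply: (coframe_inj uc); apply: complex_ext; rewrite /= -/x1 -/x2 -/x3 -/x4 -/x5 -/x6 //.
    by rewrite x3E x60 mulr0.
  by rewrite x4E x50 mulr0 oppr0.
- move=> X Y; apply: complex_ext; rewrite !ReImE /=;
    by rewrite (dform_pair X Y d1) (dform_pair X Y d2) !kformE; ring.
- move=> X Y; apply: complex_ext; rewrite !ReImE /= (dform_pair X Y d3)
    (dform_pair X Y d4) (dform_pair X Y d5) (dform_pair X Y d6) !kformE /= /y;
    by field; rewrite ?r0 ?s0 ?t0 ?z0 ?zz0.
- move=> X Y; apply: complex_ext; rewrite !ReImE /= (dform_pair X Y d3)
    (dform_pair X Y d4) (dform_pair X Y d5) (dform_pair X Y d6) !kformE /= /y;
    by field; rewrite ?r0 ?s0 ?t0 ?z0 ?zz0.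
Qed.

Section TriangularFrameCases.
Variables (u x w : g) (mu nu c : R).
Hypotheses (uf : unitary_frame J m u x w) (mu_gt0 : 0 < mu) (nu_ge0 : 0 <= nu).
Hypotheses (c0 : c != 0) (cw : forall y, ⁅y, w⁆ = 0).
Let t := mu *: x + nu *: w.
Hypotheses (Du : ⁅J w, u⁆ = t) (DJu : ⁅J w, J u⁆ = J t)
  (Dx : ⁅J w, x⁆ = 0) (DJx : ⁅J w, J x⁆ = 0).
Hypotheses (uJu : ⁅u, J u⁆ = 0) (xJx : ⁅x, J x⁆ = 0).
Hypotheses (ut : ⁅u, t⁆ = c *: w) (JuJt : ⁅J u, J t⁆ = c *: w)
  (uJt : ⁅u, J t⁆ = 0) (Jut : ⁅J u, t⁆ = 0).

Let mu0 : mu != 0 := lt0r_neq0 mu_gt0.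

Local Notation "f ∧ h" := (fun X Y => m X f * m Y h - m Y f * m X h)
  (at level 40).

Lemma triangular_frame_coords X Y :
  [/\ m ⁅X, Y⁆ u = 0, m ⁅X, Y⁆ (J u) = 0,
    m ⁅X, Y⁆ x = mu * (J w ∧ u) X Y + nu * (u ∧ J x) X Y,
    m ⁅X, Y⁆ (J x) = mu * (J w ∧ J u) X Y + nu * (J u ∧ J x) X Y &
    m ⁅X, Y⁆ w = nu * (J w ∧ u) X Y + c / mu * ((u ∧ x) X Y + (J u ∧ J x) X Y)
      + nu ^+ 2 / mu * (u ∧ J x) X Y /\
    m ⁅X, Y⁆ (J w) = nu * (J w ∧ J u) X Y + nu ^+ 2 / mu * (J u ∧ J x) X Y].
Proof.
have JtE : J t = mu *: J x + nu *: J w by rewrite /t !endoE.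
have cl y : ⁅w, y⁆ = 0 by rewrite lieC cw oppr0.
have xE : x = mu^-1 *: (t - nu *: w) by rewrite /t addrK scalerK.
have JxE : J x = mu^-1 *: (J t - nu *: J w) by rewrite JtE addrK scalerK.
have ux : ⁅u, x⁆ = (c / mu) *: w.
  by rewrite xE lieZr lieDr lieNr lieZr ut cw; by_functional.
have Jux : ⁅J u, x⁆ = 0.
  by rewrite xE lieZr lieDr lieNr lieZr Jut cw; by_functional.
have uJw : ⁅u, J w⁆ = - t by rewrite lieC Du.
have JuJw : ⁅J u, J w⁆ = - J t by rewrite lieC DJu.
have uJx : ⁅u, J x⁆ = (nu / mu) *: t.
  by rewrite JxE lieZr lieDr lieNr lieZr uJt uJw; by_functional.
have JuJx : ⁅J u, J x⁆ = (c / mu) *: w + (nu / mu) *: J t.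
  by rewrite JxE lieZr lieDr lieNr lieZr JuJt JuJw; by_functional.
have xJw : ⁅x, J w⁆ = 0 by rewrite lieC Dx oppr0.
have JxJw : ⁅J x, J w⁆ = 0 by rewrite lieC DJx oppr0.
have XYE : ⁅X, Y⁆ = (J w ∧ u) X Y *: t + (J w ∧ J u) X Y *: J t
   + (u ∧ x) X Y *: ((c / mu) *: w) + (u ∧ J x) X Y *: ((nu / mu) *: t)
   + (J u ∧ J x) X Y *: ((c / mu) *: w + (nu / mu) *: J t).
  rewrite {1}(unitary_expand JJ hJ uf dim6 X) {1}(unitary_expand JJ hJ uf dim6 Y).
  rewrite !lieDl !lieDr !lieZl !lieZr !liexx !cw !cl (lieC u (J u)) (lieC u x).
  rewrite (lieC u (J x)) (lieC (J u) x) (lieC (J u) (J x)) (lieC x (J x)).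
  by rewrite Du DJu Dx DJx uJu xJx ux Jux uJx JuJx uJw JuJw xJw JxJw; by_functional.
have [ww xx wx] : [/\ m w w = 1, m x x = 1 & m w x = 0].
  by rewrite (uf33 uf) (uf22 uf) dotC (uf23 uf).
have [xu wu] : m x u = 0 /\ m w u = 0.
  by rewrite !(dotC m _ u) (uf12 uf) (uf13 uf).
have [xJu wJu wJx] : [/\ m x (J u) = 0, m w (J u) = 0 & m w (J x) = 0].
  rewrite !(dotC m _ (J _)) !(dotJl JJ hJ) (uf1J2 uf) (uf1J3 uf) (uf2J3 uf).
  by rewrite oppr0.
have xw : m x w = 0 by rewrite dotC.
have xJw' : m x (J w) = 0 by rewrite (uf2J3 uf).
have [mxJx mwJw] : m x (J x) = 0 /\ m w (J w) = 0 by split; apply: dotxJx.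
split; last split.
all: rewrite XYE JtE /t !dotE ?hJ ?(dotJl JJ hJ) ?ww ?xx ?wx ?xu ?wu ?xJu ?wJu
  ?wJx ?xw ?xJw' ?mxJx ?mwJw; by field.
Qed.

End TriangularFrameCases.
End CaseDE.

Section NonNilpotentCases.
Local Open Scope complex_scope.
Variables (R : realType) (g : lieAlgebra R) (J : 'End(g)).
Variable m : {dot g for idfun}.
Hypotheses (csJ : complex_structure J) (hJ : hermitian_metric J m).
Hypothesis dim6 : \dim {:g} = 6%N.
Implicit Types (X Y : g) (e : 6.-tuple (dual_space g)).

Let JJ : forall x, J (J x) = - x := csJ.1.

Lemma adapted_of_frame u1 u2 u3 : unitary_frame J m u1 u2 u3 ->
  exists2 e, adapted_basis e J m & forall X,
    [/\ coform e 1 X = m X u1, coform e 2 X = - m X (J u1),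
        coform e 3 X = m X u2, coform e 4 X = - m X (J u2) &
        coform e 5 X = m X u3 /\ coform e 6 X = - m X (J u3)].
Proof.
move=> uf; have [e ae [e1 e2 e3]] := coframe_adapted dim6 (frame_coframe JJ hJ dim6 uf).
exists e => // X; have := e1 X; have := e2 X; have := e3 X.
by rewrite /cform /frame_form => -[-> ->] [-> ->] [-> ->].
Qed.

Lemma sign_sqr (c : R) : c != 0 -> exists neg : bool, exists2 q : R,
  0 < q & c = - ((-1) ^+ neg * q ^+ 2).
Proof.
move=> c0; exists (0 < c), (Num.sqrt `|c|); first by rewrite sqrtr_gt0 normr_gt0.
rewrite sqr_sqrtr ?normr_ge0 //; have [c_gt0|c_le0] := ltP 0 c.
  by rewrite gtr0_norm // expr1 mulN1r opprK.
by rewrite ler0_norm // expr0 mul1r opprK.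
Qed.

Section Coordinates.
Variables (u x w : g) (mu nu c : R).
Hypotheses (uf : unitary_frame J m u x w) (mu_gt0 : 0 < mu) (c0 : c != 0).
Local Notation "f ∧ h" := (fun X Y => m X f * m Y h - m Y f * m X h)
  (at level 40).
Hypothesis coordsE : forall X Y,
  [/\ m ⁅X, Y⁆ u = 0, m ⁅X, Y⁆ (J u) = 0,
    m ⁅X, Y⁆ x = mu * (J w ∧ u) X Y + nu * (u ∧ J x) X Y,
    m ⁅X, Y⁆ (J x) = mu * (J w ∧ J u) X Y + nu * (J u ∧ J x) X Y &
    m ⁅X, Y⁆ w = nu * (J w ∧ u) X Y + c / mu * ((u ∧ x) X Y + (J u ∧ J x) X Y)
      + nu ^+ 2 / mu * (u ∧ J x) X Y /\
    m ⁅X, Y⁆ (J w) = nu * (J w ∧ J u) X Y + nu ^+ 2 / mu * (J u ∧ J x) X Y].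

Lemma case_D_of_coords : nu = 0 -> exists e, adapted_basis e J m /\
  exists neg r s, case_D e neg r s.
Proof.
move=> nu0; have mu0 : mu != 0 by rewrite lt0r_neq0.
have uf' : unitary_frame J m u x (J w).
  case: uf => *; split; rewrite ?hJ ?JJ ?dotNr //; apply/eqP; rewrite oppr_eq0; exact/eqP.
have [e ae eE] := adapted_of_frame uf'; exists e; split=> //.
have [neg [q q_gt0 cE]] := sign_sqr c0; have q0 : q != 0 by rewrite lt0r_neq0.
exists neg, (2 / q), (mu / q); split.
- split; last by rewrite mulf_neq0 ?invr_neq0.
  by rewrite mulf_neq0 ?invr_neq0 ?pnatr_eq0.
- split; apply/dform_eqP => X; have [a1 a2 _ _ [_ a5]] := coordsE (X 0) (X 1);
    have [b1 b2 _ _ [b5 _]] := eE ⁅X 0, X 1⁆.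
  + by rewrite b1 a1 oppr0.
  + by rewrite b2 a2 oppr0.
  + by rewrite b5 a5 nu0 !kformE; ring.
- apply/dform_eqP => X; have [_ _ a3 _ _] := coordsE (X 0) (X 1).
  have [_ _ -> _ _] := eE ⁅X 0, X 1⁆; rewrite a3 !kformE.
  have [-> _ _ _ [-> _]] := eE (X 0); have [-> _ _ _ [-> _]] := eE (X 1).
  by rewrite nu0; field; rewrite ?q0 ?mu0.
- apply/dform_eqP => X; have [_ _ _ a4 _] := coordsE (X 0) (X 1).
  have [_ _ _ -> _] := eE ⁅X 0, X 1⁆; rewrite a4 !kformE.
  have [_ -> _ _ [-> _]] := eE (X 0); have [_ -> _ _ [-> _]] := eE (X 1).
  by rewrite nu0; field; rewrite ?q0 ?mu0.
apply/dform_eqP => X; have [_ _ _ _ [a6 _]] := coordsE (X 0) (X 1).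
have [_ _ _ _ [_ ->]] := eE ⁅X 0, X 1⁆; rewrite JJ dotNr opprK a6 !kformE.
have [-> -> -> -> _] := eE (X 0); have [-> -> -> -> _] := eE (X 1).
by rewrite nu0 cE; field; rewrite ?q0 ?mu0.
Qed.

(** The real plane of x and w, which contains t = mu x + nu w, is turned so that
    one axis, dual to e^6, bisects the angle from x to t. The parameter z is the
    cotangent of half this angle and becomes the quantity st + Z of (E). *)
Lemma case_E_of_coords : 0 < nu -> exists e, adapted_basis e J m /\
  exists neg r s t, case_E e neg r s t.
Proof.
move=> nu_gt0.
have mu0 : mu != 0 by rewrite lt0r_neq0.
have nu0 : nu != 0 by rewrite lt0r_neq0.
pose tau := Num.sqrt (mu ^+ 2 + nu ^+ 2).
have tau2 : tau ^+ 2 = mu ^+ 2 + nu ^+ 2 by rewrite sqr_sqrtr ?addr_ge0 ?sqr_ge0.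
have tau_gt0 : 0 < tau by rewrite sqrtr_gt0 ltr_wpDr ?sqr_ge0 ?exprn_gt0.
have nu_tau : nu < tau.
  by rewrite -(@ltr_pXn2r _ 2) ?nnegrE ?ltW // tau2 ltrDr exprn_gt0.
have [z z_gt1 muE] : exists2 z : R, 1 < z & mu = nu * ((z ^+ 2 - 1) / (2 * z)).
  exists ((tau + mu) / nu).
    by rewrite ltr_pdivlMr // mul1r (lt_trans nu_tau) // ltrDl.
  have tm0 : tau + mu != 0 by rewrite lt0r_neq0 // addr_gt0.
  transitivity (((tau + mu) ^+ 2 - nu ^+ 2) / (2 * (tau + mu))); last first.
    by field; rewrite nu0 tm0.
  have -> : (tau + mu) ^+ 2 - nu ^+ 2 = mu * (2 * (tau + mu)).
    transitivity (tau ^+ 2 + 2 * tau * mu + mu ^+ 2 - nu ^+ 2); first by ring.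
    by rewrite tau2; ring.
  by rewrite mulfK // mulf_neq0 ?pnatr_eq0.
have z0 : z != 0 by rewrite lt0r_neq0 // (lt_trans ltr01).
have z_gt0 : 0 < z by rewrite (lt_trans ltr01).
have zz_gt0 : 0 < z ^+ 2 - 1 by nra.
have zz0 : z ^+ 2 - 1 != 0 by rewrite lt0r_neq0.
have z1_gt0 : 0 < 1 + z ^+ 2 by rewrite ltr_wpDr ?sqr_ge0.
have z10 : 1 + z ^+ 2 != 0 by rewrite lt0r_neq0.
pose n := Num.sqrt (1 + z ^+ 2).
have n2 : n ^+ 2 = 1 + z ^+ 2 by rewrite sqr_sqrtr ?ltW.
have n_gt0 : 0 < n by rewrite sqrtr_gt0.
have n0 : n != 0 by rewrite lt0r_neq0.
have [neg [q q_gt0 cE]] := sign_sqr c0.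
pose f := Num.sqrt q; have f2 : f ^+ 2 = q by rewrite sqr_sqrtr ?ltW.
have f0 : f != 0 by rewrite lt0r_neq0 // sqrtr_gt0.
pose N := Num.sqrt nu; have N2 : N ^+ 2 = nu by rewrite sqr_sqrtr ?ltW.
have N0 : N != 0 by rewrite lt0r_neq0 // sqrtr_gt0.
clearbody tau n f N.
pose y3 := n^-1 *: (z *: w - x); pose y6 := n^-1 *: (z *: x + w).
have nn : n^-1 * n^-1 = (1 + z ^+ 2)^-1 by rewrite -n2 expr2 invfM.
have uf' : unitary_frame J m u y3 (J y6).
  case: uf => h11 h22 h33 h12 h13 h23 h1J2 h1J3 h2J3.
  have h32 : m w x = 0 by rewrite dotC.
  have hJ32 : m w (J x) = 0 by rewrite dotC (dotJl JJ hJ) h2J3 oppr0.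
  have e22 := dotxJx JJ hJ x; have e33 := dotxJx JJ hJ w.
  split; rewrite ?hJ /y3 /y6 ?JJ ?endoE ?JJ ?dotE ?hJ ?(dotJl JJ hJ) ?JJ ?dotNr
    ?h11 ?h22 ?h33 ?h12 ?h13 ?h23 ?h32 ?h1J2 ?h1J3 ?h2J3 ?hJ32 ?e22 ?e33.
  all: try (by ring).
  - by transitivity (n^-1 * n^-1 * (1 + z ^+ 2)); [ring | rewrite nn mulVf].
  - by transitivity (n^-1 * n^-1 * (1 + z ^+ 2)); [ring | rewrite nn mulVf].
have [e ae eE] := adapted_of_frame uf'; exists e; split=> //.
have xwE X : [/\ m X u = coform e 1 X, m X (J u) = - coform e 2 X,
    m X x = n * ((- coform e 3 X + z * coform e 6 X) / (1 + z ^+ 2)),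
    m X (J x) = n * ((coform e 4 X + z * coform e 5 X) / (1 + z ^+ 2)) &
    m X w = n * ((z * coform e 3 X + coform e 6 X) / (1 + z ^+ 2)) /\
    m X (J w) = n * ((coform e 5 X - z * coform e 4 X) / (1 + z ^+ 2))].
  have [-> -> -> -> [-> ->]] := eE X.
  rewrite /y3 /y6 ?endoE ?JJ ?endoE !dotE.
  by split; [|ring| | |split]; field; rewrite ?n0 ?z10.
(* T is the length tau of t in terms of nu and z. The product s t = T / nu is
   the half-sum of z and 1 / z, so that Z is their half-difference. *)
pose T := N ^+ 2 * ((1 + z ^+ 2) / (2 * z)).
exists neg, (- (2 / f ^+ 2)), (T / (N * f)), (f / N).
have T0 : T != 0 by rewrite !mulf_neq0 ?invr_neq0 ?expf_neq0 ?mulf_neq0 ?pnatr_eq0.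
have stE : (T / (N * f)) ^+ 2 * (f / N) ^+ 2 = ((1 + z ^+ 2) / (2 * z)) ^+ 2.
  by rewrite /T; field; rewrite ?N0 ?f0 ?z0.
have ZE : Num.sqrt ((T / (N * f)) ^+ 2 * (f / N) ^+ 2 - 1) = (z ^+ 2 - 1) / (2 * z).
  rewrite stE.
  have -> : ((1 + z ^+ 2) / (2 * z)) ^+ 2 - 1 = ((z ^+ 2 - 1) / (2 * z)) ^+ 2.
    by field.
  by rewrite sqrtr_sqr ger0_norm // divr_ge0 ?mulr_ge0 ?ler0n // ltW.
have szE : T / (N * f) * (f / N) + (z ^+ 2 - 1) / (2 * z) = z.
  by rewrite /T; field; rewrite ?N0 ?f0 ?z0.
rewrite /case_E /= ZE szE.
have e6E X Y : [/\ coform e 3 ⁅X, Y⁆ = n^-1 * (z * m ⁅X, Y⁆ w - m ⁅X, Y⁆ x),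
    coform e 4 ⁅X, Y⁆ = - (n^-1 * (z * m ⁅X, Y⁆ (J w) - m ⁅X, Y⁆ (J x))),
    coform e 5 ⁅X, Y⁆ = n^-1 * (z * m ⁅X, Y⁆ (J x) + m ⁅X, Y⁆ (J w)) &
    coform e 6 ⁅X, Y⁆ = n^-1 * (z * m ⁅X, Y⁆ x + m ⁅X, Y⁆ w)].
  have [_ _ -> -> [-> ->]] := eE ⁅X, Y⁆.
  by rewrite /y3 /y6 ?endoE ?JJ ?endoE !dotE; split; ring.
split; [| | | | split].
- split; rewrite ?oppr_eq0 ?mulf_neq0 ?invr_neq0 ?expf_neq0 ?mulf_neq0 ?pnatr_eq0 //.
  rewrite stE -subr_gt0.
  have -> : ((1 + z ^+ 2) / (2 * z)) ^+ 2 - 1 = ((z ^+ 2 - 1) / (2 * z)) ^+ 2.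
    by field.
  by rewrite exprn_gt0 // divr_gt0 // mulr_gt0 // ltr0n.
- by split; apply/dform_eqP => X; have [a1 a2 _ _ _] := coordsE (X 0) (X 1);
    have [b1 b2 _ _ _] := eE ⁅X 0, X 1⁆; rewrite ?b1 ?b2 ?a1 ?a2 oppr0.
all: apply/dform_eqP => X; have [_ _ a3 a4 [a5 a6]] := coordsE (X 0) (X 1).
all: have [b3 b4 b5 b6] := e6E (X 0) (X 1).
all: rewrite ?b3 ?b4 ?b5 ?b6 ?a3 ?a4 ?a5 ?a6 !kformE.
all: have [p1 p2 p3 p4 [p5 p6]] := xwE (X 0).
all: have [q1 q2 q3 q4 [q5 q6]] := xwE (X 1).
all: rewrite ?p1 ?p2 ?p3 ?p4 ?p5 ?p6 ?q1 ?q2 ?q3 ?q4 ?q5 ?q6.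
all: rewrite ?cE -?f2 ?muE -?N2 /T; try move: ((-1) ^+ neg) => eps.
all: by field; rewrite ?n0 ?N0 ?f0 ?z0 ?zz0 ?z10.
Qed.
End Coordinates.

Hypotheses (nilp : lie_nilpotent g) (bal : balanced J m).

Lemma non_nilpotent_cases :
  (forall v, (forall x, ⁅x, v⁆ = 0) -> (forall x, ⁅x, J v⁆ = 0) -> v = 0) ->
  exists e, adapted_basis e J m /\
    ((exists neg r s, case_D e neg r s) \/
     (exists neg r s t, case_E e neg r s t)).
Proof.
move=> noJ.
have [u [x [w [mu [nu [uf [mu_gt0 nu_ge0] cw [Du DJu] [Dx DJx]]]]]]] :=
  exists_triangular_frame csJ hJ dim6 nilp noJ.
have [c c0 [uJu xJx [ut JuJt uJt Jut]]] :=
  triangular_frame_brackets csJ hJ dim6 nilp bal noJ uf mu_gt0 cw Du DJu Dx DJx.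
have DJu' : ⁅J w, J u⁆ = J (mu *: x + nu *: w) by rewrite DJu !endoE.
have coordsE := triangular_frame_coords csJ hJ dim6 uf mu_gt0 cw Du DJu' Dx DJx
  uJu xJx ut JuJt uJt Jut.
have [nu0|nu0] := eqVneq nu 0.
  have [e [ae eD]] := case_D_of_coords uf mu_gt0 c0 coordsE nu0.
  by exists e; split=> //; left.
have nu_gt0 : 0 < nu by rewrite lt0r nu0.
have [e [ae eE]] := case_E_of_coords uf mu_gt0 c0 coordsE nu_gt0.
by exists e; split=> //; right.
Qed.
End NonNilpotentCases.

(** * The classification *)

Section Claims.
Local Open Scope complex_scope.
Variables (R : realType) (g : lieAlgebra R) (J : 'End(g)).
Variable m : {dot g for idfun}.
Hypotheses (csJ : complex_structure J) (hJ : hermitian_metric J m).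
Hypothesis dim6 : \dim {:g} = 6%N.
Implicit Types (X Y : g) (e : 6.-tuple (dual_space g)).

Let JJ : forall x, J (J x) = - x := csJ.1.

Lemma complex_real_eq0 (x : R) : (x%:C == 0 :> R[i]) = (x == 0).
Proof. by rewrite -(rmorph0 (real_complex R)) (inj_eq (@complexI R)). Qed.

Lemma balanced_cases : ~ lie_abelian g -> lie_nilpotent g -> balanced J m ->
  exists e, adapted_basis e J m /\
    [\/ exists t, case_A e t,
        exists rho b s t, case_B e rho b s t,
        exists rho b s t u1 u2, case_C e rho b s t u1 u2 |
        (exists neg r s, case_D e neg r s) \/
        (exists neg r s t, case_E e neg r s t)].
Proof.
move=> nab nilp bal.
case: (pselect (forall v, (forall x, ⁅x, v⁆ = 0) -> (forall x, ⁅x, J v⁆ = 0) ->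
    v = 0)) => [noJ|/existsNP[v /not_implyP[cv /not_implyP[cJv /eqP v0]]]].
  have [e [ae de]] := non_nilpotent_cases csJ hJ dim6 nilp bal noJ.
  by exists e; split=> //; constructor 4.
have [a _ a1] := exists_unit_scale m v0.
have [u1 [u2 uf]] := exists_frame2 J dim6 a1.
have cav x : ⁅x, a *: v⁆ = 0 by rewrite lieZr cv scaler0.
have cJav x : ⁅x, J (a *: v)⁆ = 0 by rewrite endoZ lieZr cJv scaler0.
have [rho [A [B [C ts]]]] := two_step_of_central_plane csJ hJ dim6 uf cav cJav nilp bal.
have uc := frame_coframe JJ hJ dim6 uf.
have [e [ae [eA|eB|eC]]] := two_step_cases dim6 nab uc ts; exists e; split=> //.
- by constructor 1.
- by constructor 2.
- by constructor 3.
Qed.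

Lemma case_A_claims e t : adapted_basis e J m -> case_A e t ->
  [/\ parallelizable_cs J, lie_iso g (h5 R) & iwasawa_cs J].
Proof.
move=> ae /case_A_two_step[t0 ts]; have uc := adapted_coframe JJ ae.
have [h1 h2 h3 _] := uc.
split.
- move=> X Y; apply/eqP; rewrite -subr_eq0; apply/eqP.
  have [x1 x2 x3] := ts X Y; have [y1 y2 y3] := ts (J X) Y.
  apply: (coframe_inj uc).
  + by rewrite (form10D _ _ h1) (form10N _ h1) (form10J _ h1) x1 y1; ring.
  + by rewrite (form10D _ _ h2) (form10N _ h2) (form10J _ h2) x2 y2; ring.
  + rewrite (form10D _ _ h3) (form10N _ h3) (form10J _ h3) x3 y3 /prim_form.
    by rewrite /wform (form10J _ h1) (form10J _ h2); ring.
- have [x1 [x2 [x3 [x4 [x5 [x6 [inj [x1E x2E] [x3E x4E] x5E x6E]]]]]]] :=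
    two_step_real_forms uc ts.
  have tt : (t + 0) * (t - 0) = t ^+ 2 by ring.
  apply: (normal_form_h5 dim6 inj x1E x2E x3E x4E x5E x6E); rewrite tt.
    by rewrite sqrf_eq0.
  by right; rewrite mulr0 expr0n exprn_even_gt0.
have tC0 : (t^-1)%:C != 0 :> R[i] by rewrite complex_real_eq0 invr_eq0.
exists (cform e 1), (cform e 3), (fun X => (t^-1)%:C * cform e 5 X); split.
- apply: is_10_basis_of_inj => //; first exact: form10_scale.
  move=> X z1 z2 /eqP; rewrite mulf_eq0 (negPf tC0) /= => /eqP z3.
  exact: (coframe_inj uc).
- by apply: funext => X; rewrite ext_d1E; have [-> _ _] := ts (X 0) (X 1); rewrite oppr0.
- by apply: funext => X; rewrite ext_d1E; have [_ -> _] := ts (X 0) (X 1); rewrite oppr0.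
apply: funext => X; rewrite ext_d1E wedge11E; have [_ _ ->] := ts (X 0) (X 1).
transitivity ((t^-1)%:C * t%:C * wform (cform e 1) (cform e 3) (X 0) (X 1)).
  by rewrite /prim_form; ring.
by rewrite -rmorphM /= mulVf // mul1r /wform.
Qed.

Lemma case_B_claims e rho b s t : ~ lie_abelian g -> adapted_basis e J m ->
  case_B e rho b s t ->
  [/\ nilpotent_cs J,
      lie_iso g (h2 R) \/ lie_iso g (h3 R) \/ lie_iso g (h4 R) \/
      lie_iso g (h5 R) \/ lie_iso g (h6 R),
      abelian_cs J <-> rho = 0 &
      abelian_cs J -> exists e' b' s' t', [/\ adapted_basis e' J m,
        b' ^+ 2 = 0 \/ b' ^+ 2 = 1 & case_B e' 0 b' s' t']].
Proof.
move=> nab ae /case_B_two_step[rho01 [s0 t0] ts].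
have uc := adapted_coframe JJ ae.
have abE : abelian_cs J <-> rho = 0.
  rewrite (two_step_abelian_cs dim6 uc ts); split=> [/eqP|->]; last by rewrite mulr0.
  by rewrite complex_real_eq0 !mulf_eq0 invr_eq0 (negPf s0) (negPf t0) /= => /eqP.
split=> //.
- exact: two_step_nilpotent uc ts.
- by have [] := two_step_models dim6 nab uc ts.
move=> /abE rho0; rewrite rho0 in ts; have [b0|b0] := eqVneq b 0.
  exists e, b, s, t; split=> //; first by left; rewrite b0 expr0n.
  by apply/case_B_two_step; split=> //; left.
(* For rho = 0 the equations only depend on b and s through b^2 / s. *)
exists e, 1, (s / b ^+ 2), t; split=> //; first by right; rewrite expr1n.
apply/case_B_two_step; split=> //; first by left.
  by rewrite mulf_neq0 ?invr_neq0 ?expf_neq0.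
move: ts; congr (two_step _ _ _ _ _ _ _); congr (_%:C); field; rewrite ?s0 ?b0 //.
Qed.

Lemma case_C_claims e rho b s t u1 u2 : ~ lie_abelian g ->
  adapted_basis e J m -> case_C e rho b s t u1 u2 ->
  [/\ nilpotent_cs J,
      lie_iso g (h2 R) \/ lie_iso g (h3 R) \/ lie_iso g (h4 R) \/
      lie_iso g (h5 R) \/ lie_iso g (h6 R),
      abelian_cs J <-> rho = 0 &
      abelian_cs J -> exists e' b' s' t' u1' u2', [/\ adapted_basis e' J m,
        b' ^+ 2 = 0 \/ b' ^+ 2 = 1 & case_C e' 0 b' s' t' u1' u2']].
Proof.
move=> nab ae /[dup] eC /case_C_two_step.
set md := Num.sqrt _; set y := _ / (md * t).
move=> [[rho01 t0 /andP[md_gt0 md_lt]] ts].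
have uc := adapted_coframe JJ ae.
have md0 : md != 0 by apply: contraTneq md_gt0 => ->; rewrite expr0n ltxx.
have s0 : s != 0.
  by apply: contraTneq md_lt => ->; rewrite expr0n -leNgt sqr_ge0.
have y0 : y != 0.
  rewrite !mulf_neq0 ?invr_neq0 ?mulf_neq0 ?pnatr_eq0 //.
  by rewrite sqrtr_eq0 -ltNge subr_gt0.
have uJ0 : u1 -i* u2 != 0 :> R[i].
  apply: contraNneq md0 => /eqP; rewrite eq_complex /= oppr_eq0 => /andP[/eqP u10 /eqP u20].
  by rewrite /md u10 u20 expr0n addr0 sqrtr0.
have yE : y = 2 * Num.sqrt (s ^+ 2 - md ^+ 2) / (md * t) by [].
clearbody y.
have abE : abelian_cs J <-> rho = 0.
  rewrite (two_step_abelian_cs dim6 uc ts); split=> [/eqP|->]; last first.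
    by apply/eqP; rewrite mulf_eq0 complex_real_eq0 !(mulr0, mul0r) eqxx.
  rewrite mulf_eq0 (negPf uJ0) orbF complex_real_eq0 !mulf_eq0 pnatr_eq0.
  by rewrite (negPf s0) (negPf y0) /= orbF => /eqP.
split=> //.
- exact: two_step_nilpotent uc ts.
- by have [] := two_step_models dim6 nab uc ts.
move=> /abE rho0; rewrite rho0 in ts eC; have [b0|b0] := eqVneq b 0.
  by exists e, b, s, t, u1, u2; split=> //; left; rewrite b0 expr0n.
(* For rho = 0 the equations are homogeneous: b^2, s, u have weight one and t
   has weight four, since Y has the weight of 1 / t and is multiplied by terms
   of degree four. *)
exists e, 1, (s / b ^+ 2), (t / b ^+ 8), (u1 / b ^+ 2), (u2 / b ^+ 2).
split=> //; first by right; rewrite expr1n.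
apply/case_C_two_step.
have b2_gt0 : 0 < b ^+ 2 by rewrite exprn_even_gt0.
have b2_neq0 : b ^+ 2 != 0 by rewrite lt0r_neq0.
have sqrtV x : Num.sqrt (x / b ^+ 2 ^+ 2) = Num.sqrt x / b ^+ 2.
  rewrite mulrC -exprVn sqrtrM ?sqr_ge0 // sqrtr_sqr ger0_norm ?invr_ge0 ?ltW //.
  by rewrite mulrC.
have -> : (u1 / b ^+ 2) ^+ 2 + (u2 / b ^+ 2) ^+ 2 =
    (u1 ^+ 2 + u2 ^+ 2) / b ^+ 2 ^+ 2 by field.
rewrite sqrtV -/md.
have -> : (s / b ^+ 2) ^+ 2 - (md / b ^+ 2) ^+ 2 =
    (s ^+ 2 - md ^+ 2) / b ^+ 2 ^+ 2 by field.
rewrite sqrtV.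
have -> : 2 * (Num.sqrt (s ^+ 2 - md ^+ 2) / b ^+ 2) /
    (md / b ^+ 2 * (t / b ^+ 8)) = b ^+ 8 * y.
  by rewrite yE; field; rewrite md0 t0 b0.
split.
  split; [by left | by rewrite mulf_neq0 ?invr_neq0 ?expf_neq0 |].
  rewrite !expr_div_n; apply/andP; split; first by rewrite divr_gt0 // exprn_gt0.
  by rewrite ltr_pM2r // invr_gt0 exprn_gt0.
clear yE; clearbody md; move: ts.
have -> : (u1 / b ^+ 2) -i* (u2 / b ^+ 2) = (b ^- 2)%:C * (u1 -i* u2).
  by apply: complex_ext; rewrite !ReImE /=; field.
congr (two_step _ _ _ _ _ _ _).
- by apply: complex_ext; rewrite !ReImE /=; field.
- by apply: complex_ext; rewrite !ReImE /=; field.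
- by apply: complex_ext; rewrite !ReImE /=; field.
- by apply: complex_ext; rewrite !ReImE /=; field.
Qed.

Lemma case_DE_claims e neg : adapted_basis e J m ->
  (exists r s, case_D e neg r s) \/ (exists r s t, case_E e neg r s t) ->
  [/\ lie_iso g (h19m R), ~ nilpotent_cs J, ~ abelian_cs J &
      forall neg', J0_cs J neg' <-> neg' = neg].
Proof.
move=> ae de; have jneg : J0_cs J neg.
  case: de => [[r [s eD]]|[r [s [t eE]]]].
    exact: case_D_J0 eD.
  exact: case_E_J0 eE.
have /(J0_cs_forms csJ hJ dim6)[w1 [w2 [w3 j0]]] := jneg.
have sq : ((-1) ^+ neg : R) ^+ 2 = 1 by rewrite sqrr_sign.
split.
- exact: (J0_lie_iso_h19m dim6 sq j0).
- exact: (J0_not_nilpotent dim6 sq j0).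
- exact: (J0_not_abelian dim6 j0).
by move=> neg'; split=> [/(J0_cs_sign csJ hJ dim6 jneg)|->].
Qed.
End Claims.

Theorem theorem2p11 (R : realType) (M : nilmanifold R) (J : 'End(M))
    (m : {dot M for idfun}) :
  \dim (fullv : {vspace M}) = 6%N ->
  ~ lie_abelian M ->
  complex_structure J -> hermitian_metric J m -> balanced J m ->
  (exists e : 6.-tuple (dual_space M), adapted_basis e J m /\
    [\/ exists t, case_A e t,
        exists rho b s t, case_B e rho b s t,
        exists rho b s t u1 u2, case_C e rho b s t u1 u2 |
        (exists neg r s, case_D e neg r s) \/
        (exists neg r s t, case_E e neg r s t)]) /\
  (forall e : 6.-tuple (dual_space M), adapted_basis e J m ->
    [/\ (forall t, case_A e t ->
           [/\ parallelizable_cs J, lie_iso M (h5 R) & iwasawa_cs J]),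
        (forall rho b s t, case_B e rho b s t ->
           [/\ nilpotent_cs J,
               lie_iso M (h2 R) \/ lie_iso M (h3 R) \/ lie_iso M (h4 R) \/
               lie_iso M (h5 R) \/ lie_iso M (h6 R),
               abelian_cs J <-> rho = 0 &
               abelian_cs J ->
                 exists e' b' s' t', [/\ adapted_basis e' J m,
                   b' ^+ 2 = 0 \/ b' ^+ 2 = 1 & case_B e' 0 b' s' t']]),
        (forall rho b s t u1 u2, case_C e rho b s t u1 u2 ->
           [/\ nilpotent_cs J,
               lie_iso M (h2 R) \/ lie_iso M (h3 R) \/ lie_iso M (h4 R) \/
               lie_iso M (h5 R) \/ lie_iso M (h6 R),
               abelian_cs J <-> rho = 0 &
               abelian_cs J ->
                 exists e' b' s' t' u1' u2', [/\ adapted_basis e' J m,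
                   b' ^+ 2 = 0 \/ b' ^+ 2 = 1 &
                   case_C e' 0 b' s' t' u1' u2']]) &
        (forall neg, (exists r s, case_D e neg r s) \/
                     (exists r s t, case_E e neg r s t) ->
           [/\ lie_iso M (h19m R), ~ nilpotent_cs J &
               forall neg', J0_cs J neg' <-> neg' = neg])]) /\
  (abelian_cs J ->
    (lie_iso M (h3 R) \/ lie_iso M (h5 R)) /\
    exists e : 6.-tuple (dual_space M), adapted_basis e J m /\
      ((exists b s t, case_B e 0 b s t) \/
       (exists b s t u1 u2, case_C e 0 b s t u1 u2))).
Proof.
move=> dim6 nab csJ hJ bal.
have JJ := csJ.1.
have [e0 [ae0 cases0]] := balanced_cases csJ hJ dim6 nab (nm_nilpotent M) bal.
split; first by exists e0.
split.
  move=> e ae; split.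
  - by move=> t; apply: (case_A_claims csJ dim6 ae).
  - by move=> rho b s t; apply: (case_B_claims csJ dim6 nab ae).
  - by move=> rho b s t u1 u2; apply: (case_C_claims csJ dim6 nab ae).
  - by move=> neg /(case_DE_claims csJ hJ dim6 ae)[? ? _ ?].
move=> ab.
case: cases0 => [[t eA]|[rho [b [s [t eB]]]]|[rho [b [s [t [u1 [u2 eC]]]]]]|eDE].
- move/case_A_two_step: eA => [t0 ts]; have uc := adapted_coframe JJ ae0.
  move/(two_step_abelian_cs dim6 uc ts): ab => /eqP.
  by rewrite complex_real_eq0 (negPf t0).
- have [_ _ abE _] := case_B_claims csJ dim6 nab ae0 eB; have rho0 := abE.1 ab.
  move/case_B_two_step: (eB) => [_ _ ts]; have uc := adapted_coframe JJ ae0.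
  have [_ /(_ ab) iso] := two_step_models dim6 nab uc ts.
  by split=> //; exists e0; split=> //; left; exists b, s, t; rewrite -rho0.
- have [_ _ abE _] := case_C_claims csJ dim6 nab ae0 eC; have rho0 := abE.1 ab.
  move/case_C_two_step: (eC) => [_ ts]; have uc := adapted_coframe JJ ae0.
  have [_ /(_ ab) iso] := two_step_models dim6 nab uc ts.
  by split=> //; exists e0; split=> //; right; exists b, s, t, u1, u2; rewrite -rho0.
have [neg dneg] : exists neg, (exists r s, case_D e0 neg r s) \/
    (exists r s t, case_E e0 neg r s t).
  case: eDE => [[neg [r [s eD]]]|[neg [r [s [t eE]]]]]; exists neg.
    by left; exists r, s.
  by right; exists r, s, t.
by have [_ _ /(_ ab)] := case_DE_claims csJ hJ dim6 ae0 dneg.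
Qed.
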